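(* Let $(\mathcal E,\mathfrak a,\mathfrak b)$ be a quasi-twilled Lie conformal algebra with structure $\Omega=\widehat\psi+\widehat\nu_1+\widehat\nu_2$. Set $$L:=\bigoplus_{n\ge0}\mathscr C^{n+1}(\mathcal E,\mathcal E),\qquad F:=\bigoplus_{n\ge0}\mathscr C^{n+1}(\mathfrak b,\mathfrak a),$$ let $\mathbf P:L\to L$ be the projection onto $F$, and set $\Delta:=\Omega$. Then $(L,F,\mathbf P,\Delta)$ is a $V$-data, and the resulting $L_\infty$-algebra on $F$ is $\bigl(\bigoplus_{n\ge0}\mathscr C^{n+1}(\mathfrak b,\mathfrak a),l_1,l_2,l_3\bigr)$ with $$l_1(f)=[\widehat\nu_2,\widehat f\,]_{NR},\quad l_2(f_1,f_2)=[[\widehat\nu_1,\widehat f_1]_{NR},\widehat f_2]_{NR},\quad l_3(f_1,f_2,f_3)=[[[\widehat\psi,\widehat f_1]_{NR},\widehat f_2]_{NR},\widehat f_3]_{NR},$$ and $l_k=0$ for $k\ge4$. Moreover, a $\mathbb C[\partial]$-module homomorphism $B:\mathfrak b\to\mathfrak a$ is a left deformation map of $(\mathcal E,\mathfrak a,\mathfrak b)$ if and only if $B$ is a Maurer-Cartan element: $$l_1(B)+\tfrac12l_2(B,B)+\tfrac16l_3(B,B,B)=0.$$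
   Context: All vector spaces and linear maps are over $\mathbb C$, and all $\mathbb C[\partial]$-modules are finitely generated. A Lie conformal algebra is a $\mathbb C[\partial]$-module $\mathcal E$ with a $\mathbb C$-linear map $\mathcal E\otimes\mathcal E\to\mathcal E[\lambda]$, $x\otimes y\mapsto\{x_\lambda y\}$, such that $\{\partial x_\lambda y\}=-\lambda\{x_\lambda y\}$, $\{x_\lambda\partial y\}=(\partial+\lambda)\{x_\lambda y\}$, $\{x_\lambda y\}=-\{y_{-\lambda-\partial}x\}$ and $\{x_\lambda\{y_\mu z\}\}=\{\{x_\lambda y\}_{\lambda+\mu}z\}+\{y_\mu\{x_\lambda z\}\}$ ($\partial$ in a subscript acts from the left on the coefficients). A quasi-twilled Lie conformal algebra $(\mathcal E,\mathfrak a,\mathfrak b)$ is a Lie conformal algebra with a $\mathbb C[\partial]$-module decomposition $\mathcal E=\mathfrak a\oplus\mathfrak b$ such that $\mathfrak b$ is a Lie conformal subalgebra. For $a,b\in\mathfrak a$, $u,v\in\mathfrak b$ set $\{a_\lambda b\}_{\mathfrak a}=\mathrm{pr}_{\mathfrak a}\{a_\lambda b\}$, $\psi_{1,\lambda}(a,b)=\mathrm{pr}_{\mathfrak b}\{a_\lambda b\}$, $\varrho_{\mathfrak b}(u)_\lambda a=\mathrm{pr}_{\mathfrak a}\{u_\lambda a\}$, $\varrho_{\mathfrak a}(a)_\lambda v=\mathrm{pr}_{\mathfrak b}\{a_\lambda v\}$, $\{u_\lambda v\}_{\mathfrak b}=\{u_\lambda v\}$. A left deformation map is a $\mathbb C[\partial]$-module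 homomorphism $B:\mathfrak b\to\mathfrak a$ whose graph $\{(B(u),u)\mid u\in\mathfrak b\}$ is a Lie conformal subalgebra of $\mathcal E$. Cochains: for $\mathbb C[\partial]$-modules $M,N$ and $k\ge1$, $\mathscr C^k(M,N)$ is the space of $\mathbb C$-linear maps $\varphi:M^{\otimes k}\to\mathbb C[\lambda_1,\dots,\lambda_{k-1}]\otimes N$ such that, with $\lambda_k^\ddagger:=-\sum_{j=1}^{k-1}\lambda_j-\partial$ ($\partial$ acting on $N$ from the left), (i) $\varphi(\dots,\partial a_i,\dots)=-\lambda_i\varphi(\dots,a_i,\dots)$ for $1\le i\le k-1$ and $\varphi(\dots,\partial a_k)=-\lambda_k^\ddagger\varphi(\dots,a_k)$; (ii) for every permutation $\sigma$, $\varphi_{\lambda_1,\dots,\lambda_{k-1}}(a_1,\dots,a_k)=(-1)^\sigma\varphi_{\lambda_{\sigma(1)},\dots,\lambda_{\sigma(k-1)}}(a_{\sigma(1)},\dots,a_{\sigma(k)})|_{\lambda_k\mapsto\lambda_k^\ddagger}$. In particular $\mathscr C^1(M,N)=\mathrm{Hom}_{\mathbb C[\partial]}(M,N)$. Nijenhuis-Richardson bracket: for $f\in\mathscr C^m(\mathcal E,\mathcal E)$, $g\in\mathscr C^n(\mathcal E,\mathcal E)$, $[f,g]_{NR}:=f\star g-(-1)^{(m-1)(n-1)}g\star f\in\mathscr C^{m+n-1}(\mathcal E,\mathcal E)$, where $$(f\star g)_{\lambda_1,\dots,\lambda_{m+n-2}}(x_1,\dots,x_{m+n-1})=\sum_{\sigma}(-1)^\sigma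 f_{\lambda_{\sigma(1)}+\cdots+\lambda_{\sigma(n)},\lambda_{\sigma(n+1)},\dots,\lambda_{\sigma(m+n-2)}}\bigl(g_{\lambda_{\sigma(1)},\dots,\lambda_{\sigma(n-1)}}(x_{\sigma(1)},\dots,x_{\sigma(n)}),x_{\sigma(n+1)},\dots,x_{\sigma(m+n-1)}\bigr)\big|_{\lambda_{m+n-1}\mapsto\lambda_{m+n-1}^\ddagger},$$ summed over $(n,m-1)$-unshuffles $\sigma$ (i.e. $\sigma(1)<\dots<\sigma(n)$ and $\sigma(n+1)<\dots<\sigma(m+n-1)$). With $\mathscr C^{n+1}(\mathcal E,\mathcal E)$ in degree $n$, this is a graded Lie algebra. Components: $\Omega\in\mathscr C^2(\mathcal E,\mathcal E)$ is the $\lambda$-bracket of $\mathcal E$, and $\Omega=\widehat\psi+\widehat\nu_1+\widehat\nu_2$ with $\widehat\psi_\lambda((a,u),(b,v))=(0,\psi_{1,\lambda}(a,b))$, $\widehat\nu_{1,\lambda}((a,u),(b,v))=(\{a_\lambda b\}_{\mathfrak a},\varrho_{\mathfrak a}(a)_\lambda v-\varrho_{\mathfrak a}(b)_{-\lambda-\partial}u)$, $\widehat\nu_{2,\lambda}((a,u),(b,v))=(\varrho_{\mathfrak b}(u)_\lambda b-\varrho_{\mathfrak b}(v)_{-\lambda-\partial}a,\{u_\lambda v\}_{\mathfrak b})$. For $f\in\mathscr C^k(\mathfrak b,\mathfrak a)$, the lift is $\widehat f((a_1,u_1),\dots,(a_k,u_k))=(f(u_1,\dots,u_k),0)$; $F$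 is identified with its image in $L$ under $f\mapsto\widehat f$ (with $\mathscr C^{n+1}(\mathfrak b,\mathfrak a)$ in degree $n$). The projection $\mathbf P$ sends $h\in\mathscr C^k(\mathcal E,\mathcal E)$ to the lift of $\mathrm{pr}_{\mathfrak a}\circ h|_{\mathfrak b^{\otimes k}}$. A $V$-data is a quadruple $(L,F,\mathbf P,\Delta)$ where $L$ is a graded Lie algebra, $F$ an abelian graded Lie subalgebra, $\mathbf P:L\to L$ a projection with image $F$ whose kernel is a graded Lie subalgebra, and $\Delta\in\ker(\mathbf P)^1$ with $[\Delta,\Delta]=0$. By Voronov's construction, the resulting $L_\infty$-algebra on $F$ has $l_k(f_1,\dots,f_k)=\mathbf P([\cdots[[\Delta,f_1],f_2],\cdots,f_k])$, $k\ge1$. Here an $L_\infty$-algebra on a graded space $F$ (in Voronov's convention) is a family of graded symmetric multilinear maps $l_k:F^{\otimes k}\to F$, $k\ge1$, of degree $1$ such that for all $n\ge1$ and homogeneous $v_1,\dots,v_n$, $\sum_{i=1}^n\sum_{\sigma}\varepsilon(\sigma)\,l_{n-i+1}(l_i(v_{\sigma(1)},\dots,v_{\sigma(i)}),v_{\sigma(i+1)},\dots,v_{\sigma(n)})=0$, the inner sum being over $(i,n-i)$-unshuffles and $\varepsilon(\sigma)$ the Koszul sign. A Maurer-Cartan element is a degree $0$ element $\alpha$ with $\sum_{k\ge1}\frac1{k!}l_k(\alpha,\dots,\alpha)=0$. *)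

(* Defs.v *)
From HB Require Import structures.
From mathcomp Require Import all_boot all_algebra all_fingroup.
From mathcomp Require Import -(notations) monalg.
From mathcomp Require Import finmap mpoly complex boolp reals.

Set Implicit Arguments.
Unset Strict Implicit.
Unset Printing Implicit Defensive.

Import GRing.Theory.

Local Open Scope ring_scope.

(* A C[∂]-module is an [lmodType {poly K}]; ∂ acts as the scalar ['X] and a   *)
(* constant c of the ground field as [c%:P].                                  *)

Definition fin_gen (A : pzRingType) (N : lmodType A) : Prop :=
  exists s : seq N, forall x : N,
    exists c : nat -> A, x = \sum_(i < size s) c i *: s`_i.

(* [lpoly N n] is N[λ_1, ..., λ_n] for a module N over A = C[∂], as the        *)
(* finitely supported families of coefficients. It is a module over            *)
(* A[λ_1, ..., λ_n], with A acting on the coefficients; [ltensor p x] is       *)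
(* p ⊗ x. Locking keeps failed unifications from unfolding the sums.           *)
Definition lpoly (A : comNzRingType) (N : lmodType A) (n : nat) : Type :=
  monalg.malg 'X_{1..n} N.
HB.instance Definition _ (A : comNzRingType) (N : lmodType A) n :=
  GRing.Zmodule.copy (lpoly N n) (monalg.malg 'X_{1..n} N).

Section Coefficients.
Variables (A : comNzRingType) (N : lmodType A) (n : nat).

Definition lmono (m : 'X_{1..n}) (x : N) : lpoly N n := monalg.mkmalgU m x.
Definition lcoef (m : 'X_{1..n}) (P : lpoly N n) : N := monalg.mcoeff m P.
Definition lsupp (P : lpoly N n) : seq 'X_{1..n} := monalg.msupp P.
Definition lconst (x : N) : lpoly N n := lmono 0%MM x.

End Coefficients.

HB.lock Definition ltensor (A : comNzRingType) (N : lmodType A) (n : nat)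
    (p : {mpoly A[n]}) (x : N) : lpoly N n :=
  \sum_(m <- msupp p) lmono m (p@_m *: x).

HB.lock Definition lscale (A : comNzRingType) (N : lmodType A) (n : nat)
    (p : {mpoly A[n]}) (P : lpoly N n) : lpoly N n :=
  \sum_(m <- lsupp P) ltensor (p * 'X_[m]) (lcoef m P).

Section LambdaPolynomials.
Variable A : comNzRingType.
Implicit Types (M N : lmodType A) (n : nat).

Lemma lpolyP N n (P Q : lpoly N n) :
  (forall m, lcoef m P = lcoef m Q) -> P = Q.
Proof. by move=> h; apply/monalg.malgP. Qed.

Lemma lcoefD N n m (P Q : lpoly N n) : lcoef m (P + Q) = lcoef m P + lcoef m Q.
Proof. exact: monalg.mcoeffD. Qed.

Lemma lcoef0 N n m : lcoef m (0 : lpoly N n) = 0.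
Proof. exact: monalg.mcoeff0. Qed.

Lemma lcoef_sum N n m (I : Type) (r : seq I) (F : I -> lpoly N n) :
  lcoef m (\sum_(i <- r) F i) = \sum_(i <- r) lcoef m (F i).
Proof. by apply: (big_morph _ (lcoefD m) (lcoef0 _ m)). Qed.

Lemma lcoef_mono N n (m k : 'X_{1..n}) (x : N) :
  lcoef k (lmono m x) = x *+ (m == k).
Proof. exact: monalg.mcoeffU. Qed.

Lemma lmonoE N n (P : lpoly N n) : P = \sum_(m <- lsupp P) lmono m (lcoef m P).
Proof. exact: monalg.monalgE. Qed.

Lemma lsupp_uniq N n (P : lpoly N n) : uniq (lsupp P).
Proof. exact: fset_uniq. Qed.

Lemma lcoef_out N n (P : lpoly N n) m : m \notin lsupp P -> lcoef m P = 0.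
Proof. exact: monalg.mcoeff_outdom. Qed.

Lemma ltensorE N n (p : {mpoly A[n]}) (x : N) :
  ltensor p x = \sum_(m <- msupp p) lmono m (p@_m *: x).
Proof. by rewrite unlock. Qed.

Lemma lcoef_tensor N n (p : {mpoly A[n]}) (x : N) k :
  lcoef k (ltensor p x) = p@_k *: x.
Proof.
rewrite ltensorE lcoef_sum; under eq_bigr do rewrite lcoef_mono.
have [kp|kp] := boolP (k \in msupp p).
  rewrite (bigD1_seq k) //= eqxx big1 ?addr0 // => i /negPf ->.
  by rewrite mulr0n.
rewrite (memN_msupp_eq0 kp) scale0r big_seq big1 // => i ip.
by case: eqP => // ik; rewrite -ik ip in kp.
Qed.

Section Sums.
Variables (N : lmodType A) (n : nat) (V : zmodType).
Variable F : 'X_{1..n} -> {additive N -> V}.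

Lemma lsumEw (s : seq 'X_{1..n}) (P : lpoly N n) :
    uniq s -> {subset lsupp P <= s} ->
  \sum_(m <- lsupp P) F m (lcoef m P) = \sum_(m <- s) F m (lcoef m P).
Proof.
move=> us sub; rewrite [RHS](bigID (mem (lsupp P))) /= [X in _ = _ + X]big1.
  rewrite addr0 -[RHS]big_filter; apply: perm_big; apply: uniq_perm.
  - exact: lsupp_uniq.
  - exact: filter_uniq.
  - move=> m; rewrite mem_filter /=.
    by have [/sub ->|] := boolP (m \in lsupp P).
by move=> m mP; rewrite lcoef_out // raddf0.
Qed.

Lemma lsumD (P Q : lpoly N n) :
  \sum_(m <- lsupp (P + Q)) F m (lcoef m (P + Q)) =
  \sum_(m <- lsupp P) F m (lcoef m P) + \sum_(m <- lsupp Q) F m (lcoef m Q).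
Proof.
pose s := undup (lsupp (P + Q) ++ lsupp P ++ lsupp Q).
rewrite !(@lsumEw s) ?undup_uniq //; first last.
- by move=> m; rewrite mem_undup !mem_cat => ->.
- by move=> m; rewrite mem_undup !mem_cat => ->; rewrite orbT.
- by move=> m; rewrite mem_undup !mem_cat => ->; rewrite !orbT.
by rewrite -big_split; apply: eq_bigr => m _; rewrite lcoefD raddfD.
Qed.

Lemma lsum_mono m x :
  \sum_(k <- lsupp (lmono m x)) F k (lcoef k (lmono m x)) = F m x.
Proof.
rewrite (@lsumEw [:: m]) ?big_seq1 ?lcoef_mono ?eqxx //.
move=> k; have [//|] := boolP (k \in [:: m]).
rewrite inE => km kx; have: lcoef k (lmono m x) != 0.
  by rewrite /lcoef monalg.mcoeff_neq0.
by rewrite lcoef_mono [m == k]eq_sym (negPf km) mulr0n eqxx.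
Qed.

End Sums.

Section Scale.
Variables (N : lmodType A) (n : nat).
Implicit Types (p q : {mpoly A[n]}) (P Q : lpoly N n).

Lemma ltensorDr p : {morph @ltensor A N n p : x y / x + y}.
Proof.
by move=> x y; apply: lpolyP => k; rewrite lcoefD !lcoef_tensor scalerDr.
Qed.

Lemma ltensorDl (x : N) : {morph (fun p => ltensor p x) : p q / p + q}.
Proof.
move=> p q; apply: lpolyP => k.
by rewrite lcoefD !lcoef_tensor mcoeffD scalerDl.
Qed.

Lemma ltensor0l (x : N) : ltensor (0 : {mpoly A[n]}) x = 0.
Proof.
by apply: lpolyP => k; rewrite lcoef_tensor mcoeff0 scale0r lcoef0.
Qed.

Lemma ltensorZ p c (x : N) : ltensor p (c *: x) = ltensor (c *: p) x.
Proof.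
apply: lpolyP => k.
by rewrite !lcoef_tensor mcoeffZ scalerA mulrC.
Qed.

Lemma ltensor_mono m (x : N) : ltensor 'X_[m] x = lmono m x :> lpoly N n.
Proof.
apply: lpolyP => k; rewrite lcoef_tensor lcoef_mono mcoeffX.
by case: eqP; rewrite ?scale1r ?scale0r.
Qed.

Let F p (m : 'X_{1..n}) (x : N) : lpoly N n := ltensor (p * 'X_[m]) x.
Let F_additive p m : zmod_morphism (F p m).
Proof.
move=> x y; apply: lpolyP => k; rewrite lcoef_tensor scalerBr.
by rewrite -!lcoef_tensor /lcoef monalg.mcoeffB.
Qed.
Let FA p m : {additive N -> lpoly N n} :=
  HB.pack (F p m) (GRing.isZmodMorphism.Build _ _ _ (F_additive p m)).

Lemma lscaleE p P :
  lscale p P = \sum_(m <- lsupp P) ltensor (p * 'X_[m]) (lcoef m P).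
Proof. by rewrite unlock. Qed.

Lemma lscaleDr p : {morph @lscale A N n p : P Q / P + Q}.
Proof. by move=> P Q; rewrite unlock; apply: (lsumD (FA p)). Qed.

Lemma lscale_mono p m (x : N) : lscale p (lmono m x) = ltensor (p * 'X_[m]) x.
Proof. by rewrite [in LHS]unlock; apply: (lsum_mono (FA p)). Qed.

Lemma lscale0r p : lscale p (0 : lpoly N n) = 0.
Proof. by apply: (@addrI _ (lscale p 0)); rewrite -lscaleDr !addr0. Qed.

Lemma lscale_sum p (I : Type) (r : seq I) (G : I -> lpoly N n) :
  lscale p (\sum_(i <- r) G i) = \sum_(i <- r) lscale p (G i).
Proof. exact: (big_morph _ (lscaleDr p) (lscale0r p)). Qed.

Lemma lscale_tensor p q (x : N) : lscale p (ltensor q x) = ltensor (p * q) x.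
Proof.
rewrite (ltensorE q) lscale_sum [in RHS](mpolyE q) mulr_sumr.
rewrite (big_morph _ (ltensorDl x) (ltensor0l x)); apply: eq_bigr => m _.
by rewrite lscale_mono ltensorZ scalerAr.
Qed.

Lemma lscaleA p q P : lscale p (lscale q P) = lscale (p * q) P.
Proof.
rewrite (lscaleE q) lscale_sum lscaleE; apply: eq_bigr => m _.
by rewrite lscale_tensor mulrA.
Qed.

Lemma lscale1 : left_id (1 : {mpoly A[n]}) (@lscale A N n).
Proof.
move=> P; rewrite lscaleE [RHS]lmonoE; apply: eq_bigr => m _.
by rewrite mul1r ltensor_mono.
Qed.

Lemma lscaleDl P : {morph (fun p => lscale p P) : p q / p + q}.
Proof.
move=> p q; rewrite !lscaleE -big_split; apply: eq_bigr => m _ /=.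
by rewrite mulrDl ltensorDl.
Qed.

HB.instance Definition _ := GRing.Zmodule_isLmodule.Build
  {mpoly A[n]} (lpoly N n) lscaleA lscale1 lscaleDr lscaleDl.

End Scale.

End LambdaPolynomials.

HB.lock Definition lmap (A : comNzRingType) (M N : lmodType A) (n : nat)
    (h : M -> N) (P : lpoly M n) : lpoly N n :=
  \sum_(m <- lsupp P) lmono m (h (lcoef m P)).

(* For P = Σ_m λ^m x_m, [lbind q h P] is Σ_m q^m h(x_m): the variables are    *)
(* replaced by q (in whose values ∂ acts on the coefficients of N, from the   *)
(* left), and h is applied to the coefficients of P.                          *)
HB.lock Definition lbind (A : comNzRingType) (M N : lmodType A) (p n : nat)
    (q : 'I_p -> {mpoly A[n]}) (h : M -> lpoly N n) (P : lpoly M p) :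
    lpoly N n :=
  \sum_(m <- lsupp P) mmap1 q m *: h (lcoef m P).

Definition lsubst (A : comNzRingType) (N : lmodType A) (p n : nat)
    (q : 'I_p -> {mpoly A[n]}) (P : lpoly N p) : lpoly N n :=
  lbind q (@lconst A N n) P.

Section Variables.
Variables (K : fieldType) (n : nat).

Definition dd : {mpoly {poly K}[n]} := ('X : {poly K})%:MP.

(* λ_i for i < n, and λ_{n+1}^‡ = - λ_1 - ... - λ_n - ∂ for the last index.   *)
Definition lvar (i : 'I_n.+1) : {mpoly {poly K}[n]} :=
  if unlift ord_max i is Some j then 'X_j else - (\sum_(j < n) 'X_j) - dd.

End Variables.

Section LieConformal.
Variables (K : fieldType) (E : lmodType {poly K}).
Implicit Types (br : E -> E -> lpoly E 1) (x y z : E).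

Let la1 : {mpoly {poly K}[1]} := 'X_ord0.
Let la : {mpoly {poly K}[2]} := 'X_ord0.
Let mu : {mpoly {poly K}[2]} := 'X_ord_max.

(* P(λ) is sent to P(-λ-∂), ∂ acting on the coefficients from the left.       *)
Definition neg_lambda_dd (N : lmodType {poly K}) : lpoly N 1 -> lpoly N 1 :=
  lsubst (fun=> - 'X_ord0 - dd K 1).

Record lie_conformal br : Prop := LieConformal {
  lc_linl : forall (c : K) x y z,
    br (c%:P *: x + y) z = c%:P%:MP *: br x z + br y z;
  lc_linr : forall (c : K) x y z,
    br z (c%:P *: x + y) = c%:P%:MP *: br z x + br z y;
  lc_sesql : forall x y, br ('X *: x) y = - la1 *: br x y;
  lc_sesqr : forall x y, br x ('X *: y) = (dd K 1 + la1) *: br x y;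
  lc_skew : forall x y, br x y = - neg_lambda_dd (br y x);
  lc_jacobi : forall x y z,
    lbind (fun=> mu) (fun w => lsubst (fun=> la) (br x w)) (br y z) =
    lbind (fun=> la) (fun w => lsubst (fun=> la + mu) (br w z)) (br x y) +
    lbind (fun=> la) (fun w => lsubst (fun=> mu) (br y w)) (br x z)
}.

Record conformal_subalgebra br (S : E -> Prop) : Prop := ConformalSubalgebra {
  csub_zero : S 0;
  csub_lin : forall (p : {poly K}) x y, S x -> S y -> S (p *: x + y);
  csub_br : forall x y, S x -> S y -> forall m, S (lcoef m (br x y))
}.

End LieConformal.

Section Cochains.
Variable K : fieldType.
Implicit Types (M N : lmodType {poly K}) (n : nat).

(* Degree n corresponds to n+1 arguments and n variables λ.                   *)
Definition precochain M N n : Type := ('I_n.+1 -> M) -> lpoly N n.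

Definition upd M n (x : 'I_n.+1 -> M) (i : 'I_n.+1) (y : M) : 'I_n.+1 -> M :=
  fun j => if j == i then y else x j.

Record is_cochain M N n (f : precochain M N n) : Prop := IsCochain {
  coch_lin : forall x i (c : K) (y z : M),
    f (upd x i (c%:P *: y + z)) =
    c%:P%:MP *: f (upd x i y) + f (upd x i z);
  coch_sesq : forall x i, f (upd x i ('X *: x i)) = - lvar K i *: f x;
  coch_skew : forall x (s : 'S_n.+1),
    f x = (-1) ^+ s *:
      lsubst (fun i : 'I_n => lvar K (s (lift ord_max i))) (f (x \o s))
}.

(* Families with one component in each degree. The direct sum of the cochain  *)
(* spaces is cut out of this vector space by [gspan (@cochain_deg M N)],      *)
(* defined further below.                                                     *)
Definition cfam M N : Type := forall n, precochain M N n.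

HB.instance Definition _ M N := gen_eqMixin (cfam M N).
HB.instance Definition _ M N := gen_choiceMixin (cfam M N).

Section CfamLmod.
Variables M N : lmodType {poly K}.
Implicit Types (f g h : cfam M N) (c : K).

Definition cfam_zero : cfam M N := fun n x => 0.
Definition cfam_opp f : cfam M N := fun n x => - f n x.
Definition cfam_add f g : cfam M N := fun n x => f n x + g n x.
Definition cfam_scale c f : cfam M N := fun n x => c%:P%:MP *: f n x.

Lemma cfamP f g : (forall n x, f n x = g n x) -> f = g.
Proof.
by move=> fg; apply: functional_extensionality_dep => n; apply: funext.
Qed.

Lemma cfam_addA : associative cfam_add.
Proof. by move=> f g h; apply: cfamP => n x; apply: addrA. Qed.
Lemma cfam_addC : commutative cfam_add.
Proof. by move=> f g; apply: cfamP => n x; apply: addrC. Qed.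
Lemma cfam_add0 : left_id cfam_zero cfam_add.
Proof. by move=> f; apply: cfamP => n x; apply: add0r. Qed.
Lemma cfam_addN : left_inverse cfam_zero cfam_opp cfam_add.
Proof. by move=> f; apply: cfamP => n x; apply: addNr. Qed.

HB.instance Definition _ := GRing.isZmodule.Build (cfam M N)
  cfam_addA cfam_addC cfam_add0 cfam_addN.

Lemma cfam_scaleA c d f : cfam_scale c (cfam_scale d f) = cfam_scale (c * d) f.
Proof.
by apply: cfamP => n x; rewrite /cfam_scale scalerA -mpolyCM -polyCM.
Qed.
Lemma cfam_scale1 : left_id 1 cfam_scale.
Proof. by move=> f; apply: cfamP => n x; apply: scale1r. Qed.
Lemma cfam_scaleDr : right_distributive cfam_scale +%R.
Proof. by move=> c f g; apply: cfamP => n x; apply: scalerDr. Qed.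
Lemma cfam_scaleDl f : {morph cfam_scale^~ f : c d / c + d}.
Proof.
by move=> c d; apply: cfamP => n x; rewrite /cfam_scale polyCD mpolyCD scalerDl.
Qed.

HB.instance Definition _ := GRing.Zmodule_isLmodule.Build K (cfam M N)
  cfam_scaleA cfam_scale1 cfam_scaleDr cfam_scaleDl.

End CfamLmod.

Definition cochain_deg M N n (f : cfam M N) : Prop :=
  (forall k x, k != n -> f k x = 0) /\ is_cochain (f n).

Definition unshuffle n (i : nat) (s : 'S_n) : bool :=
  [forall j : 'I_n, forall k : 'I_n,
     (j < k)%N && ((k < i)%N || (i <= j)%N) ==> (s j < s k)%N].

(* The product f ⋆ g of a degree m and a degree n cochain, meaningful for     *)
(* p = m + n; p is kept separate so as not to cast between degrees. The       *)
(* subscripts of f are the first m of                                         *)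
(*   λ_σ(1) + ... + λ_σ(n+1), λ_σ(n+2), ..., λ_σ(m+n+1),                      *)
(* one for each argument of f, and λ_{p+1} stands for λ_{p+1}^‡.              *)
Definition star E m n p (f : precochain E E m) (g : precochain E E n) :
    precochain E E p := fun x =>
  \sum_(s : 'S_p.+1 | unshuffle n.+1 s) (-1) ^+ s *:
    lbind (fun i : 'I_n => lvar K (s (inord i)))
      (fun y : E =>
        lsubst (fun j : 'I_m => if (j == 0 :> nat)
                                then \sum_(i < p.+1 | (i < n.+1)%N) lvar K (s i)
                                else lvar K (s (inord (n + j))))
          (f (fun j : 'I_m.+1 => if j == ord0 then y
                                 else x (s (inord (n + j))))))
      (g (fun i : 'I_n.+1 => x (s (inord i)))).

Definition nr E (f g : cfam E E) : cfam E E := fun p x =>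
  \sum_(n < p.+1)
    (star (f (p - n)%N) (g n) x - (-1) ^+ ((p - n) * n)%N *: star (g n) (f (p - n)%N) x).

End Cochains.

(* A graded vector space is given inside an ambient vector space V by its     *)
(* homogeneous components [gr n]; the graded space itself is their sum,       *)
(* [gspan gr], which is required to be direct. All degrees are nonnegative.   *)
Section Graded.
Variables (K : fieldType) (V : lmodType K).
Implicit Types (gr : nat -> V -> Prop) (br : V -> V -> V) (P : V -> V).
Implicit Types (S F : V -> Prop) (x y z : V) (c : K).

Definition gspan gr x : Prop :=
  exists n (v : 'I_n -> V), (forall i : 'I_n, gr i (v i)) /\ x = \sum_i v i.

Record graded_space gr : Prop := GradedSpace {
  gr_zero : forall n, gr n 0;
  gr_lin : forall n c x y, gr n x -> gr n y -> gr n (c *: x + y);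
  gr_direct : forall n (v : 'I_n -> V),
    (forall i : 'I_n, gr i (v i)) -> \sum_i v i = 0 -> forall i, v i = 0
}.

Record graded_lie gr br : Prop := GradedLie {
  gl_space : graded_space gr;
  gl_linl : forall c x y z, gspan gr x -> gspan gr y -> gspan gr z ->
    br (c *: x + y) z = c *: br x z + br y z;
  gl_linr : forall c x y z, gspan gr x -> gspan gr y -> gspan gr z ->
    br z (c *: x + y) = c *: br z x + br z y;
  gl_deg : forall m n x y, gr m x -> gr n y -> gr (m + n)%N (br x y);
  gl_skew : forall m n x y, gr m x -> gr n y ->
    br x y = - (-1) ^+ (m * n)%N *: br y x;
  gl_jacobi : forall m n p x y z, gr m x -> gr n y -> gr p z ->
    br x (br y z) = br (br x y) z + (-1) ^+ (m * n)%N *: br y (br x z)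
}.

Record graded_subalgebra gr br S : Prop := GradedSubalgebra {
  gs_zero : S 0;
  gs_lin : forall c x y, S x -> S y -> S (c *: x + y);
  gs_graded : forall x, S x -> gspan (fun n y => gr n y /\ S y) x;
  gs_br : forall x y, S x -> S y -> S (br x y)
}.

Record vdata gr br F P (Delta : V) : Prop := VData {
  vd_lie : graded_lie gr br;
  vd_sub : graded_subalgebra gr br F;
  vd_abelian : forall x y, F x -> F y -> br x y = 0;
  vd_lin : forall c x y, gspan gr x -> gspan gr y ->
    P (c *: x + y) = c *: P x + P y;
  vd_idem : forall x, gspan gr x -> P (P x) = P x;
  vd_image : forall y, F y <-> exists2 x, gspan gr x & y = P x;
  vd_ker : graded_subalgebra gr br (fun x => gspan gr x /\ P x = 0);
  vd_deg : gr 1 Delta;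
  vd_Delta : P Delta = 0;
  vd_square : br Delta Delta = 0
}.

(* The family (l_k) is encoded by one function on sequences, the value of     *)
(* l_k at (v_1, ..., v_k) being [l [:: v_1; ...; v_k]]; only k >= 1 matters.  *)
Implicit Types (l : seq V -> V).

Definition voronov br P (Delta : V) : seq V -> V :=
  fun s => P (foldl br Delta s).

Definition koszul n (d : 'I_n -> nat) (s : 'S_n) : K :=
  (-1) ^+ (\sum_(i < n) \sum_(j < n | (i < j)%N && (s j < s i)%N)
             d (s i) * d (s j))%N.

Record linfty gr l : Prop := LInfty {
  li_space : graded_space gr;
  li_lin : forall (s t : seq V) c x y,
    {in s, forall v, gspan gr v} -> {in t, forall v, gspan gr v} ->
    gspan gr x -> gspan gr y ->
    l (s ++ (c *: x + y) :: t) = c *: l (s ++ x :: t) + l (s ++ y :: t);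
  li_deg : forall n (d : 'I_n -> nat) (v : 'I_n -> V), (0 < n)%N ->
    (forall i, gr (d i) (v i)) ->
    gr (\sum_i d i).+1 (l [seq v i | i : 'I_n]);
  li_sym : forall n (d : 'I_n -> nat) (v : 'I_n -> V) (s : 'S_n), (0 < n)%N ->
    (forall i, gr (d i) (v i)) ->
    l [seq v (s i) | i : 'I_n] = koszul d s *: l [seq v i | i : 'I_n];
  li_rel : forall n (d : 'I_n -> nat) (v : 'I_n -> V), (0 < n)%N ->
    (forall i, gr (d i) (v i)) ->
    \sum_(1 <= i < n.+1) \sum_(s : 'S_n | unshuffle i s)
      koszul d s *:
        (let w := [seq v (s j) | j : 'I_n] in
         l (l (take i w) :: drop i w)) = 0
}.

(* The series is meant as a finite sum.                                       *)
Definition maurer_cartan gr l (x : V) : Prop :=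
  gr 0%N x /\
  exists2 n, (forall k, (n < k)%N -> l (nseq k x) = 0)
    & \sum_(1 <= k < n.+1) (k`!%:R)^-1 *: l (nseq k x) = 0.

End Graded.

Section QuasiTwilled.
Variables (K : fieldType) (a b : lmodType {poly K}).

Definition dsum : lmodType {poly K} := (a * b)%type.

Definition ina (x : a) : dsum := (x, 0).
Definition inb (u : b) : dsum := (0, u).
Definition pra (e : dsum) : a := e.1.
Definition prb (e : dsum) : b := e.2.

Variable br : dsum -> dsum -> lpoly dsum 1.

Definition quasi_twilled : Prop :=
  [/\ fin_gen a, fin_gen b, lie_conformal br
    & conformal_subalgebra br (fun e => pra e = 0)].

Definition left_deformation_map (B : {linear b -> a}) : Prop :=
  conformal_subalgebra br (fun e => exists u : b, e = (B u, u)).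

Definition bra (x y : a) : lpoly a 1 := lmap pra (br (ina x) (ina y)).
Definition psi1 (x y : a) : lpoly b 1 := lmap prb (br (ina x) (ina y)).
Definition rhob (u : b) (x : a) : lpoly a 1 := lmap pra (br (inb u) (ina x)).
Definition rhoa (x : a) (v : b) : lpoly b 1 := lmap prb (br (ina x) (inb v)).
Definition brb (u v : b) : lpoly b 1 := lmap prb (br (inb u) (inb v)).

Definition lpair n (P : lpoly a n) (Q : lpoly b n) : lpoly dsum n :=
  lmap ina P + lmap inb Q.

Definition cochain2 (h : dsum -> dsum -> lpoly dsum 1) : cfam dsum dsum :=
  fun n => match n return precochain dsum dsum n with
           | 1 => fun x => h (x ord0) (x ord_max)
           | _ => fun=> 0
           end.

Definition Omega : cfam dsum dsum := cochain2 br.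

Definition psi_hat : cfam dsum dsum :=
  cochain2 (fun e f => lpair 0 (psi1 (pra e) (pra f))).

Definition nu1_hat : cfam dsum dsum :=
  cochain2 (fun e f =>
    lpair (bra (pra e) (pra f))
          (rhoa (pra e) (prb f) - neg_lambda_dd (rhoa (pra f) (prb e)))).

Definition nu2_hat : cfam dsum dsum :=
  cochain2 (fun e f =>
    lpair (rhob (prb e) (pra f) - neg_lambda_dd (rhob (prb f) (pra e)))
          (brb (prb e) (prb f))).

End QuasiTwilled.

Section LiftProj.
Variables (K : fieldType) (a b : lmodType {poly K}).

Definition hat (f : cfam b a) : cfam (dsum a b) (dsum a b) :=
  fun n x => lmap (@ina K a b) (f n (fun i => prb (x i))).

Definition projF (h : cfam (dsum a b) (dsum a b)) : cfam (dsum a b) (dsum a b) :=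
  hat (fun n u => lmap (@pra K a b) (h n (fun i => inb a (u i)))).

Definition hat_deg n (h : cfam (dsum a b) (dsum a b)) : Prop :=
  exists2 f : cfam b a, cochain_deg n f & h = hat f.

Definition hom_cochain (B : {linear b -> a}) : cfam b a :=
  fun n => match n return precochain b a n with
           | 0 => fun x => lconst 0 (B (x ord0))
           | _ => fun=> 0
           end.

End LiftProj.

(* Main.v *)
Require Import Defs.
From HB Require Import structures.
From mathcomp Require Import all_boot all_algebra all_fingroup.
From mathcomp Require Import -(notations) monalg.
From mathcomp Require Import finmap mpoly complex boolp reals.
From mathcomp Require Import zify ssrAC.

Set Implicit Arguments.
Unset Strict Implicit.
Unset Printing Implicit Defensive.

Import GRing.Theory.

Local Open Scope ring_scope.

(** The statement has three sources: the graded Lie algebra of cochains,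
    Voronov's higher derived brackets, and a grading that sorts the components
    of the lambda-bracket.

    Lambda-calculus without elimination.  A cochain f with n+1 arguments
    treats its last argument differently, since the last variable is replaced
    by minus the sum of the others and of the derivation.  The asymmetry goes
    away when f is paired with a form: give each argument x_i a weight q_i in
    a polynomial ring, substitute the weights for the variables, and send the
    value y to chi (sum of the q_i, y), where chi (q, -) turns the derivation
    into multiplication by -q ([sesqui]).  The resulting function [ev f chi]
    of a list of weighted points is skew under all permutations ([ev_skew]),
    and f is recovered from one particular chi and one list of points
    ([ev_pts]).  On such functions the product f * g is an operator: a signed
    sum over the splittings of the list into the arguments of g and the
    remaining arguments of f ([ev_star]).

    The graded Lie algebra.  In (f * g) * h the value of h is an argument
    either of g or of f.  The terms of the first kind add up to f * (g * h) by
    coassociativity of splittings ([splitsum_assoc]); those of the second kind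
    insert g and h into two slots of f, so they are graded symmetric in g and
    h because f is skew ([nested_comm]).  Hence the product is graded right
    pre-Lie and its graded commutator satisfies the Jacobi identity
    ([nr_jacobi]).

    Derived brackets.  Bracketing [Delta, Delta] = 0 with v_1, ..., v_n spreads
    the v_i over the two factors.  Apply P, use P[x, y] = P[Px, y] + P[x, Py]
    (the kernel of P is a subalgebra and its image is abelian), and move the
    inner value of P to the front, which is possible because bracketing with
    elements of the abelian F is graded symmetric.  Both halves give the sum
    of the n-th L-infinity relation, so twice that sum vanishes
    ([voronov_rel]).

    The grading.  On arguments each of which lies in a or in b, a cochain is
    of weight k when an output in a requires k arguments from a, and an output
    in b requires k-1.  Lifts have weight 0, and nu_2, nu_1, psi have weights
    1, 2, 3; bracketing adds weights and subtracts 1 ([supported_star]).  A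
    cochain of weight 0 is a lift, and P kills positive weight, so only one
    component of Omega contributes to each l_k with k <= 3, and none to l_k
    with k > 3.  The same bookkeeping, with conditions such as k >= 1, shows
    that the lifts form an abelian subalgebra and the kernel of P a
    subalgebra.

    Deformation maps.  Bracketing Omega with B once, twice and three times
    gives explicit expressions; the Maurer-Cartan sum, at u and v in b, is the
    a-part of {g(u) g(v)} minus B of its b-part, where g(u) = (Bu, u)
    ([curvatureE]).  It vanishes exactly when the graph of B is closed under
    the bracket ([deformation_mc]). *)

(** * Signed sums over the splittings of a list *)

Lemma sign_eq (R : pzRingType) (T : lmodType R) (m n : nat) (x : T) :
  odd m = odd n -> (-1) ^+ m *: x = (-1) ^+ n *: x.
Proof. by move=> mn; rewrite -(signr_odd _ m) mn signr_odd. Qed.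

Ltac parity := repeat match goal with |- context [odd ?x] => case: (odd x) end; by [].
Ltac signs := rewrite ?scalerA -?exprD; apply: sign_eq;
  rewrite /= ?(mulnDl, mulnDr, addnA, oddD, oddM, oddS) /=; parity.

Section Splittings.
Variables (X : Type) (par : X -> nat).

Definition tpar (s : seq X) : nat := sumn (map par s).

Lemma tpar_cat s t : tpar (s ++ t) = (tpar s + tpar t)%N.
Proof. by rewrite /tpar map_cat sumn_cat. Qed.

Variables (R : pzRingType) (T : lmodType R).
Implicit Types (F G : seq X -> seq X -> T) (s t u v w : seq X).

(** Sum of F u v over the splittings of s into two subsequences u, of size n,
    and v, with the Koszul sign of the corresponding unshuffle: an element
    that goes to v passes the elements of u that follow it in the splitting.
    The recursion on s replaces the manipulation of permutations by inductions
    on lists. *)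
Fixpoint splitsum n F s : T :=
  if s is x :: s' then
    (if n is n'.+1 then splitsum n' (fun u v => F (x :: u) v) s' else 0) +
    splitsum n (fun u v => (-1) ^+ (par x * tpar u) *: F u (x :: v)) s'
  else if n is 0 then F [::] [::] else 0.

(** Quantifying over all weights f gives at once the equality of sizes, of
    total degrees, and of the numbers of elements of any given kind. *)
Definition splits_of s u v : Prop :=
  forall f : X -> nat, sumn (map f (u ++ v)) = sumn (map f s).

Lemma splits_of_size s u v : splits_of s u v -> (size u + size v)%N = size s.
Proof.
have sz t : sumn (map (fun=> 1%N) t) = size t by elim: t => //= x t ->.
by move=> /(_ (fun=> 1%N)); rewrite map_cat sumn_cat !sz.
Qed.

Lemma eq_splitsum n F G s :
  (forall u v, size u = n -> splits_of s u v -> F u v = G u v) ->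
  splitsum n F s = splitsum n G s.
Proof.
elim: s n F G => [|x s IH] [|n] F G FG //=; first by apply: FG.
- congr (_ + _); apply: IH => u v un uv; rewrite FG // => f.
  by have /= := uv f; rewrite !map_cat !sumn_cat /= => <-; lia.
- congr (_ + _); apply: IH => u v un uv.
    by apply: FG => [/=|f]; [rewrite un|have /= := uv f;
      rewrite !map_cat !sumn_cat /= => <-; lia].
  rewrite FG // => f.
  by have /= := uv f; rewrite !map_cat !sumn_cat /= => <-; lia.
Qed.

Lemma splitsumD n F G s : splitsum n (fun u v => F u v + G u v) s =
  splitsum n F s + splitsum n G s.
Proof.
elim: s n F G => [|x s IH] [|n] F G //=; rewrite ?add0r ?addr0 //.
- by rewrite -IH; apply: eq_splitsum => u v _ _; rewrite scalerDr.
- rewrite IH addrACA; congr (_ + _ + _); rewrite -IH.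
  by apply: eq_splitsum => u v _ _; rewrite scalerDr.
Qed.

Lemma splitsum0 n s : splitsum n (fun _ _ => 0) s = 0.
Proof. by apply: (@addrI _ (splitsum n (fun _ _ => 0) s));
  rewrite -splitsumD !addr0. Qed.

Lemma splitsum_scale n c F s :
  splitsum n (fun u v => c *: F u v) s = c *: splitsum n F s.
Proof.
elim: s n F => [|x s IH] [|n] F //=; rewrite ?scaler0 // scalerDr -IH ?scaler0 -?IH.
- by congr (_ + _); apply: eq_splitsum => u v _ _; rewrite !scalerA commr_sign.
- by congr (_ + _); apply: eq_splitsum => u v _ _; rewrite !scalerA commr_sign.
Qed.

Lemma splitsum_small n F s : (size s < n)%N -> splitsum n F s = 0.
Proof.
elim: s n F => [|x s IH] [|n] F //= sn; rewrite !IH ?addr0 //.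
exact: ltnW.
Qed.

(** Coassociativity: both sides run over the splittings into three pieces, and
    an element that goes to the last piece passes the first two in either
    order. *)
Lemma splitsum_assoc i j (F : seq X -> seq X -> seq X -> T) s :
  splitsum i (fun u r => splitsum j (F u) r) s =
  splitsum (i + j) (fun r w => splitsum i (fun u v => F u v w) r) s.
Proof.
elim: s i j F => [|x s IH] i j F; first by case: i; case: j.
rewrite /=.
have -> : splitsum i (fun u v => (-1) ^+ (par x * tpar u) *: splitsum j (F u)
  (x :: v)) s
  = splitsum i (fun u r => if j is j'.+1 then splitsum j' (fun v w =>
    (-1) ^+ (par x * tpar u) *: F u (x :: v) w) r else 0) s
  + splitsum i (fun u r => splitsum j (fun v w => (-1) ^+ (par x * (tpar u +
    tpar v)) *: F u v (x :: w)) r) s.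
  rewrite -splitsumD; apply: eq_splitsum => u r _ _ /=;
    rewrite scalerDr -splitsum_scale.
  congr (_ + _); first by case: j => [|j]; rewrite ?scaler0 -?splitsum_scale.
  by apply: eq_splitsum => v w _ _; rewrite scalerA -exprD mulnDr.
rewrite addrA; congr (_ + _).
  case: i => [|i] /=.
    rewrite add0r; case: j => [|j]; first by rewrite splitsum0.
    rewrite IH add0n; apply: eq_splitsum => u v _ _ /=.
    by rewrite add0r.
  rewrite (IH i j); case: j => [|j].
    rewrite splitsum0 addr0 addn0; apply: eq_splitsum => u w ui _ /=.
    by rewrite [X in _ + X]splitsum_small ?addr0 // ui.
  by rewrite IH addnS -splitsumD; apply: eq_splitsum.
rewrite IH; apply: eq_splitsum => r w _ _; rewrite -splitsum_scale.
apply: eq_splitsum => u v _ uv; congr ((-1) ^+ (_ * _) *: _).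
by rewrite -tpar_cat; apply: uv.
Qed.

(** The splitting is the same whichever piece is listed first; exchanging the
    two blocks costs the product of their degrees. *)
Lemma splitsum_swap i j F s : size s = (i + j)%N ->
  splitsum i F s = splitsum j (fun v u => (-1) ^+ (tpar u * tpar v) *: F u v) s.
Proof.
elim: s i j F => [|x s IH] i j F /=.
  by case: i; case: j => //= _; rewrite scale1r.
move=> sij; rewrite addrC; congr (_ + _).
  case: j => [|j] in sij *; first by rewrite splitsum_small //; lia.
  rewrite (IH _ j); last by lia.
  by apply: eq_splitsum => v u _ _; rewrite /tpar; signs.
case: i => [|i] in sij *; first by rewrite splitsum_small //; lia.
rewrite (IH _ j); last by lia.
by apply: eq_splitsum => v u _ _; rewrite /tpar; signs.
Qed.

Lemma splitsum_comm i j (F : seq X -> seq X -> seq X -> T) s :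
  splitsum i (fun u r => splitsum j (F u) r) s =
  splitsum j (fun v r => splitsum i (fun u w =>
    (-1) ^+ (tpar u * tpar v) *: F u v w) r) s.
Proof.
rewrite !splitsum_assoc addnC; apply: eq_splitsum => r w ri _.
by rewrite (splitsum_swap _ (j := j)) // ri addnC.
Qed.

(** Adjacent transpositions suffice to determine the behaviour under all
    permutations, and are the only ones that the recursions see. *)
Definition graded_sym (Phi : seq X -> T) : Prop := forall u x y v,
  Phi (u ++ x :: y :: v) = (-1) ^+ (par x * par y) *: Phi (u ++ y :: x :: v).

(** If x and y fall in the same piece, this is the symmetry of F; the
    splittings that separate them are exchanged in pairs. *)
Lemma splitsum_graded_sym n F :
  (forall v, graded_sym (F^~ v)) -> (forall u, graded_sym (F u)) ->
    graded_sym (splitsum n F).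
Proof.
move=> Fl Fr u x y v; elim: u n F Fl Fr => [|z u IH] n F Fl Fr; last first.
  rewrite /= scalerDr; congr (_ + _).
    case: n => [|n]; first by rewrite scaler0.
    by apply: IH => [w|w] a p q b; [apply: (Fl w (z :: a))|apply: Fr].
  apply: IH => [w|w] a p q b; last by rewrite (Fr w (z :: a)); signs.
  have -> : tpar (a ++ p :: q :: b) = tpar (a ++ q :: p :: b).
    by rewrite /tpar !map_cat !sumn_cat /=; lia.
  by rewrite [X in _ *: X]Fl; signs.
rewrite /=.
have -> : splitsum n (fun a b => (-1) ^+ (par y * tpar a) *: ((-1) ^+
  (par x * tpar a) *: F a (x :: y :: b))) v
  = (-1) ^+ (par x * par y) *: splitsum n (fun a b =>
    (-1) ^+ (par x * tpar a) *: ((-1) ^+ (par y * tpar a) *: F a (y :: x :: b))) v.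
  rewrite -splitsum_scale; apply: eq_splitsum => a b _ _.
  by rewrite (Fr a [::]); signs.
rewrite !addrA scalerDr; congr (_ + _).
(* the two remaining terms on each side are those where x and y are
   separated, in opposite orders on the two sides *)
case: n => [|n]; first by rewrite !addr0 scaler0.
rewrite -!addrA scalerDr.
congr (_ + _).
  case: n => [|n]; first by rewrite scaler0.
  by rewrite -splitsum_scale; apply: eq_splitsum => a b _ _; apply: (Fl b [::]).
rewrite addrC scalerDr -!splitsum_scale; congr (_ + _).
  by apply: eq_splitsum => a b _ _; rewrite /tpar; signs.
by apply: eq_splitsum => a b _ _; rewrite /tpar; signs.
Qed.

Lemma graded_sym_front Phi : graded_sym Phi -> forall u v x w,
  Phi (u ++ v ++ x :: w) = (-1) ^+ (par x * tpar v) *: Phi (u ++ x :: v ++ w).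
Proof.
move=> sP u v x w; elim: v u => [|y v IH] u /=; first by rewrite muln0 scale1r.
by rewrite -cat_rcons IH cat_rcons sP /tpar; signs.
Qed.

End Splittings.

(** * Unshuffles and splittings *)

Section Permutations.
Variables (X : Type) (par : X -> nat).

(** The exponent rather than the sign itself, so that the sign can be read in
    any ring. *)
Definition koszul_exp n (d : 'I_n -> nat) (s : 'S_n) : nat :=
  \sum_(i < n) \sum_(j < n | (i < j)%N && (s j < s i)%N) (d (s i) * d (s j))%N.

(** Inductions on permutations remove the value 0, wherever it is taken: this
    matches a recursion on the head of the list that is permuted. *)
Lemma lift_perm_ex n (s : 'S_n.+1) : exists k s', s = lift_perm k ord0 s'.
Proof.
pose k := (s^-1 ord0)%g.
have skl j : s (lift k j) != ord0.
  by rewrite -[ord0](permKV s) (inj_eq perm_inj) eq_sym neq_lift.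
pose g j := odflt j (unlift ord0 (s (lift k j))).
have gE j : lift ord0 (g j) = s (lift k j).
  rewrite /g; have := skl j; rewrite eq_sym => /unlift_some [i -> ->] //.
have gi : injective g.
  by move=> i j gij; have := gE i; rewrite gij gE => /perm_inj /lift_inj.
exists k, (perm gi); apply/permP => i; case: (unliftP k i) => [j|] ->.
  by rewrite lift_perm_lift permE gE.
by rewrite lift_perm_id /k permKV.
Qed.

Lemma lift_perm_inj n (k : 'I_n.+1) (j : 'I_n.+1) : injective (@lift_perm n k j).
Proof.
move=> s t st; apply/permP => i; apply: (@lift_inj _ j).
by rewrite -!(@lift_perm_lift _ k) st.
Qed.

Lemma sum_lift_perm n (T : nmodType) (G : 'S_n.+1 -> T) :
  \sum_s G s = \sum_k \sum_s G (lift_perm k ord0 s).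
Proof.
rewrite pair_big /= (reindex (fun p => lift_perm p.1 ord0 p.2)) //=.
apply: onW_bij; apply: inj_card_bij.
  move=> [k s] [k' s'] /= e.
  have kk : k = k'.
    apply: (@perm_inj _ (lift_perm k ord0 s)).
    by rewrite {2}e !lift_perm_id.
  by move: e; rewrite kk => /lift_perm_inj ->.
by rewrite card_prod !card_Sn card_ord factS.
Qed.

(** The value 0, taken at position k, is inverted exactly with the values at
    the positions before k. *)
Lemma koszul_exp_lift n (d : 'I_n.+1 -> nat) k (s : 'S_n) :
  koszul_exp d (lift_perm k ord0 s) =
  (d ord0 * (\sum_(j < n | (j < k)%N) d (lift ord0 (s j))) +
    koszul_exp (d \o lift ord0) s)%N.
Proof.
rewrite /koszul_exp (bigD1_ord k) //= lift_perm_id.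
rewrite [X in (X + _)%N]big1 => [|i]; last by rewrite ltn0 andbF.
rewrite add0n big_distrr /= [X in (X + _)%N]big_mkcond /= -big_split /=.
apply: eq_bigr => i _; rewrite lift_perm_lift.
rewrite big_mkcond (bigD1_ord k) //= lift_perm_id [in RHS]big_mkcond /=.
congr (_ + _)%N.
  have -> : (lift k i < k)%N = (i < k)%N by rewrite /= /bump; lia.
  by rewrite andbT mulnC.
apply: eq_bigr => j _; rewrite lift_perm_lift.
have -> : (lift k i < lift k j)%N = (i < j)%N by rewrite /= /bump; lia.
by rewrite /= /bump /= !add1n ltnS.
Qed.

Lemma koszul_exp1 n (s : 'S_n) : odd (koszul_exp (fun=> 1%N) s) = s.
Proof.
elim: n s => [|n IH] s; first by rewrite /koszul_exp big_ord0 [s]permS0 odd_perm1.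
have [k [t ->]] := lift_perm_ex s.
rewrite koszul_exp_lift odd_lift_perm /= oddD addbF; congr (_ (+) _); last exact: IH.
rewrite mul1n sum1_card cardE -(size_map val) -{2}(size_iota 0 k); congr (odd _).
apply: perm_size; apply: uniq_perm; rewrite ?iota_uniq //.
  by rewrite map_inj_uniq ?enum_uniq //; apply: val_inj.
move=> j; rewrite mem_iota add0n /=; apply/mapP/idP => [[j0] | jk].
  by rewrite mem_enum => jk ->.
have jn : (j < n)%N by apply: leq_trans jk _; rewrite -ltnS.
by exists (Ordinal jn); rewrite // mem_enum.
Qed.

Lemma map_lift_perm n (w : 'I_n.+1 -> X) k (s : 'S_n) :
  [seq w (lift_perm k ord0 s j) | j : 'I_n.+1] =
  let L := [seq w (lift ord0 (s j)) | j : 'I_n] in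
  take k L ++ w ord0 :: drop k L.
Proof.
set L := [seq w (lift ord0 (s j)) | j : 'I_n]; have sL : size L =
  n by rewrite size_map size_enum_ord.
apply: (@eq_from_nth _ (w ord0)).
  rewrite size_cat /= size_take size_drop sL size_map size_enum_ord.
  by have := ltn_ord k; case: ifP; lia.
move=> m; rewrite size_map size_enum_ord => ni; pose i' := Ordinal ni.
rewrite (nth_map k) ?size_enum_ord // -[m]/(val i') nth_ord_enum.
rewrite nth_cat size_take sL; have kn := ltn_ord k.
have Lnth (j : 'I_n) : nth (w ord0) L j = w (lift ord0 (s j)).
  by rewrite (nth_map j) ?size_enum_ord // nth_ord_enum.
have -> : (if (k < n)%N then k : nat else n) = k by case: ifP; lia.
case: (unliftP k i') => [j|] ->; last by rewrite lift_perm_id ltnn subnn.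
rewrite lift_perm_lift -Lnth /= /bump; have jn := ltn_ord j.
case: (leqP k j) => kj /=; last by rewrite add0n kj nth_take.
rewrite add1n; have -> : (j.+1 < k)%N = false by lia.
by rewrite subSn //= nth_drop subnKC.
Qed.

(** An unshuffle is increasing on each of its two blocks, so it takes its
    smallest value at the start of one of them: at position 0 or at position
    i. *)
Lemma unshuffle_lift i n (k : 'I_n.+1) (s : 'S_n) : (i <= n.+1)%N ->
  unshuffle i (lift_perm k ord0 s) =
  ((k == 0 :> nat) && (0 < i)%N && unshuffle i.-1 s) ||
  ((k == i :> nat) && unshuffle i s).
Proof.
move=> iN; apply/idP/idP.
  move=> U.
  have U' (j l : 'I_n.+1) : (j < l)%N -> (l < i)%N || (i <= j)%N ->
      (lift_perm k ord0 s j < lift_perm k ord0 s l)%N.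
    by move=> jl li; move/forallP/(_ j)/forallP/(_ l)/implyP: U; apply; rewrite jl.
  have k0i : (k == 0 :> nat) && (0 < i)%N || (k == i :> nat).
    have [k0|k0] := posnP k; first by rewrite k0 /= eq_sym; case: (i).
    have [//|ki] := eqVneq (k : nat) i; exfalso.
    have pk : (k.-1 < n.+1)%N by have := ltn_ord k; lia.
    have := U' (Ordinal pk) k; rewrite lift_perm_id ltn0 /=.
    by move=> h; apply/notF/h; lia.
  have Us m : (forall j l : 'I_n, (j < l)%N -> (l < m)%N || (m <= j)%N ->
      (lift k l < i)%N || (i <= lift k j)%N) -> unshuffle m s.
    move=> h; apply/forallP => j; apply/forallP => l; apply/implyP => /andP [jl lm].
    have := U' (lift k j) (lift k l); rewrite !lift_perm_lift /= /bump /=.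
    rewrite !add1n ltnS => -> //; first by lia.
    exact: h.
  case/orP: k0i => [/andP [k0 i0]|ki]; [apply/orP; left|apply/orP; right].
    rewrite k0 i0 /=; apply: Us => j l jl; rewrite /= /bump (eqP k0) /=; lia.
  rewrite ki /=; apply: Us => j l jl; rewrite /= /bump (eqP ki) /=; lia.
have Us m : unshuffle m s -> forall j l : 'I_n, (j < l)%N ->
  (l < m)%N || (m <= j)%N -> (s j < s l)%N.
  by move=> U j l jl lm; move/forallP/(_ j)/forallP/(_ l)/implyP: U; apply;
    rewrite jl.
move=> H; apply/forallP => j; apply/forallP => l; apply/implyP => /andP [jl lm].
case/orP: H => [/andP [/andP [/eqP k0 i0] /Us U]|/andP [/eqP ki /Us U]];
  move: jl lm;
  case: (unliftP k j) => [j'|] ->; case: (unliftP k l) => [l'|] ->;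
  rewrite ?lift_perm_lift ?lift_perm_id ?ltnn //= /bump /= ?add1n => jl lm;
  rewrite ?ltnS; try (apply: U); lia.
Qed.

Lemma sumn_take_enum n k (f : 'I_n -> nat) : (k <= n)%N ->
  sumn [seq f j | j <- take k (enum 'I_n)] = (\sum_(j < n | (j < k)%N) f j)%N.
Proof.
elim: n k f => [|n IH] [|k] f // kn; first by rewrite take0 big_ord0.
  by rewrite take0 big_pred0.
rewrite enum_ordSl /= -map_take -map_comp IH // [in RHS]big_mkcond big_ord_recl /=.
by rewrite [in LHS]big_mkcond.
Qed.

Lemma map_enum_ordS n (w : 'I_n.+1 -> X) :
  [seq w j | j : 'I_n.+1] = w ord0 :: [seq (w \o lift ord0) j | j : 'I_n].
Proof. by rewrite /image_mem enum_ordSl /= -map_comp. Qed.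

Variables (R : pzRingType) (T : lmodType R).

(** The bridge between sums over unshuffles and the recursive sums. By
    [unshuffle_lift] the permutations split according to the block that
    receives the first element of the list, as in the recursion; a block i =
    n+1 or i = 0 leaves only one of the two cases. *)
Lemma sum_unshuffle n i (w : 'I_n -> X) (F : seq X -> seq X -> T) : (i <= n)%N ->
  \sum_(s : 'S_n | unshuffle i s) (-1) ^+ (koszul_exp (par \o w) s) *:
     (let L := [seq w (s j) | j : 'I_n] in F (take i L) (drop i L)) =
  splitsum par i F [seq w j | j : 'I_n].
Proof.
elim: n i w F => [|n IH] i w F i_n.
  rewrite (big_pred1 1%g) => [|s]; last first.
    by rewrite [s]permS0 /= eqxx; apply/forallP => -[].
  have -> : i = 0%N by lia.
  have E (v : 'I_0 -> X) : [seq v j | j : 'I_0] = [::].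
    by apply: size0nil; rewrite size_map size_enum_ord.
  by rewrite /koszul_exp big_ord0 scale1r /= !E.
rewrite big_mkcond sum_lift_perm /= map_enum_ordS.
have Ek (k : 'I_n.+1) m (G : seq X -> seq X -> T) : (m <= n)%N ->
   (forall s, unshuffle i (lift_perm k ord0 s) = unshuffle m s) ->
   (forall s : 'S_n, let L := [seq (w \o lift ord0) (s j) | j : 'I_n] in
     let L' := take k L ++ w ord0 :: drop k L in
     (-1) ^+ (par (w ord0) * tpar par (take k L)) *: F (take i L') (drop i L') =
     G (take m L) (drop m L)) ->
   \sum_(s : 'S_n) (if unshuffle i (lift_perm k ord0 s) then
      (-1) ^+ koszul_exp (par \o w) (lift_perm k ord0 s) *:
       F (take i [seq w (lift_perm k ord0 s j) | j : 'I_n.+1])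
         (drop i [seq w (lift_perm k ord0 s j) | j : 'I_n.+1]) else 0) =
   splitsum par m G [seq (w \o lift ord0) j | j : 'I_n].
  move=> mn Um FG; rewrite -IH // [RHS]big_mkcond; apply: eq_bigr => s _.
  rewrite Um; case: ifP => // _; rewrite map_lift_perm koszul_exp_lift /=.
  rewrite -FG addnC exprD -scalerA; congr (_ *: ((-1) ^+ (_ * _) *: _)).
  rewrite /tpar -map_take.
  by rewrite -map_comp sumn_take_enum // -ltnS.
case: i => [|i] in i_n Ek *.
  rewrite (bigD1 ord0) //= [X in _ + X]big1 => [|k k0]; last first.
    rewrite big1 // => s _; rewrite unshuffle_lift //.
    by rewrite -(inj_eq val_inj) /= in k0; rewrite (negPf k0).
  rewrite addr0 add0r; apply: (Ek _ 0%N) => // s; first by rewrite unshuffle_lift.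
  by rewrite /= take0 !drop0 muln0.
rewrite (bigD1 ord0) //=; congr (_ + _).
  apply: (Ek ord0 i) => // s; first by rewrite unshuffle_lift // orbF.
  by rewrite /= take0 !drop0 muln0 scale1r.
have [ni|ni] := ltnP n i.+1.
  rewrite [RHS]splitsum_small; last by rewrite size_map size_enum_ord.
  rewrite big1 // => k k0.
  rewrite big1 // => s _; rewrite unshuffle_lift //.
  rewrite -(inj_eq val_inj) in k0; rewrite (negPf k0); have := ltn_ord k.
  by case: eqP => //=; lia.
pose k : 'I_n.+1 := Ordinal (ni : (i.+1 < n.+1)%N).
rewrite (bigD1 k) //= [X in _ + X]big1 => [|l lk]; last first.
  rewrite big1 // => s _; rewrite unshuffle_lift //.
  by move: lk; rewrite -!(inj_eq val_inj) /= => /andP [/negPf -> /negPf ->].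
rewrite addr0; apply: (Ek k i.+1) => // s; first by rewrite unshuffle_lift // eqxx.
set L := image _ _; have sL : size (take i.+1 L) = i.+1.
  by rewrite size_takel // size_map size_enum_ord.
by rewrite /= take_cat drop_cat sL ltnn subnn take0 drop0 cats0.
Qed.

Lemma graded_sym_perm n (w : 'I_n -> X) (s : 'S_n) (Phi : seq X -> T) :
  graded_sym par Phi ->
  Phi [seq w (s j) | j : 'I_n] =
  (-1) ^+ (koszul_exp (par \o w) s) *: Phi [seq w j | j : 'I_n].
Proof.
move=> gP.
suff H u : Phi (u ++ [seq w (s j) | j : 'I_n]) =
  (-1) ^+ (koszul_exp (par \o w) s) *: Phi (u ++ [seq w j | j :
    'I_n]) by apply: (H [::]).
elim: n w s u => [|n IH] w s u.
  rewrite /koszul_exp big_ord0 scale1r.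
  have E (v : 'I_0 -> X) : [seq v j | j : 'I_0] = [::].
    by apply: size0nil; rewrite size_map size_enum_ord.
  by rewrite /= !E.
have [k [t ->]] := lift_perm_ex s.
rewrite map_lift_perm /= (graded_sym_front gP) cat_take_drop -cat_rcons.
rewrite (IH (w \o lift ord0)) scalerA -exprD koszul_exp_lift.
rewrite map_enum_ordS cat_rcons; congr ((-1) ^+ (_ * _ + _) *: _).
by rewrite /tpar -map_take -map_comp sumn_take_enum // -ltnS.
Qed.

End Permutations.

(** * Substitution in lambda-polynomials *)

Section Bind.
Variables (A : comNzRingType) (M N : lmodType A) (p n : nat).
Implicit Types (q : 'I_p -> {mpoly A[n]}) (h g : M -> lpoly N n).

Lemma lbindE q h (P : lpoly M p) :
  lbind q h P = \sum_(m <- lsupp P) mmap1 q m *: h (lcoef m P).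
Proof. by rewrite unlock. Qed.

Section Additive.
Variables (q : 'I_p -> {mpoly A[n]}) (h : M -> lpoly N n).
Hypothesis hD : {morph h : x y / x + y}.

Let h_sub (c : {mpoly A[n]}) : zmod_morphism (fun x => c *: h x).
Proof.
move=> x y; rewrite -scalerBr; congr (_ *: _).
by apply: (addIr (h y)); rewrite -hD !subrK.
Qed.
Let hA c : {additive M -> lpoly N n} :=
  HB.pack (fun x => c *: h x) (GRing.isZmodMorphism.Build _ _ _ (h_sub c)).

Lemma lbindD (P Q : lpoly M p) : lbind q h (P + Q) = lbind q h P + lbind q h Q.
Proof. by rewrite !lbindE; apply: (lsumD (fun m => hA (mmap1 q m))). Qed.

Lemma lbind_mono m x : lbind q h (lmono m x) = mmap1 q m *: h x.
Proof. by rewrite !lbindE; apply: (lsum_mono (fun m => hA (mmap1 q m))). Qed.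

Lemma lbind0 : lbind q h 0 = 0.
Proof. by apply: (@addrI _ (lbind q h 0)); rewrite -lbindD !addr0. Qed.

Lemma lbind_sum (I : Type) (r : seq I) (P : pred I) (G : I -> lpoly M p) :
  lbind q h (\sum_(i <- r | P i) G i) = \sum_(i <- r | P i) lbind q h (G i).
Proof. exact: (big_morph _ lbindD lbind0). Qed.

Lemma lbind_const x : lbind q h (lconst p x) = h x.
Proof. by rewrite lbind_mono mmap11 scale1r. Qed.

Variable theta : {rmorphism A -> {mpoly A[n]}}.
Hypothesis hZ : forall r x, h (r *: x) = theta r *: h x.

Lemma lbind_scale c (P : lpoly M p) :
  lbind q h (c *: P) = mmap theta q c *: lbind q h P.
Proof.
have tens d x : lbind q h (ltensor d x) = mmap theta q d *: h x.
  rewrite ltensorE lbind_sum /mmap scaler_suml; apply: eq_bigr => m _.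
  by rewrite lbind_mono hZ scalerA mulrC.
rewrite [P]lmonoE scaler_sumr !lbind_sum scaler_sumr; apply: eq_bigr => m _.
by rewrite -[_ *: lmono _ _]/(lscale _ _) lscale_mono tens lbind_mono
  rmorphM /= mmapX scalerA.
Qed.

End Additive.

Lemma eq_lbind q q' h g (P : lpoly M p) : q =1 q' -> h =1 g -> lbind q h P =
  lbind q' g P.
Proof.
move=> qq hg; rewrite !lbindE; apply: eq_bigr => m _; rewrite hg; congr (_ *: _).
exact: mmap1_eq.
Qed.

Lemma lbindDh q h g (P : lpoly M p) :
  lbind q (fun y => h y + g y) P = lbind q h P + lbind q g P.
Proof. by rewrite !lbindE -big_split; apply: eq_bigr => m _; rewrite scalerDr. Qed.

Lemma lbindZh q c h (P : lpoly M p) :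
  lbind q (fun y => c *: h y) P = c *: lbind q h P.
Proof.
by rewrite !lbindE scaler_sumr; apply: eq_bigr => m _; rewrite !scalerA mulrC.
Qed.

Lemma lbind0h q (P : lpoly M p) : lbind q (fun=> 0) P = 0 :> lpoly N n.
Proof. by rewrite lbindE big1 // => m _; rewrite scaler0. Qed.

End Bind.

(** Both sides are the double sum over the coefficients of P and of P'. *)
Lemma lbind_exchange (A : comNzRingType) (M M' N : lmodType A) p p' n
  (q : 'I_p -> {mpoly A[n]}) (q' : 'I_p' -> {mpoly A[n]})
  (h : M -> M' -> lpoly N n) P P' :
  lbind q (fun y => lbind q' (h y) P') P =
  lbind q' (fun z => lbind q (h^~ z) P) P'.
Proof.
rewrite lbindE; under eq_bigr do rewrite lbindE scaler_sumr.
rewrite exchange_big lbindE; apply: eq_bigr => m _.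
rewrite lbindE scaler_sumr; apply: eq_bigr => k _.
by rewrite !scalerA mulrC.
Qed.

(** Substituting after substituting: the outer substitution also acts on the
    scalars that occur in r, through the ring morphism theta by which h
    absorbs them. *)
Lemma lbind_comp (A : comNzRingType) (M M' N : lmodType A) p p' n
  (q : 'I_p -> {mpoly A[n]}) (r : 'I_p' -> {mpoly A[p]})
  (h : M -> lpoly N n) (g : M' -> lpoly M p) (theta : {rmorphism A ->
    {mpoly A[n]}}) P :
  {morph h : x y / x + y} -> (forall r x, h (r *: x) = theta r *: h x) ->
  lbind q h (lbind r g P) =
  lbind (fun i => mmap theta q (r i)) (fun y => lbind q h (g y)) P.
Proof.
move=> hD hZ; rewrite (lbindE r) lbind_sum // lbindE; apply: eq_bigr => m _.
rewrite (lbind_scale _ hD hZ); congr (_ *: _).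
rewrite /mmap1 rmorph_prod; apply: eq_bigr => i _; exact: rmorphXn.
Qed.

(** * Cochains evaluated at weighted points *)

Section Eval.
Variable K : fieldType.

Definition scalar_emb p : K -> {mpoly {poly K}[p]} := @mpolyC p {poly K} \o polyC.
HB.instance Definition _ p := GRing.RMorphism.on (@scalar_emb p).

(** The action of polynomials in the derivation on a form of weight q: the
    derivation acts as - q. *)
Definition theta p (q : {mpoly {poly K}[p]}) : {poly K} -> {mpoly {poly K}[p]} :=
  horner_eval (- q) \o map_poly (@scalar_emb p).
HB.instance Definition _ p q := GRing.RMorphism.on (@theta p q).

Lemma thetaC p (q : {mpoly {poly K}[p]}) c : theta q c%:P = c%:P%:MP.
Proof. by rewrite /theta /= /horner_eval map_polyC hornerC. Qed.

Lemma thetaX p (q : {mpoly {poly K}[p]}) : theta q 'X = - q.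
Proof. by rewrite /theta /= /horner_eval map_polyX hornerX. Qed.

Lemma theta_dd p r : theta (- dd K p) r = r%:MP.
Proof.
elim/poly_ind: r => [|r c IH]; first by rewrite !rmorph0.
by rewrite !rmorphD !rmorphM /= IH thetaC thetaX opprK.
Qed.

Definition point p (M : lmodType {poly K}) : Type := ({mpoly {poly K}[p]} * M)%type.

(** A form in one weighted argument on which a value of total weight q sees
    the derivation as - q, as prescribed by the sesquilinearity of cochains. *)
Definition sesqui p (M N : lmodType {poly K}) (chi : point p M -> lpoly N p) : Prop :=
  forall q, {morph (fun y => chi (q, y)) : y z / y + z} /\
   forall r y, chi (q, r *: y) = theta q r *: chi (q, y).

Lemma sesquiP p (M N : lmodType {poly K}) (chi : point p M -> lpoly N p) :
  (forall q (c : K) y z, chi (q, c%:P *: y + z) = c%:P%:MP *: chi (q, y) + chi (q,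
    z)) ->
  (forall q y, chi (q, 'X *: y) = - q *: chi (q, y)) ->
  sesqui chi.
Proof.
move=> hl hX q; have hD : {morph (fun y => chi (q, y)) : y z / y + z}.
  by move=> y z /=; have := hl q 1 y z; rewrite polyC1 mpolyC1 !scale1r.
have h0 : chi (q, 0) = 0 by apply: (@addrI _ (chi (q, 0))); rewrite -hD !addr0.
split=> // r; elim/poly_ind: r => [|r c IH] y; first by rewrite rmorph0 !scale0r.
rewrite scalerDl hD -scalerA IH hX -[c%:P *: y]addr0 hl h0 addr0.
by rewrite rmorphD rmorphM /= thetaC thetaX scalerDl scalerA.
Qed.

Lemma updE (M : lmodType {poly K}) n (x : 'I_n.+1 -> M) i y j :
  upd x i y j = if j == i then y else x j.
Proof. by []. Qed.

Section Ev.
Variables (p : nat) (M M' N : lmodType {poly K}).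
Local Notation S := {mpoly {poly K}[p]}.
Local Notation X := (point p M).

(** The pairing of f with a form chi at weighted arguments: weights replace
    the variables and chi receives the value with the total weight. The value
    0 on lists of the wrong size makes the symmetry and linearity statements
    unconditional. *)
Definition ev n (f : precochain M M' n) (chi : point p M' -> lpoly N p) (s : seq X)
    : lpoly N p :=
  if size s == n.+1 then
    lbind (fun i : 'I_n => (nth (0, 0) s i).1)
          (fun y => chi (\sum_(z <- s) z.1, y))
          (f (fun i => (nth (0, 0) s i).2))
  else 0.

Lemma nth_ord_map (Y : Type) (y0 : Y) n (w : 'I_n -> Y) (i : 'I_n) :
  nth y0 [seq w j | j : 'I_n] i = w i.
Proof. by rewrite (nth_map i) ?size_enum_ord // nth_ord_enum. Qed.

Lemma seq_ord_map n (s : seq X) : size s = n ->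
  s = [seq nth (0, 0) s j | j : 'I_n].
Proof.
move=> <-; rewrite -[LHS](mkseq_nth (0, 0)) /mkseq -val_enum_ord -map_comp.
exact: eq_map.
Qed.

Lemma evE n (f : precochain M M' n) chi (w : 'I_n.+1 -> X) :
  ev f chi [seq w i | i : 'I_n.+1] =
  lbind (fun i => (w (lift ord_max i)).1) (fun y => chi (\sum_i (w i).1, y))
    (f (fun i => (w i).2)).
Proof.
rewrite /ev size_map size_enum_ord eqxx big_map big_enum /=.
have -> : (fun i : 'I_n.+1 => (nth (0, 0) [seq w i | i : 'I_n.+1] i).2) = fun i =>
  (w i).2.
  by apply/funext => i; rewrite nth_ord_map.
apply: eq_lbind => // i; rewrite -(nth_ord_map (0, 0) w).
by congr (nth _ _ _).1; rewrite /= /bump leqNgt ltn_ord.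
Qed.

Lemma ev_size n (f : precochain M M' n) chi s : size s != n.+1 -> ev f chi s = 0.
Proof. by rewrite /ev => /negPf ->. Qed.

(** Why the last argument is not special: with the derivation acting as minus
    the total weight, the variable that was eliminated becomes the last
    weight. *)
Lemma mmap_lvar n (w : 'I_n.+1 -> S) j :
  mmap (theta (\sum_i w i)) (fun i => w (lift ord_max i)) (lvar K j) = w j.
Proof.
rewrite /lvar; case: unliftP => [i|] ->; first by rewrite mmapX mmap1U.
rewrite rmorphB rmorphN rmorph_sum /= mmapC /= thetaX.
under eq_bigr do rewrite mmapX mmap1U.
rewrite opprK big_ord_recr /= addrA [X in - _ + X](_ : _ =
  \sum_(i < n) w (lift ord_max i)).
  by rewrite addNr add0r.
by apply: eq_bigr => i _; congr w; apply: val_inj; rewrite /= /bump leqNgt ltn_ord.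
Qed.

Section Cochain.
Variables (n : nat) (f : precochain M M' n) (chi : point p M' -> lpoly N p).
Hypotheses (fC : is_cochain f) (gchi : sesqui chi).

(** By [mmap_lvar] the substitution in the skew-symmetry axiom becomes a mere
    permutation of the weights. *)
Lemma ev_perm (w : 'I_n.+1 -> X) (s : 'S_n.+1) :
  ev f chi [seq w j | j : 'I_n.+1] = (-1) ^+ s *: ev f chi [seq w (s j) | j :
    'I_n.+1].
Proof.
have [hD hZ] := gchi (\sum_i (w i).1).
rewrite !evE (coch_skew fC _ s) (lbind_scale _ hD hZ) rmorph_sign; congr (_ *: _).
rewrite /lsubst (lbind_comp _ _ _ _ hD hZ).
have -> : \sum_i (w (s i)).1 = \sum_i (w i).1.
  by rewrite [RHS](reindex_inj (@perm_inj _ s)).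
apply: eq_lbind => [i|y]; first by rewrite (mmap_lvar (fun i => (w i).1)).
by rewrite lbind_const.
Qed.

Lemma ev_skew : graded_sym (fun=> 1%N) (ev f chi).
Proof.
move=> u x y v; have [sz|sz] := eqVneq (size (u ++ x :: y :: v)) n.+1; last first.
  by rewrite !ev_size ?scaler0 //; move: sz; rewrite !size_cat.
have un : (size u < n.+1)%N by rewrite -sz size_cat /=; lia.
have un1 : ((size u).+1 < n.+1)%N by rewrite -sz size_cat /=; lia.
rewrite [in LHS](seq_ord_map sz) (ev_perm _ (tperm (Ordinal un) (Ordinal un1))).
rewrite odd_tperm -val_eqE /= neq_ltn ltnSn muln1; congr (_ *: ev _ _ _).
apply: (@eq_from_nth _ (0, 0)); rewrite size_map size_enum_ord.
  by rewrite -sz !size_cat.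
move=> j jn; rewrite -[j]/(val (Ordinal jn)); move: (Ordinal jn) => {jn} k.
rewrite nth_ord_map.
case: tpermP => [->|->|/eqP h1 /eqP h2] /=.
- by rewrite !nth_cat ltnn subnn ltnNge leqnSn /= subSnn.
- by rewrite !nth_cat ltnn subnn ltnNge leqnSn /= subSnn.
move: h1 h2; rewrite -!val_eqE /= !nth_cat => h1 h2; case: ltnP => // uj.
by move: h1 h2; case: (k - size u)%N (subnK uj) => [|[|l]] <-; rewrite ?eqxx.
Qed.

Lemma coch_sesq' x i y : f (upd x i ('X *: y)) = - lvar K i *: f (upd x i y).
Proof.
rewrite -coch_sesq //; congr f; apply/funext => j.
by rewrite !updE eqxx; case: eqP.
Qed.

Lemma upd_nth (s1 s2 : seq X) (q : S) (i : 'I_n.+1) y : size s1 = i ->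
  (fun i : 'I_n.+1 => (nth (0, 0) (s1 ++ (q, y) :: s2) i).2) =
  upd (fun i : 'I_n.+1 => (nth (0, 0) (s1 ++ (q, 0) :: s2) i).2) i y.
Proof.
move=> si; apply/funext => j; rewrite updE !nth_cat -val_eqE /= si.
case: ltngtP => [//|ij|->]; last by rewrite subnn.
by have := subnK (ltnW ij); case: (j - i)%N => [e|//]; rewrite -e ltnn in ij.
Qed.

Lemma ev_upd (s1 s2 : seq X) (q : S) y (i : 'I_n.+1) :
  size s1 = i -> size (s1 ++ s2) = n ->
  let w i := nth (0, 0) (s1 ++ (q, 0) :: s2) i in
  ev f chi (s1 ++ (q, y) :: s2) =
  lbind (fun i : 'I_n => (w (lift ord_max i)).1) (fun y =>
    chi (\sum_(i < n.+1) (w i).1, y))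
    (f (upd (fun i : 'I_n.+1 => (w i).2) i y)).
Proof.
move=> s1i sz w; rewrite /ev -(upd_nth _ _ _ s1i).
have s12 (z : X) : size (s1 ++ z :: s2) = n.+1 by rewrite size_cat /= addnS
  -size_cat sz.
have E1 j : (nth (0, 0) (s1 ++ (q, y) :: s2) j).1 = (nth (0, 0) (s1 ++ (q,
  0) :: s2) j).1.
  by rewrite !nth_cat; case: ltnP => // _; case: (j - _)%N.
rewrite s12 eqxx; apply: eq_lbind => [j|z].
  by rewrite E1 /w /= /bump leqNgt ltn_ord.
rewrite (seq_ord_map (s12 (q, y))) big_map big_enum /=.
by under eq_bigr do rewrite E1.
Qed.

Lemma ev_sesqui (s1 s2 : seq X) : sesqui (fun z => ev f chi (s1 ++ z :: s2)).
Proof.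
have [sz|sz] := eqVneq (size (s1 ++ s2)) n; last first.
  have H z : ev f chi (s1 ++ z :: s2) = 0.
    by apply: ev_size; move: sz; rewrite !size_cat /= addnS eqSS.
  by move=> q; split=> [y z|r y]; rewrite !H ?addr0 ?scaler0.
have ui : (size s1 < n.+1)%N by rewrite -sz size_cat; lia.
pose i := Ordinal ui; apply: sesquiP => q => [c y z|y].
  rewrite !(@ev_upd _ _ q _ i) // coch_lin //; set mu := \sum_(j < _) _.
  have [hD hZ] := gchi mu.
  by rewrite lbindD // (lbind_scale _ hD hZ) mmapC /= thetaC.
rewrite !(@ev_upd _ _ q _ i) // coch_sesq' //; set mu := \sum_(j < _) _.
have [hD hZ] := gchi mu.
rewrite (lbind_scale _ hD hZ) rmorphN; congr (- _ *: _).
apply: etrans (mmap_lvar (fun i : 'I_n.+1 => (nth (0, 0) (s1 ++ (q,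
  0) :: s2) i).1) i) _.
by rewrite /= nth_cat ltnn subnn.
Qed.

End Cochain.
End Ev.

Section Universal.
Variables (p : nat) (M N : lmodType {poly K}).
Local Notation X := (point p M).

(** At total weight minus the derivation, the value itself is such a form; at
    other weights the form is 0, so that it is sesquilinear everywhere. *)
Definition chi0 (z : point p N) : lpoly N p :=
  if z.1 == - dd K p then lconst p z.2 else 0.

Lemma lconstD : {morph @lconst _ N p : y z / y + z}.
Proof. by move=> y z; rewrite /lconst -!ltensor_mono ltensorDr. Qed.

Lemma lconstZ r (y : N) : lconst p (r *: y) = r%:MP *: lconst p y.
Proof.
rewrite -[RHS]/(lscale _ _) lscale_mono -[RHS]/(ltensor (r%:MP * 'X_[0%MM]) y).
by rewrite /lconst -ltensor_mono ltensorZ mul_mpolyC.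
Qed.

Lemma chi0_sesqui : sesqui chi0.
Proof.
move=> q; rewrite /chi0 /=; case: eqP => [->|_]; split=> [y z|r y];
  rewrite ?addr0 ?scaler0 //=; first exact: lconstD.
by rewrite theta_dd lconstZ.
Qed.

(** The weights of a cochain that is evaluated at its own variables; they add
    up to minus the derivation by [sum_lvar]. *)
Definition pts (x : 'I_p.+1 -> M) : seq X := [seq (lvar K i, x i) | i : 'I_p.+1].

Lemma size_pts (x : 'I_p.+1 -> M) : size (pts x) = p.+1.
Proof. by rewrite size_map size_enum_ord. Qed.

Lemma lvar_lift (i : 'I_p) : lvar K (lift ord_max i) = 'X_i.
Proof. by rewrite /lvar liftK. Qed.

Lemma sum_lvar : \sum_i lvar K i = - dd K p.
Proof.
rewrite big_ord_recr /= [X in _ + X](_ : _ = - (\sum_(j < p) 'X_j) - dd K p);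
  last first.
  by rewrite /lvar unlift_none.
rewrite addrA [X in X - _ - _](_ : _ = \sum_(j < p) 'X_j) ?subrr ?sub0r //.
apply: eq_bigr => i _; rewrite -lvar_lift; congr (lvar K); apply: val_inj.
by rewrite /= /bump leqNgt ltn_ord.
Qed.

Lemma lbind_X (P : lpoly N p) q : q =1 (fun i => 'X_i) ->
  lbind q (@lconst _ N p) P = P.
Proof.
move=> qX; rewrite (eq_lbind P qX (fun=> erefl)) lbindE [RHS]lmonoE.
apply: eq_bigr => m _; rewrite mmap1_id -[_ *: _]/(lscale _ _) lscale_mono.
by rewrite -[(0 : 'X_{1..p})%MM]/0%MM mpolyX0 mulr1 ltensor_mono.
Qed.

Lemma ev_pts (f : precochain M N p) x : ev f chi0 (pts x) = f x.
Proof.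
rewrite evE /= sum_lvar; under eq_lbind => [i|y].
- by rewrite lvar_lift; over.
- rewrite /chi0 eqxx; over.
exact: lbind_X.
Qed.

Lemma ev_lsubst (f : precochain M N p) x (s : 'S_p.+1) :
  ev f chi0 [seq (lvar K (s i), x (s i)) | i : 'I_p.+1] =
  lsubst (fun i => lvar K (s (lift ord_max i))) (f (x \o s)).
Proof.
rewrite evE /=; have -> : \sum_i lvar K (s i) = - dd K p.
  by rewrite -sum_lvar [RHS](reindex_inj (@perm_inj _ s)).
by apply: eq_lbind => // y; rewrite /chi0 eqxx.
Qed.

Lemma pts_split x (i : 'I_p.+1) :
  {s1 : seq X & {s2 : seq X | forall y, pts (upd x i y) = s1 ++ (lvar K i, y) :: s2}}.
Proof.
exists (take i (pts x)), (drop i.+1 (pts x)) => y.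
apply: (@eq_from_nth _ (0, 0)).
  by rewrite size_cat /= size_take size_drop !size_pts ltn_ord; have := ltn_ord i;
    lia.
move=> j; rewrite size_pts => jp; rewrite -[j]/(val (Ordinal jp));
  move: (Ordinal jp) => k.
rewrite nth_ord_map nth_cat size_take size_pts ltn_ord updE -val_eqE /=.
have [ki|ik|ki] := ltngtP k i; last by rewrite ki subnn; rewrite (val_inj ki).
  by rewrite nth_take // nth_ord_map.
have -> : (k - i)%N = (k - i.+1).+1 by lia.
by rewrite /= nth_drop subnKC // nth_ord_map.
Qed.

(** The axioms of cochains can be checked on lists of weighted points, where
    adjacent transpositions suffice for skew-symmetry. *)
Lemma ev_cochain (f : precochain M N p) :
  graded_sym (fun=> 1%N) (ev f chi0) ->
  (forall s1 s2, sesqui (fun z : X => ev f chi0 (s1 ++ z :: s2))) ->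
  is_cochain f.
Proof.
move=> fs fg; split=> [x i c y z|x i|x s].
- have [s1 [s2 E]] := pts_split x i; rewrite -!ev_pts !E.
  have [hD hZ] := fg s1 s2 (lvar K i).
  by rewrite hD hZ thetaC.
- have [s1 [s2 E]] := pts_split x i.
  have xE : x = upd x i (x i).
    by apply/funext => j; rewrite updE; case: eqP => // ->.
  rewrite -!ev_pts {3}xE !E; have [hD hZ] := fg s1 s2 (lvar K i).
  by rewrite hZ thetaX.
rewrite -ev_pts -ev_lsubst.
rewrite (graded_sym_perm (fun i => (lvar K i, x i)) s fs).
rewrite -(signr_odd _ (koszul_exp _ _)) (koszul_exp1 s :
  odd (koszul_exp (_ \o _) s) = _).
by rewrite scalerA -expr2 sqrr_sign scale1r.
Qed.

End Universal.

End Eval.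

(** * The product of cochains as an operator on forms *)

Section EvLinear.
Variables (K : fieldType) (p : nat) (M M' N : lmodType {poly K}).
Local Notation X := (point p M).
Local Notation T := (lpoly N p).
Implicit Types (chi : point p M' -> T) (s : seq X).

Lemma eq_ev n (f : precochain M M' n) chi chi' s :
  chi =1 chi' -> ev f chi s = ev f chi' s.
Proof. by move=> e; congr (ev f _ s); apply/funext. Qed.

Lemma evDc n (f : precochain M M' n) chi chi' s :
  ev f (fun z => chi z + chi' z) s = ev f chi s + ev f chi' s.
Proof. by rewrite /ev; case: ifP; rewrite ?addr0 // lbindDh. Qed.

Lemma evZc n (f : precochain M M' n) c chi s :
  ev f (fun z => c *: chi z) s = c *: ev f chi s.
Proof. by rewrite /ev; case: ifP; rewrite ?scaler0 // lbindZh. Qed.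

Lemma ev0c n (f : precochain M M' n) s : ev f (fun=> 0 : T) s = 0.
Proof. by rewrite /ev; case: ifP => // _; rewrite lbind0h. Qed.

Lemma ev_splitsum n k (f : precochain M M' n) (X' : Type) par
    (F : point p M' -> seq X' -> seq X' -> T) t s :
  ev f (fun z => splitsum par k (F z) t) s =
  splitsum par k (fun u v => ev f (fun z => F z u v) s) t.
Proof.
elim: t k F => [|x t IH] [|k] F //=; rewrite ?ev0c //.
  rewrite add0r (eq_ev _ _ (fun z => add0r _)) IH.
  by apply: eq_splitsum => u v _ _; rewrite evZc.
rewrite evDc !IH; congr (_ + _).
by apply: eq_splitsum => u v _ _; rewrite evZc.
Qed.

Lemma ev_linl n (f g : precochain M M' n) c chi s : sesqui chi ->
  ev (fun x => c%:P%:MP *: f x + g x) chi s = c%:P%:MP *: ev f chi s + ev g chi s.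
Proof.
move=> gchi; rewrite /ev; case: ifP; rewrite ?scaler0 ?addr0 // => _.
have [hD hZ] := gchi (\sum_(z <- s) z.1).
by rewrite lbindD // (lbind_scale _ hD hZ) mmapC /= thetaC.
Qed.

Lemma ev_0l n chi s : sesqui chi -> ev (fun=> 0 : lpoly M' n) chi s = 0.
Proof.
move=> gchi; rewrite /ev; case: ifP => // _.
by have [hD hZ] := gchi (\sum_(z <- s) z.1); rewrite lbind0.
Qed.

Lemma ev_exchange m n M1 M2 (f : precochain M M1 m) (g : precochain M M2 n)
    (chi : point p M1 -> point p M2 -> T) s t :
  ev f (fun y => ev g (chi y) t) s = ev g (fun z => ev f (chi^~ z) s) t.
Proof.
rewrite /ev; case: ifP => _; case: ifP => _; rewrite ?lbind0h //.
exact: lbind_exchange.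
Qed.

Lemma sesquiD (chi chi' : X -> T) : sesqui chi -> sesqui chi' -> sesqui (fun z =>
  chi z + chi' z).
Proof.
move=> g g' q; have [hD hZ] := g q; have [hD' hZ'] := g' q.
by split=> [y z|r y]; rewrite ?hD ?hD' ?hZ ?hZ' ?scalerDr // addrACA.
Qed.

Lemma sesquiZ c (chi : X -> T) : sesqui chi -> sesqui (fun z => c *: chi z).
Proof.
move=> g q; have [hD hZ] := g q.
by split=> [y z|r y]; rewrite ?hD ?hZ ?scalerDr // !scalerA mulrC.
Qed.

Lemma sesqui0 : sesqui (fun _ : X => 0 : T).
Proof. by move=> q; split=> [y z|r y]; rewrite ?addr0 ?scaler0. Qed.

Lemma sesqui_splitsum k (X' : Type) par (F : X -> seq X' -> seq X' -> T) t :
  (forall u v, sesqui (fun z => F z u v)) -> sesqui (fun z => splitsum par k (F z) t).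
Proof.
elim: t k F => [|x t IH] [|k] F gF /=; [exact: gF|exact: sesqui0| |].
  by apply: sesquiD; [exact: sesqui0|apply: IH => u v; apply: sesquiZ].
by apply: sesquiD; apply: IH => u v //; apply: sesquiZ.
Qed.

End EvLinear.

Lemma sesqui_ev (K : fieldType) p (M M1 M' N : lmodType {poly K}) n
   (f : precochain M M' n) (chi : point p M1 -> point p M' -> lpoly N p) s :
  (forall z, sesqui (chi^~ z)) -> sesqui (fun y => ev f (chi y) s).
Proof.
move=> gc q; split=> [y z|r y].
  by rewrite -evDc; apply: eq_ev => w; rewrite (gc w q).1.
by rewrite -evZc; apply: eq_ev => w; rewrite (gc w q).2.
Qed.

Section Star.
Variables (K : fieldType) (E : lmodType {poly K}).
Local Notation one := (fun=> 1%N).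

Section EvStar.
Variables (p : nat) (N : lmodType {poly K}).
Local Notation X := (point p E).

(** The product, paired with chi, is g paired with the form that f induces on
    its first argument, summed over the splittings of the arguments. In the
    definition of star the first subscript of f is the total weight of the
    arguments of g, which is what the pairing with g passes on. *)
Lemma ev_star m n k (f : precochain E E m) (g : precochain E E n)
    (chi : X -> lpoly N p) (s : seq X) : k = (m + n)%N -> sesqui chi ->
  ev (star f g : precochain E E k) chi s =
  splitsum one n.+1 (fun u v => ev g (fun z => ev f chi (z :: v)) u) s.
Proof.
move=> kE gchi; have [sk|sk] := eqVneq (size s) k.+1; last first.
  rewrite ev_size //; transitivity (splitsum one n.+1 (fun u v : seq X => 0 :
    lpoly N p) s).
    by rewrite splitsum0.
  apply: eq_splitsum => u v un /splits_of_size uv.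
  apply: (etrans (esym (ev0c N g u))); apply: eq_ev => z.
  apply: esym; rewrite ev_size //=; move: sk; rewrite kE -uv un; apply: contra =>
    /eqP [->]; lia.
rewrite (seq_ord_map sk); set w := fun j : 'I_k.+1 => nth _ s j.
have nk : (n.+1 <= k.+1)%N by rewrite ltnS kE leq_addl.
rewrite -sum_unshuffle // evE /star; set mu := \sum_i (w i).1.
have [hD hZ] := gchi mu.
rewrite lbind_sum //; apply: eq_bigr => t _.
rewrite (lbind_scale _ hD hZ) rmorph_sign.
rewrite -[X in _ = X *: _]signr_odd (koszul_exp1 t : odd (koszul_exp (_ \o _) t) =
  _); congr (_ *: _).
rewrite (lbind_comp _ _ _ _ hD hZ) /=.
set L := [seq w (t j) | j : 'I_k.+1].
have sL : size L = k.+1 by rewrite size_map size_enum_ord.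
have nthL j : (j < k.+1)%N -> nth (0, 0) L j = w (t (inord j)).
  by move=> jk; rewrite -{1}(inordK jk) nth_ord_map.
have EL1 : take n.+1 L = [seq w (t (inord i)) | i : 'I_n.+1].
  apply: (@eq_from_nth _ (0, 0)) => [|j]; rewrite size_takel ?sL //.
    by rewrite size_map size_enum_ord.
  move=> jn; rewrite nth_take // nthL; last exact: leq_trans jn nk.
  by rewrite -[in RHS](_ : nat_of_ord (Ordinal jn) = j) // nth_ord_map.
rewrite {1}EL1 evE; apply: eq_lbind => [i|y].
  rewrite (mmap_lvar (fun i => (w i).1)); congr (w (t (inord _))).1.
  by rewrite /= /bump leqNgt ltn_ord.
pose z := (\sum_(i < n.+1) (w (t (inord i))).1, y).
have EL2 : z :: drop n.+1 L =
    [seq if j == ord0 then z else w (t (inord (n + j))) | j : 'I_m.+1].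
  apply: (@eq_from_nth _ (0, 0)) => [|[|j]].
  - by rewrite /= size_drop sL size_map size_enum_ord kE; lia.
  - by move=> _; rewrite [LHS]/= -[0%N]/(val (@ord0 m)) nth_ord_map.
  rewrite /= ltnS size_drop sL => jn; have jm : (j.+1 < m.+1)%N by lia.
  rewrite -[in RHS](_ : nat_of_ord (Ordinal jm) = j.+1) // nth_ord_map /=.
  by rewrite nth_drop nthL ?addSnnS //; lia.
rewrite EL2 evE; set mu' := \sum_(i < m.+1) _.
(* z is the argument of f that carries the value of g: its weight is the
   total weight of the arguments of g *)
have zE : \sum_(i < k.+1 | (i < n.+1)%N) (w (t i)).1 = z.1.
  rewrite big_ord_narrow /z /=; apply: eq_bigr => i _; congr (w (t _)).1.
  by apply: val_inj; rewrite /= inordK //; apply: leq_trans (ltn_ord i) nk.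
have -> : mu' = mu.
  transitivity (\sum_(x <- z :: drop n.+1 L) x.1).
    by rewrite EL2 big_map big_enum.
  rewrite big_cons -(_ : \sum_(x <- take n.+1 L) x.1 = z.1); last first.
    by rewrite EL1 big_map big_enum.
  rewrite -big_cat cat_take_drop big_map big_enum /= /mu.
  by rewrite [RHS](reindex_inj (@perm_inj _ t)).
rewrite /lsubst (lbind_comp _ _ _ _ hD hZ).
have -> : (fun i : 'I_m.+1 => (if i == ord0 then z else w (t (inord (n + i)))).2) =
   (fun i : 'I_m.+1 => if i == ord0 then y else (w (t (inord (n + i)))).2).
  by apply/funext => i; case: ifP.
apply: eq_lbind => [i|v]; last by rewrite lbind_const.
have -> : (lift ord_max i == ord0 :> 'I_m.+1) = (i == 0 :> nat).
  by rewrite -val_eqE /= /bump leqNgt ltn_ord.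
case: ifP => _.
  rewrite -zE rmorph_sum; apply: eq_bigr => j _.
  exact: (mmap_lvar (fun i => (w i).1)).
rewrite (mmap_lvar (fun i => (w i).1)); congr (w (t (inord (_ + _)))).1.
by rewrite /= /bump leqNgt ltn_ord.
Qed.

End EvStar.

Lemma starE m n k (f : precochain E E m) (g : precochain E E n) x :
  k = (m + n)%N -> star f g x =
  splitsum one n.+1 (fun u v => ev g (fun z =>
    ev f (@chi0 K k E) (z :: v)) u) (pts x).
Proof. by move=> kE; rewrite -ev_pts (ev_star _ _ _ kE) //; apply: chi0_sesqui. Qed.

Lemma star_linl m n k (f f' : precochain E E m) (g : precochain E E n) c (x :
  'I_k.+1 -> E) :
  k = (m + n)%N ->
  star (fun y => c%:P%:MP *: f y + f' y) g x = c%:P%:MP *: star f g x + star f' g x.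
Proof.
move=> kE; rewrite !starE // -splitsum_scale -splitsumD; apply: eq_splitsum =>
  u v _ _.
rewrite -evZc -evDc; apply: eq_ev => z; rewrite ev_linl //; exact: chi0_sesqui.
Qed.

Lemma star_linr m n k (f : precochain E E m) (g g' : precochain E E n) c (x :
  'I_k.+1 -> E) :
  k = (m + n)%N -> is_cochain f ->
  star f (fun y => c%:P%:MP *: g y + g' y) x = c%:P%:MP *: star f g x + star f g' x.
Proof.
move=> kE fC; rewrite !starE // -splitsum_scale -splitsumD; apply: eq_splitsum =>
  u v _ _.
by rewrite ev_linl //; apply: (ev_sesqui fC (@chi0_sesqui _ _ _) [::] v).
Qed.

Lemma star0l m n k (g : precochain E E n) (x : 'I_k.+1 -> E) : k = (m + n)%N ->
  star (fun=> 0 : lpoly E m) g x = 0.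
Proof.
move=> kE; rewrite starE // -[RHS](@splitsum0 _ one _ _ n.+1 (pts x)).
apply: eq_splitsum => u v _ _; apply: (etrans _ (ev0c _ g u)); apply: eq_ev => z.
by rewrite ev_0l //; apply: chi0_sesqui.
Qed.

Lemma star0r m n k (f : precochain E E m) (x : 'I_k.+1 -> E) : k = (m + n)%N ->
  is_cochain f -> star f (fun=> 0 : lpoly E n) x = 0.
Proof.
move=> kE fC; rewrite starE // -[RHS](@splitsum0 _ one _ _ n.+1 (pts x)).
apply: eq_splitsum => u v _ _; apply: ev_0l.
exact: (ev_sesqui fC (@chi0_sesqui _ _ _) [::] v).
Qed.

(** Skew-symmetry is that of signed sums; by it, linearity and sesquilinearity
    need only be checked in the first argument, which the recursion treats
    explicitly. *)
Lemma star_cochain m n k (f : precochain E E m) (g : precochain E E n) :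
  k = (m + n)%N -> is_cochain f -> is_cochain g -> is_cochain (star f g :
    precochain E E k).
Proof.
move=> kE fC gC.
have c0 := @chi0_sesqui K k E.
have es s := ev_star f g s kE c0.
have sg : graded_sym one (ev (star f g : precochain E E k) (@chi0 K k E)).
  move=> u x y v; rewrite !es; apply: splitsum_graded_sym => [w|w] a p q b.
    by apply: ev_skew => //; exact: (ev_sesqui fC c0 [::] w).
  rewrite -evZc; apply: eq_ev => z.
  exact: (ev_skew fC c0 (z :: a)).
apply: ev_cochain => // s1 s2.
have E0 z : ev (star f g : precochain E E k) (@chi0 K k E) (s1 ++ z :: s2) =
   (-1) ^+ (1 * tpar one s1) *: ev (star f g :
     precochain E E k) (@chi0 K k E) (z :: s1 ++ s2).
  exact: (graded_sym_front sg [::]).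
have -> : (fun z => ev (star f g : precochain E E k) (@chi0 K k E) (s1 ++ z :: s2)) =
  fun z => (-1) ^+ (1 * tpar one s1) *: ev (star f g :
    precochain E E k) (@chi0 K k E) (z :: s1 ++ s2).
  by apply/funext => z; rewrite E0.
apply: sesquiZ.
have -> : (fun z => ev (star f g : precochain E E k) (@chi0 K k E) (z :: s1 ++ s2)) =
   fun z => splitsum one n (fun u v => ev g (fun z' =>
     ev f (@chi0 K k E) (z' :: v)) (z :: u)) (s1 ++ s2)
    + splitsum one n.+1 (fun u v => (-1) ^+ (1 * tpar one u) *: ev g (fun z' =>
      ev f (@chi0 K k E) (z' :: z :: v)) u) (s1 ++ s2).
  by apply/funext => z; rewrite es.
apply: sesquiD; apply: sesqui_splitsum => u v.
  exact: (ev_sesqui gC (ev_sesqui fC c0 [::] v) [::] u).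
apply: sesquiZ; apply: sesqui_ev => z; exact: (ev_sesqui fC c0 [:: z] v).
Qed.

Lemma tpar_one (X : Type) (s : seq X) : tpar one s = size s.
Proof. by elim: s => //= x s <-. Qed.

Section Associator.
Variables (p : nat).
Local Notation X := (point p E).

(** The part of (f * g) * h where the values of g and h are both arguments of
    f. *)
Definition nested m n l (f : precochain E E m) (g : precochain E E n)
    (h : precochain E E l) (chi : X -> lpoly E p) (s : seq X) : lpoly E p :=
  splitsum one l.+1 (fun u r => splitsum one n.+1 (fun v w => (-1) ^+ n.+1 *:
    ev h (fun y => ev g (fun z => ev f chi (z :: y :: w)) v) u) r) s.

(** In (f * g) * h the value y of h heads the list of arguments of f * g. If y
    is an argument of g, coassociativity gives f * (g * h); otherwise y passes
    the n+1 arguments of g, whence the sign in [nested]. The degrees k1 and k2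
    are kept apart from m + n and n + l to avoid casts. *)
Lemma associator m n l k1 k2 k (f : precochain E E m) (g : precochain E E n)
    (h : precochain E E l) chi s :
  k1 = (m + n)%N -> k2 = (n + l)%N -> k = (m + n + l)%N -> is_cochain f ->
    sesqui chi ->
  ev (star (star f g : precochain E E k1) h : precochain E E k) chi s =
  ev (star f (star g h : precochain E E k2) : precochain E E k) chi s +
    nested f g h chi s.
Proof.
move=> k1E k2E kE fC gchi.
rewrite !ev_star //; try by rewrite kE ?k1E ?k2E // addnA.
transitivity (splitsum one l.+1 (fun u r =>
   splitsum one n (fun v w => ev h (fun y => ev g (fun z =>
     ev f chi (z :: w)) (y :: v)) u) r
   + splitsum one n.+1 (fun v w => (-1) ^+ n.+1 *:
    ev h (fun y => ev g (fun z => ev f chi (z :: y :: w)) v) u) r) s).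
  apply: eq_splitsum => u r _ _.
  rewrite (eq_ev _ _ (fun y => ev_star f g (y :: r) k1E gchi)) /= evDc !ev_splitsum.
  congr (_ + _); apply: eq_splitsum => v w vn _; rewrite evZc mul1n.
  by rewrite tpar_one vn.
rewrite splitsumD; congr (_ + _); rewrite splitsum_assoc.
have -> : k2.+1 = (l.+1 + n)%N by lia.
apply: eq_splitsum => r w _ _.
by rewrite (ev_star _ _ _ k2E) //; apply: (ev_sesqui fC gchi [::] w).
Qed.

(** Exchanging the two blocks of arguments costs (n+1)(l+1) and exchanging the
    two first arguments of f costs 1; together with the signs n+1 and l+1
    inside [nested] this is n l modulo 2. *)
Lemma nested_comm m n l (f : precochain E E m) (g : precochain E E n)
    (h : precochain E E l) chi s : is_cochain f -> sesqui chi ->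
  nested f g h chi s = (-1) ^+ (n * l) *: nested f h g chi s.
Proof.
move=> fC gchi; rewrite /nested splitsum_comm -splitsum_scale.
apply: eq_splitsum => v r vn _; rewrite -splitsum_scale; apply: eq_splitsum =>
  u w ul _.
rewrite !tpar_one vn ul ev_exchange.
have -> : ev g (fun z => ev h (fun y => ev f chi [:: z, y & w]) u) v =
  (-1) ^+ 1 *: ev g (fun y => ev h (fun z => ev f chi [:: z, y & w]) u) v.
  rewrite -evZc; apply: eq_ev => z; rewrite -evZc; apply: eq_ev => y.
  exact: (ev_skew fC gchi [::]).
by rewrite !scalerA -!exprD; apply: sign_eq; rewrite !(oddD, oddM, oddS) /=; parity.
Qed.

End Associator.
End Star.

(** * The Nijenhuis-Richardson graded Lie algebra *)

Lemma jacobi_terms (V : zmodType) (x1 x2 x3 x4 x5 x6 : V) :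
  x1 - x2 + x4 - x3 = x1 - x5 + x4 - x6 + x5 - x3 + x6 - x2.
Proof. by rewrite [RHS](ACl (1*8*3*6*(2*5)*(4*7)))%AC /= !addNr !addr0. Qed.

Arguments nr {K E} f g n x : rename.

Section Families.
Variables (K : fieldType).

Lemma scalar_emb_sign n k : (((-1) ^+ k : K)%:P)%:MP =
  (-1) ^+ k :> {mpoly {poly K}[n]}.
Proof. by rewrite -[LHS]/(@scalar_emb K n _) rmorph_sign. Qed.

Section MN.
Variables (M N : lmodType {poly K}).
Implicit Types (f g : cfam M N).

Lemma cfam_sumE (I : Type) (r : seq I) (P : pred I) (F : I -> cfam M N) n x :
  (\sum_(i <- r | P i) F i) n x = \sum_(i <- r | P i) F i n x.
Proof. by apply: (big_morph (fun f : cfam M N => f n x)). Qed.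

Lemma is_cochain0 n : is_cochain ((fun=> 0) : precochain M N n).
Proof.
apply: (@ev_cochain _ n M N) => [u x y v|s1 s2].
  by rewrite !ev_0l ?scaler0 //; apply: chi0_sesqui.
move=> q; split=> [y z|r y]; rewrite !ev_0l ?addr0 ?scaler0 //; exact: chi0_sesqui.
Qed.

Lemma is_cochain_lin n c (f g : precochain M N n) : is_cochain f -> is_cochain g ->
  is_cochain ((fun x => c%:P%:MP *: f x + g x) : precochain M N n).
Proof.
move=> fC gC; have c0 := @chi0_sesqui K n N.
have E s : ev ((fun x => c%:P%:MP *: f x + g x) : precochain M N n) (@chi0 K n N) s =
   c%:P%:MP *: ev f (@chi0 K n N) s + ev g (@chi0 K n N) s by apply: ev_linl.
apply: ev_cochain => [u x y v|s1 s2].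
  by rewrite !E (ev_skew fC c0) (ev_skew gC c0) scalerDr !scalerA mulrC.
have -> : (fun z => ev ((fun x => c%:P%:MP *: f x + g x) :
  precochain M N n) (@chi0 K n N) (s1 ++ z :: s2)) =
  (fun z => c%:P%:MP *: ev f (@chi0 K n N) (s1 ++ z :: s2) +
    ev g (@chi0 K n N) (s1 ++ z :: s2)).
  by apply/funext => z; rewrite E.
by apply: sesquiD; [apply: sesquiZ|]; apply: ev_sesqui.
Qed.

Definition cochains f : Prop := forall n, is_cochain (f n).

Lemma cochain_deg_cochains n f : cochain_deg n f -> cochains f.
Proof.
move=> [f0 fn] k; have [-> //|kn] := eqVneq k n.
have -> : f k = (fun=> 0) by apply/funext => x; apply: f0.
exact: is_cochain0.
Qed.

Lemma cochains0 : cochains 0.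
Proof. by move=> n; apply: is_cochain0. Qed.

Lemma cochains_lin c f g : cochains f -> cochains g -> cochains (c *: f + g).
Proof. by move=> fC gC n; apply: is_cochain_lin. Qed.

Lemma cochains_sum (I : Type) (r : seq I) (P : pred I) (F : I -> cfam M N) :
  (forall i, P i -> cochains (F i)) -> cochains (\sum_(i <- r | P i) F i).
Proof.
move=> FC; elim/big_ind: _ => [|f g fC gC|//]; first exact: cochains0.
by rewrite -[f]scale1r; apply: cochains_lin.
Qed.

Lemma gspan_cochains f : gspan (@cochain_deg _ M N) f -> cochains f.
Proof.
move=> [n [v [vd ->]]]; apply: cochains_sum => i _.
exact: cochain_deg_cochains (vd i).
Qed.

Lemma cochain_graded : graded_space (@cochain_deg _ M N).
Proof.
split=> [n|n c f g [f0 fn] [g0 gn]|n v vd sv0 i].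
- by split=> //; apply: is_cochain0.
- split; last exact: is_cochain_lin.
  by move=> k x kn; rewrite -[LHS]/(_ *: f k x + g k x) f0 // g0 // scaler0 addr0.
apply: cfamP => k x; have [ki|ki] := eqVneq k i; last by have [v0 _] := vd i;
  rewrite v0.
have := congr1 (fun f : cfam M N => f k x) sv0.
rewrite cfam_sumE (bigD1 i) //= big1 ?addr0 // => j ji.
by have [v0 _] := vd j; rewrite v0 // ki eq_sym.
Qed.

End MN.

Section NR.
Variable E : lmodType {poly K}.
Implicit Types (f g h : cfam E E).

Lemma nr_linl c f f' g : cochains f -> cochains f' -> cochains g ->
  nr (c *: f + f') g = c *: nr f g + nr f' g.
Proof.
move=> fC f'C gC; apply: cfamP => p x.
rewrite -[RHS]/(_ *: nr f g p x + nr f' g p x) /nr scaler_sumr -big_split.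
apply: eq_bigr => n _; have pn : p = (p - n + n)%N by rewrite subnK // -ltnS.
have pn' : p = (n + (p - n))%N by rewrite addnC.
rewrite -[(c *: f + f') (p - n)%N]/(fun y => c%:P%:MP *: f (p - n)%N y +
  f' (p - n)%N y).
rewrite star_linl // star_linr // !scalerBr !scalerDr opprD !scalerA mulrC.
by rewrite addrACA.
Qed.

Lemma nr_linr c f f' g : cochains f -> cochains f' -> cochains g ->
  nr g (c *: f + f') = c *: nr g f + nr g f'.
Proof.
move=> fC f'C gC; apply: cfamP => p x.
rewrite -[RHS]/(_ *: nr g f p x + nr g f' p x) /nr scaler_sumr -big_split.
apply: eq_bigr => n _; have pn : p = (p - n + n)%N by rewrite subnK // -ltnS.
have pn' : p = (n + (p - n))%N by rewrite addnC.
rewrite -[(c *: f + f') n]/(fun y => c%:P%:MP *: f n y + f' n y).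
rewrite star_linl // star_linr // !scalerBr !scalerDr opprD !scalerA mulrC.
by rewrite addrACA.
Qed.

Lemma nr_homog m n f g p x : cochain_deg m f -> cochain_deg n g -> p = (m + n)%N ->
  nr f g p x = star (f m) (g n) x - (-1) ^+ (m * n) *: star (g n) (f m) x.
Proof.
move=> fC gC pE; have np : (n < p.+1)%N by lia.
rewrite /nr (bigD1 (Ordinal np)) //= big1 ?addr0.
  by have -> : (p - n)%N = m by rewrite pE addnK.
move=> i ni; have gi : g i = (fun=> 0).
  by apply/funext => y; apply: gC.1; rewrite -val_eqE /= in ni.
have pn : p = (p - i + i)%N by rewrite subnK // -ltnS.
have pn' : p = (i + (p - i))%N by rewrite addnC.
rewrite gi star0l // star0r ?scaler0 ?subr0 //.
exact: cochain_deg_cochains fC _.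
Qed.

Lemma nr_out m n f g p x : cochain_deg m f -> cochain_deg n g -> p != (m + n)%N ->
  nr f g p x = 0.
Proof.
move=> fC gC pE; rewrite /nr big1 // => i _.
have pn : p = (p - i + i)%N by rewrite subnK // -ltnS.
have pn' : p = (i + (p - i))%N by rewrite addnC.
have [i_n|i_n] := eqVneq (i : nat) n; last first.
  have gi : g i = (fun=> 0) by apply/funext => y; apply: gC.1.
  rewrite gi star0l // star0r ?scaler0 ?subr0 //; exact: cochain_deg_cochains fC _.
have fi : f (p - i)%N = (fun=> 0).
  by apply/funext => y; apply: fC.1; apply: contra pE => /eqP <-; rewrite -i_n -pn.
rewrite fi star0l // star0r ?scaler0 ?subr0 //; exact: cochain_deg_cochains gC _.
Qed.

Lemma nr_deg m n f g : cochain_deg m f -> cochain_deg n g -> cochain_deg (m +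
  n) (nr f g).
Proof.
move=> fC gC; split=> [k x kn|]; first exact: nr_out kn.
have -> : nr f g (m + n)%N = (fun x => (- (-1) ^+ (m * n) :
  K)%:P%:MP *: star (g n) (f m) x + star (f m) (g n) x).
  apply/funext => x; rewrite (nr_homog _ fC gC) // addrC.
  by rewrite rmorphN /= rmorphN /= scalar_emb_sign scaleNr.
by apply: is_cochain_lin; apply: star_cochain; rewrite ?(addnC m) //;
  [apply: gC.2|apply: fC.2|apply: fC.2|apply: gC.2].
Qed.

Lemma cfam_signE k f p x : ((-1) ^+ k *: f) p x = (-1) ^+ k *: f p x.
Proof. by rewrite -[LHS]/(_%:P%:MP *: _) scalar_emb_sign. Qed.

Lemma nr_skew m n f g : cochain_deg m f -> cochain_deg n g ->
  nr f g = - (-1) ^+ (m * n) *: nr g f.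
Proof.
move=> fC gC; apply: cfamP => p x; rewrite scaleNr -[RHS]/(-
  ((_ *: nr g f) p x)) cfam_signE.
have [pmn|pmn] := eqVneq p (m + n)%N; last first.
  by rewrite (nr_out _ fC gC) // (nr_out _ gC fC) ?scaler0 ?oppr0 // addnC.
rewrite (nr_homog _ fC gC) // (nr_homog _ gC fC) // 1?addnC // (mulnC n).
by rewrite scalerBr scalerA -expr2 sqrr_sign scale1r opprB.
Qed.

Lemma star_subl m n k (f f' : precochain E E m) (g : precochain E E n) e (x :
  'I_k.+1 -> E) :
  k = (m + n)%N ->
  star (fun y => f y - (-1) ^+ e *: f' y) g x = star f g x - (-1) ^+ e *: star f' g x.
Proof.
move=> kE; have -> : (fun y => f y - (-1) ^+ e *: f' y) = (fun y => (- (-1) ^+ e :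
  K)%:P%:MP *: f' y + f y).
  by apply/funext => y; rewrite rmorphN /= rmorphN /= scalar_emb_sign scaleNr addrC.
by rewrite star_linl // rmorphN /= rmorphN /= scalar_emb_sign scaleNr addrC.
Qed.

Lemma star_subr m n k (f : precochain E E m) (g g' : precochain E E n) e (x :
  'I_k.+1 -> E) :
  k = (m + n)%N -> is_cochain f ->
  star f (fun y => g y - (-1) ^+ e *: g' y) x = star f g x - (-1) ^+ e *: star f g' x.
Proof.
move=> kE fC; have -> : (fun y => g y - (-1) ^+ e *: g' y) = (fun y =>
  (- (-1) ^+ e : K)%:P%:MP *: g' y + g y).
  by apply/funext => y; rewrite rmorphN /= rmorphN /= scalar_emb_sign scaleNr addrC.
by rewrite star_linr // rmorphN /= rmorphN /= scalar_emb_sign scaleNr addrC.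
Qed.

(** Right multiplication by a bracket is the graded commutator of right
    multiplications: the associators agree up to sign by [nested_comm]. *)
Lemma star_nr m n l f g h p x : cochain_deg m f -> cochain_deg n g ->
  cochain_deg l h ->
  p = (m + n + l)%N ->
  star (f m) (nr g h (n + l)%N) x =
  star (star (f m) (g n) : precochain E E (m + n)) (h l) x
  - (-1) ^+ (n * l) *: star (star (f m) (h l) : precochain E E (m +
    l)) (g n) x :> lpoly E p.
Proof.
move=> fC gC hC pE.
have -> : nr g h (n + l)%N = fun y => star (g n) (h l) y - (-1) ^+ (n * l) *: star
  (h l) (g n) y.
  by apply/funext => y; apply: nr_homog.
rewrite star_subr ?addnA //; last exact: fC.2.
have c0 := @chi0_sesqui K p E.
rewrite -!ev_pts (@associator _ _ _ m n l _ (n + l)) //; last exact: fC.2.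
rewrite (@associator _ _ _ m l n _ (n + l)) //;
  [|exact: addnC|by rewrite pE addnAC|exact: fC.2].
rewrite (nested_comm _ _ _ fC.2 c0).
by rewrite scalerDr opprD addrACA subrr addr0.
Qed.

(** Expand the outer brackets and use [star_nr] for the terms where a bracket
    is on the right: all terms become left-normed products, and they cancel in
    pairs. *)
Lemma nr_jacobi m n l f g h : cochain_deg m f -> cochain_deg n g -> cochain_deg l h ->
  nr f (nr g h) = nr (nr f g) h + (-1) ^+ (m * n) *: nr g (nr f h).
Proof.
move=> fC gC hC; apply: cfamP => p x.
rewrite -[RHS]/(nr (nr f g) h p x + (_ *: nr g (nr f h)) p x) cfam_signE.
have gh := nr_deg gC hC; have fg := nr_deg fC gC; have fh := nr_deg fC hC.
have [pE|pE] := eqVneq p (m + n + l)%N; last first.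
  rewrite (nr_out _ fC gh) ?(nr_out _ fg hC) ?(nr_out _ gC fh) ?scaler0 ?addr0 //.
  - by rewrite addnCA addnA.
  - by rewrite addnA.
rewrite (nr_homog _ fC gh); last by rewrite addnA.
rewrite (nr_homog _ fg hC) //.
rewrite (nr_homog _ gC fh); last by rewrite addnCA addnA.
rewrite (star_nr _ fC gC hC) // (star_nr _ gC fC hC); last by rewrite (addnC n).
rewrite (star_nr _ hC fC gC); last by rewrite pE addnC addnA.
have -> : nr g h (n + l)%N = fun y => star (g n) (h l) y - (-1) ^+ (n * l) *: star
  (h l) (g n) y.
  by apply/funext => y; apply: nr_homog.
have -> : nr f g (m + n)%N = fun y => star (f m) (g n) y - (-1) ^+ (m * n) *: star
  (g n) (f m) y.
  by apply/funext => y; apply: nr_homog.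
have -> : nr f h (m + l)%N = fun y => star (f m) (h l) y - (-1) ^+ (m * l) *: star
  (h l) (f m) y.
  by apply/funext => y; apply: nr_homog.
rewrite !star_subl; try by rewrite pE; lia.
(* products in two orders have degrees such as l + n and n + l, which are
   equal but not convertible *)
have cast u v w k k' (r : precochain E E u) (s : precochain E E v) (t :
  precochain E E w) :
    k = k' -> star (star r s : precochain E E k) t x =
    star (star r s : precochain E E k') t x :> lpoly E p by move->.
rewrite (cast _ _ _ _ _ (h l) (g n) (f m) (addnC n l)) (cast _ _ _ _ _ (g n) (f m)
  (h l) (addnC m n))
  (cast _ _ _ _ _ (h l) (f m) (g n) (addnC m l)).
move: (star (star (f m) (g n)) (h l) x) (star (star (f m) (h l)) (g n) x)
  (star (star (g n) (h l)) (f m) x) (star (star (h l) (g n)) (f m) x)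
  (star (star (g n) (f m)) (h l) x) (star (star (h l) (f m)) (g n) x) =>
    x1 x2 x3 x4 x5 x6.
rewrite !mulnDl !mulnDr !exprD (mulnC n m).
set a := (-1) ^+ (m * n); set b := (-1) ^+ (n * l); set c := (-1) ^+ (m * l).
have aa : a * a = 1 by rewrite /a -expr2 sqrr_sign.
rewrite !scalerBr !scalerA !mulrA aa mul1r (mulrAC c b a) (mulrC c a) (mulrC c b).
rewrite !opprB !addrA.
exact: (jacobi_terms x1 (b *: x2) ((a * c) *: x3) ((a * c * b) *: x4) (a *: x5)
  ((b * c) *: x6)).
Qed.

Lemma nr_graded_lie : graded_lie (@cochain_deg K E E) (@nr K E).
Proof.
split.
- exact: cochain_graded.
- by move=> c f g h *; apply: nr_linl; apply: gspan_cochains.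
- by move=> c f g h *; apply: nr_linr; apply: gspan_cochains.
- by move=> m n f g; apply: nr_deg.
- by move=> m n f g; apply: nr_skew.
- by move=> m n l f g h; apply: nr_jacobi.
Qed.

End NR.
End Families.

(** * Higher derived brackets *)

Lemma oppr_sign (R : pzRingType) (T : lmodType R) m (x : T) :
  - ((-1) ^+ m *: x) = (-1) ^+ m.+1 *: x.
Proof. by rewrite exprS mulN1r scaleNr. Qed.

Section AllSplittings.
Variables (X : Type) (par : X -> nat) (R : pzRingType) (T : lmodType R).
Implicit Types (F G : seq X -> seq X -> T) (s u v : seq X).

Definition splitsum_all F s : T := \sum_(i < (size s).+1) splitsum par i F s.

(** No piece is larger than the tail, so the sizes that only the longer list
    allows contribute nothing. *)
Lemma splitsum_all_cons F x s : splitsum_all F (x :: s) =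
  splitsum_all (fun u v => F (x :: u) v) s +
  splitsum_all (fun u v => (-1) ^+ (par x * tpar par u) *: F u (x :: v)) s.
Proof.
rewrite /splitsum_all /= big_split [X in X + _ = _]big_ord_recl /= add0r;
  congr (_ + _).
by rewrite big_ord_recr /= [X in _ + X]splitsum_small ?addr0.
Qed.

Lemma eq_splitsum_all F G s : (forall u v, splits_of s u v -> F u v = G u v) ->
  splitsum_all F s = splitsum_all G s.
Proof. by move=> FG; apply: eq_bigr => i _; apply: eq_splitsum => u v _;
  apply: FG. Qed.

Lemma splitsum_allD F G s : splitsum_all (fun u v => F u v + G u v) s =
  splitsum_all F s + splitsum_all G s.
Proof. by rewrite /splitsum_all -big_split; apply: eq_bigr => i _;
  rewrite splitsumD. Qed.

Lemma splitsum_all_scale c F s : splitsum_all (fun u v => c *: F u v) s =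
  c *: splitsum_all F s.
Proof. by rewrite /splitsum_all scaler_sumr; apply: eq_bigr => i _;
  rewrite splitsum_scale. Qed.

Lemma splitsum_all_swap F s :
  splitsum_all F s = splitsum_all (fun v u =>
    (-1) ^+ (tpar par u * tpar par v) *: F u v) s.
Proof.
rewrite /splitsum_all [RHS](reindex_inj rev_ord_inj); apply: eq_bigr => i _.
by apply: splitsum_swap => /=; rewrite subSS subnKC // -ltnS.
Qed.

End AllSplittings.

Section GradedSpan.
Variables (K : fieldType) (V : lmodType K).
Implicit Types (gr : nat -> V -> Prop).

Lemma gspan_gr gr n x : graded_space gr -> gr n x -> gspan gr x.
Proof.
move=> gs gx; exists n.+1, (fun i => if i == n :> nat then x else 0); split.
  by move=> i; case: eqP => [->//|_]; apply: gr_zero.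
rewrite big_ord_recr /= eqxx big1 ?add0r // => i _.
by rewrite /= ltn_eqF.
Qed.

Lemma gspan_lin gr c x y : graded_space gr -> gspan gr x -> gspan gr y ->
  gspan gr (c *: x + y).
Proof.
move=> gs [n [v [vg ->]]] [m [w [wg ->]]].
pose ext k (z : 'I_k -> V) (i : nat) := if insub i is Some j then z j else 0.
have extE k (z : 'I_k -> V) N : (k <= N)%N -> \sum_(i < N) ext k z i = \sum_i z i.
  move=> kN; rewrite -(subnKC kN) big_split_ord /= [X in _ + X]big1 ?addr0.
    by apply: eq_bigr => i _; rewrite /ext /= valK.
  by move=> i _; rewrite /ext insubF //= ltnNge leq_addr.
have extg k (z : 'I_k -> V) i : (forall j : 'I_k, gr j (z j)) -> gr i (ext k z i).
  move=> zg; rewrite /ext; case: insubP => [j _ <-|_]; first exact: zg.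
  exact: gr_zero.
exists (n + m)%N, (fun i => c *: ext n v i + ext m w i); split.
  by move=> i; apply: gr_lin => //; apply: extg.
by rewrite big_split -scaler_sumr !extE ?leq_addr ?leq_addl.
Qed.

Lemma gspan0 gr : gspan gr 0.
Proof. by exists 0%N, (fun=> 0); split; [case|rewrite big_ord0]. Qed.

Lemma gspan_mono gr gr' x : (forall n y, gr n y -> gr' n y) -> gspan gr x ->
  gspan gr' x.
Proof. by move=> h [n [v [vg ->]]]; exists n, v; split=> // i; apply: h. Qed.

Lemma gspan_ind gr (Q : V -> Prop) : Q 0 -> (forall x y, Q x -> Q y -> Q (x + y)) ->
  (forall n x, gr n x -> Q x) -> forall x, gspan gr x -> Q x.
Proof.
move=> Q0 QD Qg x [n [v [vg ->]]]; elim/big_ind: _ => // i _; exact: Qg (vg i).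
Qed.

(** Bilinearity is only known on the span, so the induction carries membership
    along. *)
Lemma gspan_br gr (br : V -> V -> V) x y : graded_lie gr br ->
  gspan gr x -> gspan gr y -> gspan gr (br x y).
Proof.
move=> lie; have gs := gl_space lie; have g0 := gspan0 gr.
have gD z w : gspan gr z -> gspan gr w -> gspan gr (z + w).
  by move=> gz gw; rewrite -[z]scale1r; apply: gspan_lin.
have Dl z w t : gspan gr z -> gspan gr w -> gspan gr t -> br (z + w) t = br z t +
  br w t.
  by move=> *; rewrite -[z]scale1r (gl_linl lie) // !scale1r.
have Dr z w t : gspan gr z -> gspan gr w -> gspan gr t -> br t (z + w) = br t z +
  br t w.
  by move=> *; rewrite -[z]scale1r (gl_linr lie) // !scale1r.
move=> gx gy; suff [] : gspan gr x /\ gspan gr (br x y) by [].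
elim/gspan_ind: x / gx => [|z w [gz gzy] [gw gwy]|n x gx].
- by split=> //; rewrite -[br 0 y](addrK (br 0 y)) -Dl // addr0 subrr.
- by rewrite Dl //; split; apply: gD.
have Gx := gspan_gr gs gx; split=> //.
suff [] : gspan gr y /\ gspan gr (br x y) by [].
elim/gspan_ind: y / gy => [|z w [gz gzy] [gw gwy]|m y gy].
- by split=> //; rewrite -[br x 0](addrK (br x 0)) -Dr // addr0 subrr.
- by rewrite Dr //; split; apply: gD.
by split; [exact: gspan_gr gy|exact: (gspan_gr gs (gl_deg lie gx gy))].
Qed.

End GradedSpan.

Section Voronov.
Variables (K : fieldType) (V : lmodType K).
Variables (gr grF : nat -> V -> Prop) (br : V -> V -> V) (P : V -> V) (Delta : V).
Hypothesis vd : vdata gr br (gspan grF) P Delta.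
Hypothesis grF_space : graded_space grF.
Hypothesis grFW : forall n x, grF n x -> gr n x.
Hypothesis Pgr : forall n x, gr n x -> grF n (P x).
Hypothesis two : 2%:R != 0 :> K.

Let lie := vd_lie vd.
Let sp := gl_space lie.
Local Notation L := (gspan gr).
Local Notation F := (gspan grF).

Let gL n x : gr n x -> L x. Proof. exact: gspan_gr. Qed.
Let FL x : F x -> L x. Proof. exact: gspan_mono. Qed.
Let L0 : L 0. Proof. exact: gspan0. Qed.
Let LD x y : L x -> L y -> L (x + y).
Proof. by move=> Lx Ly; rewrite -[x]scale1r; apply: gspan_lin. Qed.
Let LZ c x : L x -> L (c *: x).
Proof. by move=> Lx; rewrite -[_ *: _]addr0; apply: gspan_lin. Qed.
Let LN x : L x -> L (- x).
Proof. by move=> Lx; rewrite -scaleN1r; apply: LZ. Qed.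

Let brDl x y z : L x -> L y -> L z -> br (x + y) z = br x z + br y z.
Proof. by move=> *; rewrite -[x]scale1r (gl_linl lie) // !scale1r. Qed.
Let brDr x y z : L x -> L y -> L z -> br z (x + y) = br z x + br z y.
Proof. by move=> *; rewrite -[x]scale1r (gl_linr lie) // !scale1r. Qed.
Let br0l z : L z -> br 0 z = 0.
Proof. by move=> Lz; apply: (@addrI _ (br 0 z)); rewrite -brDl // !addr0. Qed.
Let br0r z : L z -> br z 0 = 0.
Proof. by move=> Lz; apply: (@addrI _ (br z 0)); rewrite -brDr // !addr0. Qed.
Let brZl c x z : L x -> L z -> br (c *: x) z = c *: br x z.
Proof. by move=> *; rewrite -[c *: x]addr0 (gl_linl lie) // br0l // addr0. Qed.
Let brZr c x z : L x -> L z -> br z (c *: x) = c *: br z x.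
Proof. by move=> *; rewrite -[c *: x]addr0 (gl_linr lie) // br0r // addr0. Qed.
Let brNl x z : L x -> L z -> br (- x) z = - br x z.
Proof. by move=> *; rewrite -scaleN1r brZl // scaleN1r. Qed.
Let brNr x z : L x -> L z -> br z (- x) = - br z x.
Proof. by move=> *; rewrite -scaleN1r brZr // scaleN1r. Qed.

Let Lbr x y : L x -> L y -> L (br x y). Proof. exact: gspan_br. Qed.

(* right bracketing is a graded derivation *)
Let br_deriv m n k x y a : gr m x -> gr n y -> gr k a ->
  br (br x y) a = (-1) ^+ (n * k) *: br (br x a) y + br x (br y a).
Proof.
move=> gx gy ga; rewrite (gl_jacobi lie gx gy ga).
rewrite (gl_skew lie (gl_deg lie gx ga) gy) scaleNr scalerN scalerA -exprD addrCA.
rewrite -[LHS]addr0; congr (_ + _); rewrite addrC; apply/esym/eqP.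
by rewrite subr_eq0; apply/eqP; signs.
Qed.

(* right bracketings with elements of the abelian subalgebra commute up to
   sign *)
Let br_comm n k k' x a b : gr n x -> grF k a -> grF k' b ->
  br (br x a) b = (-1) ^+ (k * k') *: br (br x b) a.
Proof.
move=> gx ga gb; rewrite (br_deriv gx (grFW ga) (grFW gb)) [X in _ +
  br x X](vd_abelian vd) //.
- by rewrite br0r ?addr0 //; exact: gL gx.
- exact: gspan_gr ga.
- exact: gspan_gr gb.
Qed.

Let FP x : L x -> F (P x).
Proof. by move=> Lx; apply/(vd_image vd); exists x. Qed.
Let LP x : L x -> L (P x). Proof. by move=> /FP /FL. Qed.
Let PD x y : L x -> L y -> P (x + y) = P x + P y.
Proof. by move=> *; rewrite -[x]scale1r (vd_lin vd) // !scale1r. Qed.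
Let P0 : P 0 = 0.
Proof. by apply: (@addrI _ (P 0)); rewrite -PD // !addr0. Qed.
Let PZ c x : L x -> P (c *: x) = c *: P x.
Proof. by move=> Lx; rewrite -[c *: x]addr0 (vd_lin vd) // P0 addr0. Qed.
Let PN x : L x -> P (- x) = - P x.
Proof. by move=> Lx; rewrite -scaleN1r PZ // scaleN1r. Qed.

(* x - P x and y - P y lie in the kernel of P, hence so does their bracket,
   and the bracket of P x with P y vanishes *)
Let P_br x y : L x -> L y -> P (br x y) = P (br (P x) y) + P (br x (P y)).
Proof.
move=> Lx Ly; have kerP z : L z -> L (z - P z) /\ P (z - P z) = 0.
  move=> Lz; have LNPz := LN (LP Lz); split; first exact: LD.
  by rewrite PD // PN ?(vd_idem vd) ?subrr //; apply: LP.
have [_] := gs_br (vd_ker vd) (kerP x Lx) (kerP y Ly).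
have [LPx LPy] := (LP Lx, LP Ly); have [LNx LNy] := (LN LPx, LN LPy).
rewrite brDl ?brDr ?brNl ?brNr //; try (by apply: LD); try by apply: LN.
rewrite [X in - - X](vd_abelian vd); [|exact: FP|exact: FP].
rewrite oppr0 oppr0 addr0 !PD ?PN; try (by do ?[exact: Lbr | apply: LN | apply: LD]).
by rewrite -addrA -opprD => /eqP; rewrite subr_eq0 addrC => /eqP ->; rewrite addrC.
Qed.

Section Arguments.
Variables (n : nat) (d : 'I_n -> nat) (v : 'I_n -> V).
Hypothesis gv : forall i, grF (d i) (v i).
Local Notation I := (seq 'I_n).
Local Notation W x s := (foldl br x (map v (s : I))).
Implicit Types (s t u w : I).

Let gv' i : gr (d i) (v i). Proof. exact: grFW. Qed.
Let Lv i : L (v i). Proof. exact: gL (gv' i). Qed.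

Lemma W_deg k x s : gr k x -> gr (k + tpar d s) (W x s).
Proof.
elim: s k x => [|a s IH] k x gx /=; first by rewrite addn0.
by rewrite /tpar /= addnA; apply: IH; apply: (gl_deg lie gx).
Qed.

Lemma L_W x s : L x -> L (W x s).
Proof. by elim: s x => [|a s IH] x Lx //=; apply/IH/Lbr. Qed.

Lemma WD x y s : L x -> L y -> W (x + y) s = W x s + W y s.
Proof. by elim: s x y => [|a s IH] x y Lx Ly //=; rewrite brDl // IH //;
  apply: Lbr. Qed.

Lemma WZ c x s : L x -> W (c *: x) s = c *: W x s.
Proof. by elim: s x => [|a s IH] x Lx //=; rewrite brZl // IH //; apply: Lbr. Qed.

Lemma W0 s : W 0 s = 0.
Proof. by elim: s => [|a s IH] //=; rewrite br0l. Qed.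

(** Iterate the derivation rule: each argument goes to x or to y, passing y
    and the arguments that y has received when it goes to x. *)
Lemma W_br p q x y s : gr p x -> gr q y ->
  W (br x y) s = splitsum_all d (fun u w => (-1) ^+ (q * tpar d u) *: br (W x u)
    (W y w)) s.
Proof.
elim: s p q x y => [|a s IH] p q x y gx gy.
  by rewrite /splitsum_all big_ord1 /= muln0 scale1r.
rewrite splitsum_all_cons /= (br_deriv gx gy (gv' a)) WD ?WZ;
  try (by do ?[apply: LZ|apply: Lbr|apply: gL; eassumption]).
rewrite (IH _ _ _ _ (gl_deg lie gx (gv' a)) gy) (IH _ _ _ _ gx (gl_deg lie gy
  (gv' a))).
rewrite -splitsum_all_scale; congr (_ + _); apply: eq_splitsum_all => u w _;
  rewrite /tpar; signs.
Qed.

Lemma W_move p k x b s : gr p x -> grF k b ->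
  W (br x b) s = (-1) ^+ (k * tpar d s) *: br (W x s) b.
Proof.
elim: s p x => [|a s IH] p x gx gb /=; first by rewrite muln0 scale1r.
have Lb : L b := gL (grFW gb).
rewrite (br_comm gx gb (gv a)) WZ; last by do ?[apply: Lbr|apply: gL; eassumption].
by rewrite (IH _ _ (gl_deg lie gx (gv' a)) gb) /tpar; signs.
Qed.

Lemma W_graded_sym : graded_sym d (fun s => W Delta s).
Proof.
move=> u x y w; rewrite !map_cat !foldl_cat /=.
rewrite (br_comm (W_deg u (vd_deg vd)) (gv x) (gv y)) WZ //.
by do ?[apply: Lbr|apply: L_W|apply: gL (vd_deg vd)].
Qed.

Lemma L_splitsum_all (G : I -> I -> V) s : (forall u w, L (G u w)) ->
  L (splitsum_all d G s).
Proof.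
elim: s G => [|a s IH] G LG; first by rewrite /splitsum_all big_ord1 /=.
by rewrite splitsum_all_cons; apply: LD; apply: IH => u w //; apply: LZ.
Qed.

Lemma P_splitsum_all (G : I -> I -> V) s : (forall u w, L (G u w)) ->
  P (splitsum_all d G s) = splitsum_all d (fun u w => P (G u w)) s.
Proof.
elim: s G => [|a s IH] G LG; first by rewrite /splitsum_all !big_ord1 /=.
rewrite !splitsum_all_cons PD ?IH //; try (by apply: L_splitsum_all => u w //;
  apply: LZ).
  by congr (_ + _); apply: eq_splitsum_all => u w _; rewrite PZ.
by move=> u w; apply: LZ.
Qed.

(** The n-th relation. The sum is half of P applied to the iterated brackets
    of [Delta, Delta] with the arguments. *)
Lemma voronov_rel s : splitsum_all d (fun u w =>
  P (W (br Delta (P (W Delta u))) w)) s = 0.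
Proof.
have LD' : L Delta := gL (vd_deg vd).
have LWD u : L (W Delta u) by apply: L_W.
have LPW u : L (P (W Delta u)) by apply: LP.
have gPW u : grF (1 + tpar d u) (P (W Delta u)) by apply/Pgr/W_deg/(vd_deg vd).
have H : P (W (br Delta Delta) s) = 0 by rewrite (vd_square vd) W0 P0.
rewrite (W_br s (vd_deg vd) (vd_deg vd)) P_splitsum_all in H; last by move=> u w;
  apply/LZ/Lbr.
(* the summand of the relation as the half of P[x, y] with P on the first
   factor; the signs of antisymmetry and of moving P (W Delta u) to the front
   cancel that of W_br *)
have E u w : (-1) ^+ (1 * tpar d u) *: P (br (P (W Delta u)) (W Delta w)) =
   P (W (br Delta (P (W Delta u))) w).
  rewrite (W_move w (vd_deg vd) (gPW u)).
  rewrite (gl_skew lie (grFW (gPW u)) (W_deg w (vd_deg vd))) scaleNr PN;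
    last by apply/LZ/Lbr.
  rewrite !PZ; try by apply: Lbr.
  by rewrite ?scalerN !scalerA -!exprD oppr_sign; signs.
(* the other half gives the same sum after exchanging the two pieces *)
have E2 : splitsum_all d (fun u w => (-1) ^+ (1 * tpar d u) *: P (br (W Delta u)
  (P (W Delta w)))) s =
   splitsum_all d (fun u w => P (W (br Delta (P (W Delta u))) w)) s.
  rewrite splitsum_all_swap; apply: eq_splitsum_all => w u _; rewrite -E.
  rewrite (gl_skew lie (W_deg u (vd_deg vd)) (grFW (gPW w))) scaleNr PN;
    last by apply/LZ/Lbr.
  rewrite !PZ; try by apply: Lbr.
  by rewrite ?scalerN !scalerA -!exprD oppr_sign; signs.
have {}H : 2%:R *: splitsum_all d (fun u w =>
  P (W (br Delta (P (W Delta u))) w)) s = 0.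
  rewrite -[RHS]H scaler_nat mulr2n -{2}E2 -splitsum_allD;
    apply: eq_splitsum_all => u w _.
  have PE : P (br (W Delta u) (W Delta w)) =
    P (br (P (W Delta u)) (W Delta w)) + P (br (W Delta u) (P (W Delta w))).
    exact: (P_br (LWD u) (LWD w)).
  have Lb : L (br (W Delta u) (W Delta w)) := Lbr (LWD u) (LWD w).
  by rewrite (PZ _ Lb) PE scalerDr E.
by move/eqP: H; rewrite scaler_eq0 (negPf two) => /eqP.
Qed.

End Arguments.

(** Symmetry holds because the arguments commute up to sign under right
    bracketing; the relations are [voronov_rel], whose sum over all splittings
    includes the empty first piece, which contributes nothing as P Delta = 0. *)
Lemma voronov_linfty : linfty grF (voronov br P Delta).
Proof.
have LDel : L Delta := gL (vd_deg vd).
have Lfold x s : L x -> {in s, forall y, L y} -> L (foldl br x s).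
  elim: s x => [|a s IH] x Lx Ls //=; apply: IH => [|y ys].
    by apply: Lbr => //; apply: Ls; rewrite mem_head.
  by apply: Ls; rewrite inE ys orbT.
split.
- exact: grF_space.
- move=> s t c x y Fs Ft Fx Fy; rewrite /voronov !foldl_cat /=.
  have Lz : L (foldl br Delta s) by apply: Lfold => // w ws; apply/FL/Fs.
  have Lt : {in t, forall w, L w} by move=> w wt; apply/FL/Ft.
  have [Lx Ly] := (FL Fx, FL Fy).
  have Hf x' y' : L x' -> L y' -> foldl br (c *: x' + y') t = c *: foldl br x' t +
    foldl br y' t.
    elim: t Lt {Ft} x' y' => [|a t IH] Lt x' y' Lx' Ly' //=.
    have La : L a by apply: Lt; rewrite mem_head.
    rewrite (gl_linl lie) // IH //; try by apply: Lbr.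
    by move=> w wt; apply: Lt; rewrite inE wt orbT.
  rewrite (gl_linr lie) // Hf; try by apply: Lbr.
  by rewrite (vd_lin vd) //; apply: Lfold => //; apply: Lbr.
- move=> n d v _ gv; rewrite /voronov /image_mem.
  have -> : [seq v i | i <- enum 'I_n] = map v (enum 'I_n) by [].
  have -> : (\sum_i d i).+1 = (1 + tpar d (enum 'I_n))%N.
    by rewrite add1n /tpar sumnE big_map big_enum.
  by apply: Pgr; apply: W_deg => //; exact: vd_deg vd.
- move=> n d v s _ gv; rewrite /voronov.
  have -> : [seq v (s i) | i : 'I_n] = map v [seq s i | i :
    'I_n] by rewrite -map_comp.
  rewrite (graded_sym_perm id s (W_graded_sym gv)).
  rewrite PZ; last first.
    by apply: Lfold => // w /mapP [i _ ->]; apply: gL (grFW (gv i)).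
  by rewrite /image_mem map_id.
move=> n d v n0 gv.
have J := voronov_rel gv (enum 'I_n).
rewrite /splitsum_all size_enum_ord big_ord_recl in J.
have z0 : splitsum d 0 (fun u w => P (foldl br (br Delta (P (foldl br Delta
  (map v u)))) (map v w))) (enum 'I_n) = 0.
  rewrite (@eq_splitsum _ d _ _ _ _ (fun _ _ => 0)) ?splitsum0 // =>
    u w /size0nil -> _ /=.
  by rewrite (vd_Delta vd) br0r // (W0 gv) P0.
rewrite z0 add0r in J; rewrite -[RHS]J big_add1 big_mkord.
apply: eq_bigr => i _; rewrite -[enum 'I_n]map_id -[map id _]/[seq id j | j : 'I_n].
rewrite -sum_unshuffle; last exact: ltn_ord.
apply: eq_bigr => s _; congr (_ *: _).
have -> : [seq v (s j) | j : 'I_n] = map v [seq id (s j) | j :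
  'I_n] by rewrite -map_comp.
by rewrite /voronov /= map_take map_drop /bump /=.
Qed.
End Voronov.

(** * Composition of cochains with module maps *)

Section Lmap.
Variables (K : fieldType).

Section One.
Variables (M N : lmodType {poly K}) (n : nat) (h : {linear M -> N}).

Lemma lmap_unlock (P : lpoly M n) :
  lmap h P = \sum_(m <- lsupp P) lmono m (h (lcoef m P)).
Proof. by rewrite unlock. Qed.

Lemma lmapE (P : lpoly M n) :
  lmap h P = lbind (fun i => 'X_i) (fun y => lconst n (h y)) P.
Proof.
rewrite lbindE unlock; apply: eq_bigr => m _.
rewrite mmap1_id -[_ *: _]/(lscale _ _) lscale_mono.
by rewrite -[(0 : 'X_{1..n})%MM]/0%MM mpolyX0 mulr1 ltensor_mono.
Qed.

Lemma lconst_linD : {morph (fun y => lconst n (h y)) : y z / y + z}.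
Proof. by move=> y z /=; rewrite linearD lconstD. Qed.

Lemma lconst_linZ r (y : M) : lconst n (h (r *: y)) = r%:MP *: lconst n (h y).
Proof. by rewrite linearZ /= lconstZ. Qed.

Lemma mmap_id (c : {mpoly {poly K}[n]}) : mmap (@mpolyC n {poly K}) (fun i =>
  'X_i) c = c.
Proof.
rewrite /mmap [RHS]mpolyE; apply: eq_bigr => m _.
by rewrite mul_mpolyC mmap1_id.
Qed.

Lemma lmapD (P Q : lpoly M n) : lmap h (P + Q) = lmap h P + lmap h Q.
Proof. by rewrite !lmapE lbindD //; apply: lconst_linD. Qed.

Lemma lmapZ c (P : lpoly M n) : lmap h (c *: P) = c *: lmap h P.
Proof.
by rewrite !lmapE (lbind_scale _ lconst_linD lconst_linZ) mmap_id.
Qed.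

Lemma lmap0 : lmap h (0 : lpoly M n) = 0.
Proof. by rewrite -[0]addr0 -(scale0r 0) lmapD lmapZ scale0r addr0. Qed.

Lemma lmapN (P : lpoly M n) : lmap h (- P) = - lmap h P.
Proof. by rewrite -scaleN1r lmapZ scaleN1r. Qed.

Lemma lcoef_lmap m (P : lpoly M n) : lcoef m (lmap h P) = h (lcoef m P).
Proof.
rewrite [P in RHS]lmonoE lmap_unlock !lcoef_sum linear_sum; apply: eq_bigr => k _.
by rewrite !lcoef_mono; case: (k == m); rewrite ?mulr1n ?mulr0n ?linear0.
Qed.

Lemma lmap_const y : lmap h (lconst n y) = lconst n (h y).
Proof. by rewrite lmapE lbind_const //; apply: lconst_linD. Qed.

Lemma lbind_lmap (N' : lmodType {poly K}) k (q : 'I_n -> {mpoly {poly K}[k]})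
   (g : N -> lpoly N' k) (P : lpoly M n) : {morph g : x y / x + y} ->
  lbind q g (lmap h P) = lbind q (fun y => g (h y)) P.
Proof.
move=> gD; rewrite lmap_unlock lbind_sum // lbindE; apply: eq_bigr => m _.
by rewrite lbind_mono.
Qed.

End One.

Lemma lmap_lsubst (M N : lmodType {poly K}) n (h : {linear M -> N}) k
   (r : 'I_k -> {mpoly {poly K}[n]}) (P : lpoly M k) :
  lmap h (lsubst r P) = lsubst r (lmap h P).
Proof.
rewrite lmapE /lsubst (lbind_comp _ _ _ _ (lconst_linD _ h) (lconst_linZ _ h)).
rewrite lbind_lmap; last exact: lconstD.
apply: eq_lbind => [i|y]; first by rewrite mmap_id.
by rewrite lbind_const //; apply: lconst_linD.
Qed.

Lemma lmap_comp (M N N' : lmodType {poly K}) n (g : {linear N -> N'}) (h :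
  {linear M -> N})
  (P : lpoly M n) : lmap g (lmap h P) = lmap (g \o h) P.
Proof. by apply: lpolyP => m; rewrite !lcoef_lmap. Qed.

Lemma lmap_id (M : lmodType {poly K}) n (P : lpoly M n) : lmap idfun P = P.
Proof. by apply: lpolyP => m; rewrite lcoef_lmap. Qed.

(** The lifts, the projection, and the components of the lambda-bracket all
    arise in this way from given cochains. *)
Lemma cochain_comp (M M' N N' : lmodType {poly K}) n (al : {linear M -> M'}) (be :
  {linear N -> N'})
  (f : precochain M' N n) : is_cochain f ->
  is_cochain ((fun x => lmap be (f (fun i => al (x i)))) : precochain M N' n).
Proof.
move=> fC; have updc (x : 'I_n.+1 -> M) i y : (fun j => al (upd x i y j)) =
  upd (fun j => al (x j)) i (al y).
  by apply/funext => j; rewrite !updE; case: eqP.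
split=> [x i c y z|x i|x s].
- by rewrite !updc linearP coch_lin // lmapD lmapZ.
- by rewrite !updc linearZ coch_sesq // lmapZ.
- by rewrite (coch_skew fC _ s) lmapZ lmap_lsubst.
Qed.

Lemma ev_lmap (M N N' : lmodType {poly K}) n (h : {linear N -> N'}) (f :
  precochain M N n) x :
  lmap h (f x) = ev f (fun z => @chi0 K n N' (z.1, h z.2)) (pts x).
Proof.
rewrite evE /= sum_lvar lmapE; apply: eq_lbind => [i|y]; first by rewrite lvar_lift.
by rewrite /chi0 eqxx.
Qed.

Lemma chi0_lin_sesqui (N N' : lmodType {poly K}) n (h : {linear N -> N'}) :
  sesqui (fun z : point n N => @chi0 K n N' (z.1, h z.2)).
Proof.
move=> q; have [hD hZ] := @chi0_sesqui K n N' q.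
by split=> [y z|r y] /=; rewrite ?linearD ?linearZ ?hD ?hZ.
Qed.

End Lmap.

(** * Support of a cochain with respect to the decomposition *)

Arguments hat {K a b} f n x : rename.
Arguments projF {K a b} h n x : rename.

Section Dsum.
Variables (K : fieldType) (a b : lmodType {poly K}).
Local Notation E := (dsum a b).
Local Notation ina := (@ina K a b).
Local Notation inb := (@inb K a b).
Local Notation pra := (@pra K a b).
Local Notation prb := (@prb K a b).

Lemma pra_linear : linear pra. Proof. by []. Qed.
Lemma prb_linear : linear prb. Proof. by []. Qed.
Lemma ina_linear : linear ina.
Proof. by move=> r x y; congr (_, _); rewrite /= scaler0 addr0. Qed.
Lemma inb_linear : linear inb.
Proof. by move=> r x y; congr (_, _); rewrite /= scaler0 addr0. Qed.

HB.instance Definition _ := GRing.isLinear.Build {poly K} E a *:%R pra pra_linear.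
HB.instance Definition _ := GRing.isLinear.Build {poly K} E b *:%R prb prb_linear.
HB.instance Definition _ := GRing.isLinear.Build {poly K} a E *:%R ina ina_linear.
HB.instance Definition _ := GRing.isLinear.Build {poly K} b E *:%R inb inb_linear.

Lemma dsumE (x : E) : x = ina (pra x) + inb (prb x).
Proof. by case: x => x y; congr (_, _); rewrite /= ?addr0 ?add0r. Qed.

Lemma lmap_dsum n (P : lpoly E n) : P = lmap ina (lmap pra P) + lmap inb (lmap prb P).
Proof. by apply: lpolyP => m; rewrite lcoefD !lcoef_lmap -dsumE. Qed.

Lemma lmap_praK n (P : lpoly a n) : lmap pra (lmap ina P) = P.
Proof. by apply: lpolyP => m; rewrite !lcoef_lmap. Qed.
Lemma lmap_prbK n (P : lpoly b n) : lmap prb (lmap inb P) = P.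
Proof. by apply: lpolyP => m; rewrite !lcoef_lmap. Qed.
Lemma lmap_prb_ina n (P : lpoly a n) : lmap prb (lmap ina P) = 0.
Proof. by apply: lpolyP => m; rewrite !lcoef_lmap lcoef0. Qed.
Lemma lmap_pra_inb n (P : lpoly b n) : lmap pra (lmap inb P) = 0.
Proof. by apply: lpolyP => m; rewrite !lcoef_lmap lcoef0. Qed.

(** The zero vector is pure of both kinds, so the kind is a parameter rather
    than a function of e. *)
Definition pure (c : bool) (e : E) : bool := if c then prb e == 0 else pra e == 0.

Lemma pure_a e : pure true e -> e = ina (pra e).
Proof. by move=> /eqP e0; rewrite [LHS]dsumE e0 linear0 addr0. Qed.
Lemma pure_b e : pure false e -> e = inb (prb e).
Proof. by move=> /eqP e0; rewrite [LHS]dsumE e0 linear0 add0r. Qed.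

(** For A = {k} this says that h has weight k in the grading by outputs in a
    against inputs in a, shifted so that it starts at 0; other sets A express
    bounds on the weight. *)
Definition supported (A : nat -> Prop) n (h : precochain E E n) : Prop :=
  forall x (c : 'I_n.+1 -> bool), (forall i, pure (c i) (x i)) ->
  (~ A (\sum_i c i)%N -> lmap pra (h x) = 0) /\
  (~ A (\sum_i c i).+1 -> lmap prb (h x) = 0).

Section Typed.
Variables (p : nat).
Local Notation X := (point p E).
Local Notation Y := (bool * X)%type.
Implicit Types s u v : seq Y.

(** Points are paired with their kinds: the kinds follow them through
    splittings, where [splits_of] keeps count of those in a and of the impure
    ones. *)
Definition cnt s : nat := sumn [seq nat_of_bool z.1 | z <- s].
Definition impure s : nat := sumn [seq nat_of_bool (~~ pure z.1 z.2.2) | z <- s].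

(** Passage from lists of typed points to the families of arguments in
    [supported]. *)
Lemma typed_coord n s : size s = n.+1 -> impure s = 0%N ->
  exists x c, [/\ forall i : 'I_n.+1, pure (c i) (x i), (\sum_i c i)%N = cnt s &
     (fun i : 'I_n.+1 => (nth (0, 0) (map snd s) i).2) = x].
Proof.
move=> ss s0; pose z0 : Y := (false, (0, 0)).
exists (fun i => (nth z0 s i).2.2), (fun i => (nth z0 s i).1); split=> [i||].
- have lt_i : (i < size s)%N by rewrite ss.
  move: s0 lt_i; rewrite /impure; elim: (s) (i : nat) => //= z t IH [|j] /=.
    by case: (pure _ _).
  by move/eqP; rewrite addn_eq0 => /andP [_ /eqP /IH h]; apply: h.
- rewrite /cnt sumnE big_map (big_nth z0) ss big_mkord //.
- by apply/funext => i; rewrite (nth_map z0) ?ss.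
Qed.

Lemma cnt_cat u v : cnt (u ++ v) = (cnt u + cnt v)%N.
Proof. by rewrite /cnt map_cat sumn_cat. Qed.
Lemma impure_cat u v : impure (u ++ v) = (impure u + impure v)%N.
Proof. by rewrite /impure map_cat sumn_cat. Qed.

Section Supp.
Variables (A : nat -> Prop) (n : nat) (h : precochain E E n) (N : lmodType {poly K}).
Hypothesis hA : supported A h.

Lemma supported_ev_a (chi : point p a -> lpoly N p) s :
  (forall q, {morph (fun y => chi (q, y)) : y z / y + z}) ->
  impure s = 0%N -> ~ A (cnt s) ->
  ev h (fun z => chi (z.1, pra z.2)) (map snd s) = 0.
Proof.
move=> cD s0 As; have [ss|ss] := eqVneq (size (map snd s)) n.+1;
  last by rewrite ev_size.
rewrite /ev ss eqxx; set mu := \sum_(z <- _) _; set x0 := fun i : 'I_n.+1 => _.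
transitivity (lbind (fun i : 'I_n => (nth (0, 0) (map snd s) i).1) (fun y =>
  chi (mu, y)) (lmap pra (h x0))).
  by rewrite lbind_lmap.
rewrite /x0 {x0}.
rewrite size_map in ss; have [x [c [xc cs ->]]] := typed_coord ss s0.
by have [h0 _] := hA xc; rewrite h0 ?lbind0 ?cs.
Qed.

Lemma supported_ev_b (chi : point p b -> lpoly N p) s :
  (forall q, {morph (fun y => chi (q, y)) : y z / y + z}) ->
  impure s = 0%N -> ~ A (cnt s).+1 ->
  ev h (fun z => chi (z.1, prb z.2)) (map snd s) = 0.
Proof.
move=> cD s0 As; have [ss|ss] := eqVneq (size (map snd s)) n.+1;
  last by rewrite ev_size.
rewrite /ev ss eqxx; set mu := \sum_(z <- _) _; set x0 := fun i : 'I_n.+1 => _.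
transitivity (lbind (fun i : 'I_n => (nth (0, 0) (map snd s) i).1) (fun y =>
  chi (mu, y)) (lmap prb (h x0))).
  by rewrite lbind_lmap.
rewrite /x0 {x0}.
rewrite size_map in ss; have [x [c [xc cs ->]]] := typed_coord ss s0.
by have [_ h0] := hA xc; rewrite h0 ?lbind0 ?cs.
Qed.

End Supp.

Lemma splitsum_map (X1 X2 : Type) (f : X1 -> X2) par (R : pzRingType) (T :
  lmodType R) n
    (F : seq X2 -> seq X2 -> T) (s : seq X1) :
  splitsum par n F (map f s) = splitsum (par \o f) n (fun w t =>
    F (map f w) (map f t)) s.
Proof.
elim: s n F => [|x s IH] [|n] F //=; rewrite !IH.
- congr (_ + _); apply: eq_splitsum => u v _ _.
  by rewrite /tpar -map_comp.
- congr (_ + _); apply: eq_splitsum => u v _ _.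
  by rewrite /tpar -map_comp.
Qed.

Lemma ev_split n (g : precochain E E n) (N : lmodType {poly K}) (phi : X ->
  lpoly N p) (s : seq X) :
  (forall q, {morph (fun y => phi (q, y)) : y z / y + z}) ->
  ev g phi s = ev g (fun z => phi (z.1, ina (pra z.2))) s + ev g (fun z =>
    phi (z.1, inb (prb z.2))) s.
Proof.
move=> phiD; rewrite -evDc; apply: eq_ev => -[q y] /=.
by rewrite {1}[y]dsumE phiD.
Qed.

End Typed.

Lemma pure_ina (x : a) : pure true (ina x). Proof. exact: eqxx. Qed.
Lemma pure_inb (u : b) : pure false (inb u). Proof. exact: eqxx. Qed.

Section SuppStar.
Variables (A B C : nat -> Prop).
Hypothesis ABC : forall i j k, A i -> B j -> (i + j = k.+1)%N -> C k.

(** The value of g falls in a and counts as an input of f in a, or it falls in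
    b and does not; either way the number j of inputs in a satisfies j + e + 1
    = i1 + i2 with i1 in A and i2 in B. The offset e is 0 for the a-part of f
    and 1 for its b-part. *)
Lemma supported_ins m n k (f : precochain E E m) (g : precochain E E n) (N :
  lmodType {poly K}) e p
    (chi : point p E -> lpoly N p) (s : seq (bool * point p E)) :
  is_cochain f -> sesqui chi -> supported B g ->
  (forall t, impure t = 0%N -> ~ A (cnt t + e)%N -> ev f chi (map snd t) = 0) ->
  k = (m + n)%N -> impure s = 0%N -> ~ C (cnt s + e)%N ->
  ev (star f g : precochain E E k) chi (map snd s) = 0.
Proof.
move=> fC gchi gB fA kE s0 Cs; rewrite (ev_star _ _ _ kE gchi) splitsum_map.
rewrite -[RHS](@splitsum0 _ ((fun=> 1%N) \o snd) _ _ n.+1 s); apply: eq_splitsum =>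
  u v _ uv.
have phiD q : {morph (fun y => ev f chi ((q, y) :: map snd v)) : y z / y + z}.
  by have [hD _] := ev_sesqui fC gchi [::] (map snd v) q.
rewrite (ev_split _ _ phiD) /=.
have sE : cnt s = (cnt u + cnt v)%N by rewrite -cnt_cat; apply/esym/uv.
have : (impure u + impure v = 0)%N by rewrite -impure_cat -s0; apply: uv.
move=> /eqP; rewrite addn_eq0 => /andP [/eqP u0 /eqP v0].
rewrite [X in X + _](_ : _ = 0); last first.
  (* the a-part of the value of g, then its b-part *)
  have [Bu|Bu] := pselect (B (cnt u)); last first.
    apply: (supported_ev_a gB (chi := fun z => ev f chi ((z.1,
      ina z.2) :: map snd v)) _ u0 Bu) => q y z /=.
    by rewrite linearD phiD.
  apply: (etrans _ (ev0c N g (map snd u))); apply: eq_ev => z.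
  apply: (fA ((true, (z.1, ina (pra z.2))) :: v));
    first by rewrite -[LHS]/(nat_of_bool (~~ pure true _) + impure v)%N pure_ina v0.
  move=> Av; apply: Cs; apply: (ABC Av Bu); rewrite sE /cnt /=; lia.
rewrite add0r; have [Bu|Bu] := pselect (B (cnt u).+1); last first.
  apply: (supported_ev_b gB (chi := fun z => ev f chi ((z.1,
    inb z.2) :: map snd v)) _ u0 Bu) => q y z /=.
  by rewrite linearD phiD.
apply: (etrans _ (ev0c N g (map snd u))); apply: eq_ev => z.
apply: (fA ((false, (z.1, inb (prb z.2))) :: v));
  first by rewrite -[LHS]/(nat_of_bool (~~ pure false _) + impure v)%N pure_inb v0.
move=> Av; apply: Cs; apply: (ABC Av Bu); rewrite sE /cnt /=; lia.
Qed.

Lemma supported_star m n k (f : precochain E E m) (g : precochain E E n) :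
  is_cochain f -> supported A f -> supported B g -> k = (m + n)%N ->
  supported C (star f g : precochain E E k).
Proof.
move=> fC fA gB kE x c xc.
pose s : seq (bool * point k E) := [seq (c i, (lvar K i, x i)) | i : 'I_k.+1].
have sE : map snd s = pts x by rewrite -map_comp.
have cs : cnt s = (\sum_i c i)%N by rewrite /cnt -map_comp sumnE big_map big_enum.
have s0 : impure s = 0%N.
  rewrite /impure -map_comp sumnE big_map big_enum /= big1 // => i _.
  by rewrite xc.
split=> Cc; rewrite ev_lmap -sE.
  apply: (@supported_ins m n k f g a 0%N) => //; first exact: chi0_lin_sesqui.
    move=> t t0; rewrite addn0 => At; apply: (supported_ev_a fA (chi :=
      @chi0 K k a)) => // q.
    by have [] := @chi0_sesqui K k a q.
  by rewrite cs addn0.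
apply: (@supported_ins m n k f g b 1%N) => //; first exact: chi0_lin_sesqui.
  move=> t t0; rewrite addn1 => At; apply: (supported_ev_b fA (chi :=
    @chi0 K k b)) => // q.
  by have [] := @chi0_sesqui K k b q.
by rewrite cs addn1.
Qed.

End SuppStar.

(** By linearity in each argument in turn: k bounds the positions that may
    still be impure. *)
Lemma pure_ext n (h : precochain E E n) : is_cochain h ->
  (forall x c, (forall i, pure (c i) (x i)) -> h x = 0) -> forall x, h x = 0.
Proof.
move=> hC h0; suff H k : forall x (c : 'I_n.+1 -> bool),
    (forall i : 'I_n.+1, (k <= i)%N -> pure (c i) (x i)) -> h x = 0.
  (* for k = n.+1 no argument is required to be pure, so the kinds are
     arbitrary *)
  by move=> x; apply: (H n.+1 x (fun=> true)) => i; rewrite leqNgt ltn_ord.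
elim: k => [|k IH] x c xc; first by apply: (h0 x c) => i; apply: xc.
have [nk|nk] := leqP n.+1 k.
  by apply: (IH x c) => i ki; have := ltn_ord i; lia.
pose i := Ordinal nk; have xE : x = upd x i (1%:P *: ina (pra (x i)) +
  inb (prb (x i))).
  apply/funext => j; rewrite updE; case: eqP => // ->.
  by rewrite polyC1 scale1r -dsumE.
have pur d e : pure d e -> forall j : 'I_n.+1, (k <= j)%N ->
   pure ((fun j => if j == i then d else c j) j) (upd x i e j).
  move=> de j kj; rewrite updE /=; case: eqP => // /eqP ji; apply: xc.
  by move: ji; rewrite -val_eqE /=; lia.
rewrite xE coch_lin // (IH _ _ (pur true _ (pure_ina _))).
by rewrite (IH _ _ (pur false _ (pure_inb _))) scaler0 addr0.
Qed.

End Dsum.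

(** * Lifts and the projection *)

Section HatProj.
Variables (K : fieldType) (a b : lmodType {poly K}).
Local Notation E := (dsum a b).
Local Notation ina := (@ina K a b).
Local Notation inb := (@inb K a b).
Local Notation pra := (@pra K a b).
Local Notation prb := (@prb K a b).
Implicit Types (f g h : cfam E E).

Lemma cochains_nr f g : cochains f -> cochains g -> cochains (nr f g).
Proof.
move=> fC gC p; rewrite /nr.
have H (r : seq 'I_p.+1) : is_cochain ((fun x => \sum_(n <- r)
  (star (f (p - n)%N) (g n) x - (-1) ^+ ((p - n) * n) *: star (g n) (f
    (p - n)%N) x)) : precochain E E p).
  elim: r => [|n r IH].
    rewrite (_ : (fun x => _) = (fun=> 0)); first exact: is_cochain0.
    by apply/funext => x; rewrite big_nil.
  have pn : p = (p - n + n)%N by rewrite subnK // -ltnS.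
  have pn' : p = (n + (p - n))%N by rewrite addnC.
  rewrite (_ : (fun x => _) = (fun x => (1%:P)%:MP *: ((- (-1) ^+ ((p - n) * n) :
    K)%:P%:MP *: star (g n) (f (p - n)%N) x
     + star (f (p - n)%N) (g n) x) + \sum_(n <- r)
  (star (f (p - n)%N) (g n) x - (-1) ^+ ((p - n) * n) *: star (g n) (f
    (p - n)%N) x))); last first.
    apply/funext => x; rewrite big_cons polyC1 mpolyC1 scale1r rmorphN /= rmorphN
      /= scalar_emb_sign scaleNr.
    by rewrite [X in X + _]addrC.
  by apply: is_cochain_lin => //; apply: is_cochain_lin; apply: star_cochain.
exact: H.
Qed.

Lemma hatE (f : cfam b a) n x : hat f n x = lmap ina (f n (fun i => prb (x i))).
Proof. by []. Qed.

Lemma hat_lin c (f g : cfam b a) : hat (c *: f + g) = c *: hat f + hat g.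
Proof.
by apply: cfamP => n x; rewrite -[RHS]/(_ *: hat f n x + hat g n x) !hatE lmapD lmapZ.
Qed.

Lemma hat0 : hat (0 : cfam b a) = 0.
Proof. by apply: cfamP => n x; rewrite hatE lmap0. Qed.

Lemma hat_cochains (f : cfam b a) : cochains f -> cochains (hat f).
Proof. by move=> fC n; apply: (cochain_comp prb ina). Qed.

Lemma hat_cochain_deg n (f : cfam b a) : cochain_deg n f -> cochain_deg n (hat f).
Proof.
move=> [f0 fn]; split; last exact: (cochain_comp prb ina).
by move=> k x kn; rewrite hatE f0 // lmap0.
Qed.

Lemma hat_deg_deg n h : hat_deg n h -> cochain_deg n h.
Proof. by move=> [f fC ->]; apply: hat_cochain_deg. Qed.

Definition resF h : cfam b a := fun n u => lmap pra (h n (fun i => inb (u i))).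

Lemma projFE h : projF h = hat (resF h). Proof. by []. Qed.

Lemma resF_cochains h : cochains h -> cochains (resF h).
Proof. by move=> hC n; apply: (cochain_comp inb pra). Qed.

Lemma resF_deg n h : cochain_deg n h -> cochain_deg n (resF h).
Proof.
move=> [h0 hn]; split; last exact: (cochain_comp inb pra).
by move=> k x kn; rewrite /resF h0 // lmap0.
Qed.

Lemma resF_lin c f g : resF (c *: f + g) = c *: resF f + resF g.
Proof.
apply: cfamP => n u; rewrite -[RHS]/(_ *: lmap pra (f n _) + lmap pra (g n _)).
by rewrite -lmapZ -lmapD.
Qed.

Lemma resF_hat (f : cfam b a) : resF (hat f) = f.
Proof. by apply: cfamP => n u; rewrite /resF hatE lmap_praK. Qed.

Lemma resFD : {morph resF : f g / f + g}.
Proof. by move=> f g; rewrite -{1}[f]scale1r resF_lin scale1r. Qed.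

Lemma resF0 : resF 0 = 0.
Proof. by rewrite -{1}hat0 resF_hat. Qed.

Lemma projF_lin c f g : projF (c *: f + g) = c *: projF f + projF g.
Proof. by rewrite !projFE resF_lin hat_lin. Qed.

Lemma projF0 : projF (0 : cfam E E) = 0.
Proof. by rewrite projFE; apply: cfamP => n x; rewrite hatE /resF !lmap0. Qed.

Lemma projFD f g : projF (f + g) = projF f + projF g.
Proof. by rewrite -[f]scale1r projF_lin !scale1r. Qed.

Lemma projF_sum (I : Type) (r : seq I) (P : pred I) (F : I -> cfam E E) :
  projF (\sum_(i <- r | P i) F i) = \sum_(i <- r | P i) projF (F i).
Proof. exact: (big_morph _ projFD projF0). Qed.

Lemma hat_sum (I : Type) (r : seq I) (P : pred I) (F : I -> cfam b a) :
  hat (\sum_(i <- r | P i) F i) = \sum_(i <- r | P i) hat (F i).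
Proof.
apply: (big_morph _ _ hat0) => f g; by rewrite -[f]scale1r hat_lin !scale1r.
Qed.

Lemma projF_hat (f : cfam b a) : projF (hat f) = hat f.
Proof. by rewrite projFE resF_hat. Qed.

Lemma projF_deg n h : cochain_deg n h -> hat_deg n (projF h).
Proof. by move=> hC; exists (resF h) => //; apply: resF_deg. Qed.

Lemma gspan_hat h : gspan (@hat_deg K a b) h <-> exists2 f,
  gspan (@cochain_deg K b a) f & h = hat f.
Proof.
split=> [[n [v [vd ->]]]|[f [n [v [vd ->]]] ->]].
  exists (resF (\sum_i v i)); last first.
    rewrite -projFE projF_sum; apply: eq_bigr => i _.
    by have [f _ ->] := vd i; rewrite projF_hat.
  exists n, (fun i => resF (v i)); split=> [i|]; first exact/resF_deg/hat_deg_deg.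
  exact: (big_morph resF resFD resF0).
exists n, (fun i => hat (v i)); split=> [i|]; last exact: hat_sum.
by exists (v i).
Qed.

Lemma hat_graded : graded_space (@hat_deg K a b).
Proof.
split=> [n|n c x y [f fC ->] [g gC ->]|n v vd sv0 i].
- by exists 0; [apply: gr_zero (cochain_graded _ _) n|rewrite hat0].
- by exists (c *: f + g); [exact: (gr_lin
  (cochain_graded b a) c fC gC)|rewrite hat_lin].
- by apply: (gr_direct (cochain_graded E E) _ sv0) => j; apply: hat_deg_deg.
Qed.

Definition supportedf (A : nat -> Prop) h : Prop := forall n, supported A (h n).

Lemma supported_lin A n c (f g : precochain E E n) : supported A f -> supported A g ->
  supported A (fun x => c *: f x + g x).
Proof.
move=> fA gA x t xt; have [fa fb] := fA x t xt; have [ga gb] := gA x t xt.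
by split=> At; rewrite lmapD lmapZ ?fa ?fb ?ga ?gb // scaler0 addr0.
Qed.

Lemma supported0 A n : supported A ((fun=> 0) : precochain E E n).
Proof. by move=> x t xt; rewrite !lmap0. Qed.

Lemma supportedf_nr (A B C : nat -> Prop) f g :
  (forall i j k, A i -> B j -> (i + j = k.+1)%N -> C k) ->
  cochains f -> cochains g -> supportedf A f -> supportedf B g ->
    supportedf C (nr f g).
Proof.
move=> ABC fC gC fA gB p.
have BAC i j k : B i -> A j -> (i + j = k.+1)%N -> C k.
  by move=> Bi Aj ij; apply: (ABC j i) => //; rewrite addnC.
rewrite /nr.
have H (r : seq 'I_p.+1) : supported C ((fun x => \sum_(n <- r)
  (star (f (p - n)%N) (g n) x - (-1) ^+ ((p - n) * n) *: star (g n) (f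
    (p - n)%N) x)) : precochain E E p).
  elim: r => [|n r IH].
    rewrite (_ : (fun x => _) = (fun=> 0)); first exact: supported0.
    by apply/funext => x; rewrite big_nil.
  have pn : p = (p - n + n)%N by rewrite subnK // -ltnS.
  have pn' : p = (n + (p - n))%N by rewrite addnC.
  rewrite (_ : (fun x => _) = (fun x => 1 *: (- (-1) ^+ ((p - n) * n) *: star
    (g n) (f (p - n)%N) x
     + star (f (p - n)%N) (g n) x) + \sum_(n <- r)
  (star (f (p - n)%N) (g n) x - (-1) ^+ ((p - n) * n) *: star (g n) (f
    (p - n)%N) x))); last first.
    by apply/funext => x; rewrite big_cons scale1r scaleNr [X in X + _]addrC.
  by apply: supported_lin => //; apply: supported_lin;
    [apply: (supported_star BAC)|apply: (supported_star ABC)].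
exact: H.
Qed.

Lemma supportedf_none f : cochains f -> supportedf (fun=> False) f -> f = 0.
Proof.
move=> fC f0; apply: cfamP => n; apply: (pure_ext (fC n)) => x c xc.
have [fa fb] := f0 n x c xc.
by rewrite [f n x]lmap_dsum fa ?fb ?lmap0 ?addr0.
Qed.

Lemma coch_slot0 (M N : lmodType {poly K}) n (f : precochain M N n) x i :
  is_cochain f -> f (upd x i 0) = 0.
Proof.
move=> fC; have := coch_lin fC x i (-1) 0 0.
by rewrite scaler0 addr0 polyCN mpolyCN polyC1 mpolyC1 scaleN1r addNr.
Qed.

(** A lift sees only the b-parts of its arguments, so it vanishes as soon as
    one argument lies in a. *)
Lemma supportedf_hat (f : cfam b a) : cochains f -> supportedf (eq 0%N) (hat f).
Proof.
move=> fC n x c xc; rewrite hatE lmap_praK lmap_prb_ina; split=> // /eqP.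
rewrite eq_sym sum_nat_eq0 negb_forall => /existsP [i ci].
have ci1 : c i by move: ci; case: (c i).
have -> : (fun j => prb (x j)) = upd (fun j => prb (x j)) i 0.
  apply/funext => j; rewrite updE; case: eqP => // ->.
  by have := xc i; rewrite ci1 => /eqP.
exact: coch_slot0.
Qed.

Lemma all_b_pure n (x : 'I_n -> E) (c : 'I_n -> bool) : (forall i,
  pure (c i) (x i)) ->
  (\sum_i c i = 0)%N -> x = fun i => inb (prb (x i)).
Proof.
move=> xc /eqP; rewrite sum_nat_eq0 => /forallP c0; apply/funext => i.
by apply: pure_b; have := xc i; have := c0 i; case: (c i).
Qed.

Lemma supportedf_projF0 (A : nat -> Prop) h : ~ A 0%N -> supportedf A h ->
  projF h = 0.
Proof.
move=> A0 hA; apply: cfamP => n x; rewrite projFE hatE /resF.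
have [ha _] := hA n (fun i => inb (prb (x i))) (fun=> false) (fun i => pure_inb _ _).
by rewrite ha ?lmap0 // big1.
Qed.

(** On arguments in b the a-part vanishes by assumption; elsewhere there is an
    argument in a, and the shifted count for outputs in b is always positive. *)
Lemma supportedf_ge1 h : projF h = 0 -> supportedf (fun j => (0 < j)%N) h.
Proof.
move=> h0 n x c xc; split=> // /negP; rewrite -eqn0Ngt => /eqP c0.
have := congr1 (fun f : cfam E E => lmap pra (f n x)) h0.
by rewrite projFE hatE lmap_praK lmap0 /resF -(all_b_pure xc c0).
Qed.

(** Both sides agree on pure arguments: they vanish if some argument lies in
    a, and on arguments from b the cochain has values in a. *)
Lemma supportedf_projF h : cochains h -> supportedf (eq 0%N) h -> projF h = h.
Proof.
move=> hC h0; apply/eqP; rewrite -subr_eq0 -scaleN1r addrC; apply/eqP.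
have pC : cochains (projF h) by apply/hat_cochains/resF_cochains.
apply: supportedf_none; first exact: cochains_lin.
have pA' : supportedf (eq 0%N) (projF h) by apply/supportedf_hat/resF_cochains.
move=> n; have pA := pA' n.
rewrite -[X in supported _ X]/(fun x => (-1)%:P%:MP *: h n x + projF h n x).
move=> x c xc; have [ha hb] := h0 n x c xc; have [pa pb] := pA x c xc.
split=> _; rewrite lmapD lmapZ; last by rewrite hb ?pb ?scaler0 ?addr0.
have [c0|c0] := eqVneq (\sum_i c i)%N 0%N; last first.
  by rewrite ha ?pa ?scaler0 ?addr0 // => e; rewrite -e in c0.
rewrite projFE hatE lmap_praK /resF -(all_b_pure xc c0).
by rewrite polyCN mpolyCN polyC1 mpolyC1 scaleN1r addNr.
Qed.

End HatProj.

(** * V-data of a square-zero cochain *)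

Section VData.
Variables (K : fieldType) (a b : lmodType {poly K}).
Local Notation E := (dsum a b).
Local Notation L := (@cochain_deg K E E).
Local Notation F := (@hat_deg K a b).
Implicit Types (f g h : cfam E E).

Lemma gspan_hat_gspan h : gspan F h -> gspan L h.
Proof. by apply: gspan_mono => n y; apply: hat_deg_deg. Qed.

Lemma supportedf_gspan_hat h : gspan F h -> supportedf (eq 0%N) h.
Proof. by move=> /gspan_hat [f fC ->]; apply/supportedf_hat/gspan_cochains. Qed.

(** Two cochains of weight 0 have a product of weight -1, which is none. *)
Lemma nr_hat_abelian f g : gspan F f -> gspan F g -> nr f g = 0.
Proof.
move=> Ff Fg; have [fC gC] := (gspan_cochains (gspan_hat_gspan Ff),
  gspan_cochains (gspan_hat_gspan Fg)).
apply: supportedf_none; first exact: cochains_nr.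
by apply: (supportedf_nr _ fC gC (supportedf_gspan_hat Ff)
  (supportedf_gspan_hat Fg)) => i j k <- <-.
Qed.

(** The kernel consists of the weights at least 1, and the sum of two such
    weights, minus 1, is again at least 1. *)
Lemma ker_projF_nr f g : cochains f -> cochains g -> projF f = 0 -> projF g = 0 ->
  projF (nr f g) = 0.
Proof.
move=> fC gC f0 g0; apply: (@supportedf_projF0 _ _ _ (fun j => (0 < j)%N)) => //.
apply: (supportedf_nr _ fC gC (supportedf_ge1 f0) (supportedf_ge1 g0)) => i j k; lia.
Qed.

Lemma nr_vdata Delta : L 1%N Delta -> projF Delta = 0 -> nr Delta Delta = 0 ->
  vdata L (@nr K E) (gspan F) (@projF K a b) Delta.
Proof.
move=> D1 PD DD; have lie := nr_graded_lie E; have sp := gl_space lie.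
split=> //.
- split=> [|c x y|x|x y Fx Fy].
  + exact: gspan0.
  + by apply: gspan_lin; apply: hat_graded.
  + apply: gspan_mono => n y Fy; split; first exact: hat_deg_deg.
    exact: (gspan_gr (hat_graded a b) Fy).
  + by rewrite nr_hat_abelian //; apply: gspan0.
- exact: nr_hat_abelian.
- by move=> *; apply: projF_lin.
- by move=> x _; rewrite [projF x]projFE projF_hat.
- move=> y; split=> [Fy|[x Lx ->]].
    exists y; first exact: gspan_hat_gspan.
    by have [f _ ->] := (gspan_hat y).1 Fy; rewrite projF_hat.
  have [n [v [vd ->]]] := Lx; exists n, (fun i => projF (v i)).
  by split=> [i|]; [apply: projF_deg|rewrite projF_sum].
- split=> [|c x y [Lx x0] [Ly y0]|x [[n [v [vd ->]]]]|x y [Lx x0] [Ly y0]].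
  + by split; [apply: gspan0|apply: projF0].
  + by split; [apply: gspan_lin|rewrite projF_lin x0 y0 scaler0 addr0].
  + rewrite projF_sum => v0; exists n, v; split=> // i; split; first exact: vd.
    split; first exact: (gspan_gr sp (vd i)).
    apply: (gr_direct (hat_graded a b) (v := fun i => projF (v i))) => // j.
    exact: projF_deg.
  + by split; [apply: gspan_br|apply: ker_projF_nr => //; apply: gspan_cochains].
Qed.

End VData.

(** * The lambda-bracket as a square-zero cochain *)

Section Omega.
Variables (K : fieldType).

Section Conformal.
Variables (E : lmodType {poly K}) (br : E -> E -> lpoly E 1).
Hypothesis lc : lie_conformal br.

Definition arity2 (h : E -> E -> lpoly E 1) : precochain E E 1 := fun x =>
  h (x ord0) (x ord_max).

Lemma ord2P (i : 'I_2) : i = ord0 \/ i = ord_max.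
Proof. by case: i => [[|[|i]]] // ilt; [left|right]; apply: val_inj. Qed.

Lemma lvar1_max : lvar K (ord_max : 'I_2) = - 'X_ord0 - dd K 1.
Proof. by rewrite /lvar unlift_none big_ord_recl big_ord0 addr0. Qed.

Lemma lvar1_0 : lvar K (ord0 : 'I_2) = 'X_ord0.
Proof.
by rewrite -lvar_lift; congr lvar; apply: val_inj.
Qed.

(** A permutation of two arguments is trivial or the transposition, and then
    the axiom is the skew-symmetry of the lambda-bracket. *)
Lemma br_cochain : is_cochain (arity2 br).
Proof.
split=> [x i c y z|x i|x s]; rewrite /arity2.
- by have [->|->] := ord2P i; rewrite !updE /= ?(lc_linl lc) ?(lc_linr lc).
- have [->|->] := ord2P i; rewrite !updE /=.
    by rewrite lvar1_0 (lc_sesql lc).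
  by rewrite lvar1_max (lc_sesqr lc) opprB opprK.
have [s0|s0] := eqVneq (s ord0) ord0.
  have -> : s = 1%g.
    apply/permP => i; rewrite perm1; have [->//|->] := ord2P i.
    have [e|//] := ord2P (s ord_max); have := @perm_inj _ s ord0 ord_max.
    by rewrite s0 e => /(_ erefl).
  rewrite odd_perm1 scale1r /= !perm1; apply/esym/lbind_X => i.
  by rewrite perm1 lvar_lift.
have -> : s = tperm ord0 ord_max.
  have e0 : s ord0 = ord_max by have [e|//] := ord2P (s ord0); rewrite e in s0.
  apply/permP => i; have [->|->] := ord2P i; rewrite ?tpermL ?tpermR //.
  have [//|e] := ord2P (s ord_max); have := @perm_inj _ s ord0 ord_max.
  by rewrite e0 e => /(_ erefl).
rewrite odd_tperm /= expr1 scaleN1r (lc_skew lc) tpermL tpermR; congr (- _).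
apply: eq_lbind => // i; have -> : lift ord_max i = ord0 by apply: val_inj;
  case: i => [[]].
by rewrite tpermL lvar1_max.
Qed.

Lemma ev_arity2 p (N : lmodType {poly K}) (h : E -> E -> lpoly E 1) (chi :
  point p E -> lpoly N p) z w :
  ev (arity2 h) chi [:: z; w] = lbind (fun=> z.1) (fun y => chi (z.1 + w.1,
    y)) (h z.2 w.2).
Proof.
rewrite /ev /arity2 /= big_cons big_seq1; apply: eq_lbind => // i.
by case: i => [[]].
Qed.

Lemma ev_arity2_chi0 p (h : E -> E -> lpoly E 1) z w : z.1 + w.1 = - dd K p ->
  ev (arity2 h) (@chi0 K p E) [:: z; w] = lsubst (fun=> z.1) (h z.2 w.2).
Proof.
by move=> zw; rewrite ev_arity2; apply: eq_lbind => // y; rewrite /chi0 zw eqxx.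
Qed.

Lemma pts3 (x : 'I_3 -> E) : pts x =
  [:: (lvar K ord0, x ord0); (lvar K (inord 1), x (inord 1)); (lvar K ord_max,
    x ord_max)].
Proof.
rewrite /pts /image_mem enum_ordSl enum_ordSr (enum_ordSr 0).
have -> : enum 'I_0 = [::] by apply: size0nil; rewrite size_enum_ord.
rewrite /=; congr [:: _; _; _].
- have -> // : lift ord0 (widen_ord (leqnSn 1) ord_max) = inord 1 :> 'I_3.
  by apply: val_inj; rewrite /= inordK.
- by have -> : lift ord0 ord_max = ord_max :> 'I_3 by apply: val_inj.
Qed.

(** The three unshuffles give the three terms of the Jacobi identity, once the
    two terms where the inner bracket is the second argument are rewritten by
    skew-symmetry. *)
Lemma br_square (x : 'I_3 -> E) : star (arity2 br) (arity2 br) x = 0.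
Proof.
have cC := br_cochain; have c0 := @chi0_sesqui K 2 E.
have skew z w : ev (arity2 br) (@chi0 K 2 E) [:: z; w] =
  - ev (arity2 br) (@chi0 K 2 E) [:: w; z].
  by rewrite (ev_skew cC c0 [::]) muln1 scaleN1r.
rewrite starE // pts3 /= !(add0r, addr0).
rewrite muln0 scale1r !muln1 expr1 scaleN1r -[tpar _ _]/2%N sqrrN expr1n scale1r.
set q0 := lvar K (ord0 : 'I_3); set q1 := lvar K (inord 1 : 'I_3); set q2 :=
  lvar K (ord_max : 'I_3).
have q0E : q0 = 'X_ord0 by rewrite /q0 -lvar_lift; congr lvar; apply: val_inj.
have q1E : q1 = 'X_ord_max.
  by rewrite /q1 -lvar_lift; congr lvar; apply: val_inj; rewrite /= inordK.
have qs : q0 + q1 + q2 = - dd K 2.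
  rewrite -sum_lvar big_ord_recr big_ord_recr big_ord_recr big_ord0 /= add0r.
  congr (lvar _ _ + lvar _ _ + lvar _ _); apply: val_inj => //.
  by rewrite /= inordK.
rewrite !ev_arity2 /=.
transitivity (lbind (fun=> q0) (fun w => lsubst (fun=> q0 +
  q1) (br w (x ord_max))) (br (x ord0) (x (inord 1)))
  + lbind (fun=> q0) (fun w => lsubst (fun=> q1) (br (x (inord 1)) w)) (br
    (x ord0) (x ord_max))
  - lbind (fun=> q1) (fun w => lsubst (fun=> q0) (br (x ord0) w)) (br (x
    (inord 1)) (x ord_max))).
  congr (_ + _ + _).
  - by apply: eq_lbind => // w; rewrite ev_arity2_chi0 //= qs.
  - rewrite -scaleN1r -lbindZh; apply: eq_lbind => // w.
    by rewrite skew ev_arity2_chi0 ?scaleN1r ?opprK //= addrCA addrA.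
  - rewrite -scaleN1r -lbindZh; apply: eq_lbind => // w.
    by rewrite skew ev_arity2_chi0 ?scaleN1r //= addrA.
rewrite q0E q1E; apply/eqP; rewrite subr_eq0; apply/eqP/esym.
exact: (lc_jacobi lc).
Qed.

End Conformal.
End Omega.

(** * The three components of the lambda-bracket *)

Lemma omega_terms (V : zmodType) (x1 x2 x3 x4 x5 : V) :
  x1 + x2 + (x3 + x4 + x5) = x3 + (x1 + x4) + (x2 + x5).
Proof. by rewrite !addrA [LHS](ACl (3*1*4*2*5))%AC. Qed.

Section Components.
Variables (K : fieldType) (a b : lmodType {poly K}).
Local Notation E := (dsum a b).
Local Notation ina := (@ina K a b).
Local Notation inb := (@inb K a b).
Local Notation pra := (@pra K a b).
Local Notation prb := (@prb K a b).
Variable br : E -> E -> lpoly E 1.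
Hypothesis qt : quasi_twilled br.

Let lc : lie_conformal br. Proof. by case: qt. Qed.
Let subb : conformal_subalgebra br (fun e => pra e = 0). Proof. by case: qt. Qed.

Definition ona : {linear E -> E} := ina \o pra.
Definition onb : {linear E -> E} := inb \o prb.

Lemma onE e : e = ona e + onb e. Proof. exact: dsumE. Qed.

Lemma brDl x y z : br (x + y) z = br x z + br y z.
Proof. by have := lc_linl lc 1 x y z; rewrite polyC1 mpolyC1 !scale1r. Qed.
Lemma brDr x y z : br z (x + y) = br z x + br z y.
Proof. by have := lc_linr lc 1 x y z; rewrite polyC1 mpolyC1 !scale1r. Qed.
Lemma br0l z : br 0 z = 0.
Proof. by apply: (@addrI _ (br 0 z)); rewrite -brDl !addr0. Qed.
Lemma br0r z : br z 0 = 0.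
Proof. by apply: (@addrI _ (br z 0)); rewrite -brDr !addr0. Qed.

Lemma pra_br_b (u v : b) : lmap pra (br (inb u) (inb v)) = 0.
Proof.
by apply: lpolyP => m; rewrite lcoef_lmap lcoef0; apply: (csub_br subb).
Qed.

Definition br_aa x y := br (ona x) (ona y).
Definition br_bb x y := br (onb x) (onb y).
Definition br_ab x y := br (ona x) (onb y) + br (onb x) (ona y).

Lemma br_split x y : br x y = br_aa x y + br_ab x y + br_bb x y.
Proof. by rewrite {1}[x]onE {1}[y]onE brDl !brDr /br_ab !addrA. Qed.

(** As a difference, the mixed part is visibly a cochain, although its two
    summands are not skew separately. *)
Lemma br_abE x y : br_ab x y = br x y - br_aa x y - br_bb x y.
Proof. by rewrite br_split addrAC addrK addrAC subrr add0r. Qed.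

Lemma lmap_ona n (P : lpoly E n) : lmap ona P = lmap ina (lmap pra P).
Proof. by rewrite lmap_comp. Qed.
Lemma lmap_onb n (P : lpoly E n) : lmap onb P = lmap inb (lmap prb P).
Proof. by rewrite lmap_comp. Qed.
Lemma lmap_pra_ona n (P : lpoly E n) : lmap pra (lmap ona P) = lmap pra P.
Proof. by rewrite lmap_ona lmap_praK. Qed.
Lemma lmap_prb_onb n (P : lpoly E n) : lmap prb (lmap onb P) = lmap prb P.
Proof. by rewrite lmap_onb lmap_prbK. Qed.
Lemma lmap_prb_ona n (P : lpoly E n) : lmap prb (lmap ona P) = 0.
Proof. by rewrite lmap_ona lmap_prb_ina. Qed.
Lemma lmap_pra_onb n (P : lpoly E n) : lmap pra (lmap onb P) = 0.
Proof. by rewrite lmap_onb lmap_pra_inb. Qed.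

Definition psi2 x y := lmap onb (br_aa x y).
Definition nu1_2 x y := lmap ona (br_aa x y) + lmap onb (br_ab x y).
Definition nu2_2 x y := lmap ona (br_ab x y) + lmap onb (br_bb x y).

Lemma eq_cochain2 h h' : (forall x y, h x y = h' x y) ->
  cochain2 h = cochain2 h' :> cfam E E.
Proof. by move=> hh; congr cochain2; apply/funext => x; apply/funext => y. Qed.

Lemma psi_hatE : psi_hat br = cochain2 psi2.
Proof.
by apply: eq_cochain2 => x y; rewrite /lpair lmap0 add0r /psi2 lmap_onb.
Qed.

(** It turns the terms of nu_1 and nu_2 with reversed arguments into brackets
    in the given order. *)
Lemma skew_lmap (M : lmodType {poly K}) (h : {linear E -> M}) x y :
  - neg_lambda_dd (lmap h (br y x)) = lmap h (br x y).
Proof. by rewrite [in RHS](lc_skew lc) lmapN /neg_lambda_dd lmap_lsubst. Qed.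

Lemma nu1_hatE : nu1_hat br = cochain2 nu1_2.
Proof.
apply: eq_cochain2 => x y; rewrite /lpair /rhoa skew_lmap /nu1_2 lmap_ona lmap_onb.
congr (_ + lmap inb _); exact: (esym (lmapD prb _ _)).
Qed.

Lemma nu2_hatE : nu2_hat br = cochain2 nu2_2.
Proof.
apply: eq_cochain2 => x y; rewrite /lpair /rhob skew_lmap /nu2_2 lmap_ona lmap_onb.
congr (lmap ina _ + _); rewrite addrC; exact: (esym (lmapD pra _ _)).
Qed.

Lemma cochain2D h h' : cochain2 (fun x y => h x y + h' x y) = cochain2 h +
  cochain2 h' :> cfam E E.
Proof. by apply: cfamP => -[|[|n]] x //; rewrite -[RHS]/(0 + 0) addr0. Qed.

(** The only part of the bracket that the three components miss is the a-part
    of brackets of elements of b, and this vanishes because b is a subalgebra. *)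
Lemma Omega_sum : Omega br = psi_hat br + nu1_hat br + nu2_hat br.
Proof.
rewrite psi_hatE nu1_hatE nu2_hatE -!cochain2D; apply: eq_cochain2 => x y.
rewrite /psi2 /nu1_2 /nu2_2.
have Eb : lmap ona (br_bb x y) = 0 by rewrite lmap_ona pra_br_b lmap0.
rewrite [LHS]lmap_dsum -lmap_ona -lmap_onb br_split !lmapD Eb addr0.
by rewrite omega_terms.
Qed.

Section Cochains.

Lemma brC : is_cochain (arity2 br). Proof. exact: br_cochain. Qed.

Lemma br_aa_cochain : is_cochain (arity2 br_aa).
Proof.
rewrite (_ : arity2 br_aa = fun x => lmap idfun (arity2 br (fun i => ona (x i)))).
  exact: (cochain_comp ona idfun brC).
by apply/funext => x; rewrite lmap_id.
Qed.

Lemma br_bb_cochain : is_cochain (arity2 br_bb).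
Proof.
rewrite (_ : arity2 br_bb = fun x => lmap idfun (arity2 br (fun i => onb (x i)))).
  exact: (cochain_comp onb idfun brC).
by apply/funext => x; rewrite lmap_id.
Qed.

Lemma br_ab_cochain : is_cochain (arity2 br_ab).
Proof.
rewrite (_ : arity2 br_ab = fun x => (-1)%:P%:MP *: arity2 br_bb x +
  ((-1)%:P%:MP *: arity2 br_aa x + arity2 br x)).
  by apply: is_cochain_lin; [exact: br_bb_cochain|apply: is_cochain_lin;
    [exact: br_aa_cochain|exact: brC]].
apply/funext => x; rewrite polyCN mpolyCN polyC1 mpolyC1 !scaleN1r /arity2 br_abE.
by rewrite [RHS]addrC [X in _ = X + _]addrC.
Qed.

Lemma arity2_lmap_cochain (h : {linear E -> E}) (g : E -> E -> lpoly E 1) :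
  is_cochain (arity2 g) ->
  is_cochain (arity2 (fun x y => lmap h (g x y))).
Proof. by move=> gC; apply: (cochain_comp idfun h gC). Qed.

Lemma arity2_add_cochain (g g' : E -> E -> lpoly E 1) : is_cochain (arity2 g) ->
  is_cochain (arity2 g') ->
  is_cochain (arity2 (fun x y => g x y + g' x y)).
Proof.
move=> gC gC'; rewrite (_ : arity2 _ = fun x => 1%:P%:MP *: arity2 g x + arity2 g' x).
  exact: is_cochain_lin.
by apply/funext => x; rewrite polyC1 mpolyC1 scale1r.
Qed.

Lemma cochain2_deg (g : E -> E -> lpoly E 1) : is_cochain (arity2 g) ->
  cochain_deg 1 (cochain2 g : cfam E E).
Proof. by move=> gC; split=> // -[|[|k]]. Qed.

Lemma Omega_deg : cochain_deg 1 (Omega br). Proof. exact: cochain2_deg brC. Qed.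
Lemma psi_deg : cochain_deg 1 (psi_hat br).
Proof. by rewrite psi_hatE; apply: cochain2_deg;
  apply/arity2_lmap_cochain/br_aa_cochain. Qed.
Lemma nu1_deg : cochain_deg 1 (nu1_hat br).
Proof.
by rewrite nu1_hatE; apply: cochain2_deg; apply: arity2_add_cochain;
  apply: arity2_lmap_cochain; [exact: br_aa_cochain|exact: br_ab_cochain].
Qed.
Lemma nu2_deg : cochain_deg 1 (nu2_hat br).
Proof.
by rewrite nu2_hatE; apply: cochain2_deg; apply: arity2_add_cochain;
  apply: arity2_lmap_cochain; [exact: br_ab_cochain|exact: br_bb_cochain].
Qed.

End Cochains.

Lemma supportedf_cochain2 A (g : E -> E -> lpoly E 1) :
  (forall s t x y, pure s x -> pure t y ->
     (~ A (s + t)%N -> lmap pra (g x y) = 0) /\ (~ A (s + t).+1 ->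
       lmap prb (g x y) = 0)) ->
  supportedf A (cochain2 g : cfam E E).
Proof.
move=> gA [|[|n]] x c xc; try by rewrite !lmap0.
have := gA (c ord0) (c ord_max) (x ord0) (x ord_max) (xc _) (xc _).
rewrite !big_ord_recl big_ord0 addn0 /=.
by have -> : lift ord0 ord0 = ord_max :> 'I_2 by apply: val_inj.
Qed.

Lemma ona_pure s x : pure s x -> ona x = if s then x else 0.
Proof.
by case: s => xp; [rewrite [RHS](pure_a xp)|rewrite (pure_b xp)];
  rewrite /ona /= ?linear0.
Qed.
Lemma onb_pure s x : pure s x -> onb x = if s then 0 else x.
Proof.
by case: s => xp; [rewrite (pure_a xp)|rewrite [RHS](pure_b xp)];
  rewrite /onb /= ?linear0.
Qed.

Lemma psi_supported : supportedf (eq 3%N) (psi_hat br).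
Proof.
rewrite psi_hatE; apply: supportedf_cochain2 => s t x y xs yt.
rewrite /psi2 lmap_pra_onb lmap_prb_onb /br_aa (ona_pure xs) (ona_pure yt).
by split=> // n3; case: s t {xs yt} n3 => [] [] //=; rewrite ?br0l ?br0r ?lmap0.
Qed.

Lemma nu1_supported : supportedf (eq 2%N) (nu1_hat br).
Proof.
rewrite nu1_hatE; apply: supportedf_cochain2 => s t x y xs yt.
split=> n2; rewrite /nu1_2 lmapD ?lmap_pra_ona ?lmap_pra_onb ?lmap_prb_ona
  ?lmap_prb_onb ?addr0 ?add0r;
  rewrite /br_ab /br_aa ?(ona_pure xs) ?(ona_pure yt) ?(onb_pure xs) ?(onb_pure yt);
  by case: s t {xs yt} n2 => [] [] //= n2; rewrite ?br0l ?br0r ?addr0 ?lmap0 //;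
    case: n2.
Qed.

Lemma nu2_supported : supportedf (eq 1%N) (nu2_hat br).
Proof.
rewrite nu2_hatE; apply: supportedf_cochain2 => s t x y xs yt.
split=> n2; rewrite /nu2_2 lmapD ?lmap_pra_ona ?lmap_pra_onb ?lmap_prb_ona
  ?lmap_prb_onb ?addr0 ?add0r;
  rewrite /br_ab /br_bb ?(ona_pure xs) ?(ona_pure yt) ?(onb_pure xs) ?(onb_pure yt);
  by case: s t {xs yt} n2 => [] [] //= n2; rewrite ?br0l ?br0r ?addr0 ?lmap0 //;
    case: n2.
Qed.

Lemma projF_Omega : projF (Omega br) = 0.
Proof.
have E1 : projF (psi_hat br) = 0 by apply: supportedf_projF0 psi_supported.
have E2 : projF (nu1_hat br) = 0 by apply: supportedf_projF0 nu1_supported.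
have E3 : projF (nu2_hat br) = 0 by apply: supportedf_projF0 nu2_supported.
by rewrite Omega_sum !projFD E1 E2 E3 !addr0.
Qed.

Lemma Omega_square : nr (Omega br) (Omega br) = 0.
Proof.
apply: cfamP => p x; have [pE|pE] := eqVneq p 2;
  last exact: nr_out Omega_deg Omega_deg pE.
rewrite (nr_homog _ Omega_deg Omega_deg pE); move: x; rewrite pE => x.
by rewrite [star _ _ x](br_square lc) scaler0 subrr.
Qed.

Lemma Omega_vdata : vdata (@cochain_deg K E E) (@nr K E) (gspan (@hat_deg K a b))
  (@projF K a b) (Omega br).
Proof. by apply: nr_vdata; [exact: Omega_deg|exact: projF_Omega|exact:
  Omega_square]. Qed.

End Components.

(** * Derived brackets of the components *)

Section Brackets.
Variables (K : fieldType) (a b : lmodType {poly K}).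
Local Notation E := (dsum a b).
Local Notation F := (@hat_deg K a b).
Implicit Types (f g h : cfam E E).

Definition weight k h : Prop := cochains h /\ supportedf (eq k) h.

Lemma weight_nr k h f : weight k.+1 h -> gspan F f -> weight k (nr h f).
Proof.
move=> [hC hA] Ff; have fC := gspan_cochains (gspan_hat_gspan Ff).
split; first exact: cochains_nr.
apply: (supportedf_nr _ hC fC hA (supportedf_gspan_hat Ff)) => i j l <- <-; lia.
Qed.

Lemma weight0_nr h f : weight 0 h -> gspan F f -> nr h f = 0.
Proof.
move=> [hC hA] Ff; have fC := gspan_cochains (gspan_hat_gspan Ff).
apply: supportedf_none; first exact: cochains_nr.
by apply: (supportedf_nr _ hC fC hA (supportedf_gspan_hat Ff)) => i j l <- <-.
Qed.

Lemma nr0l f : cochains f -> nr 0 f = 0.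
Proof.
move=> fC; have := nr_linl (-1) (@cochains0 K E E) (@cochains0 K E E) fC.
by rewrite scaler0 addr0 scaleN1r addNr.
Qed.

Lemma nrDl f g h : cochains f -> cochains g -> cochains h -> nr (f + g) h =
  nr f h + nr g h.
Proof. by move=> *; rewrite -[f]scale1r nr_linl // !scale1r. Qed.

Lemma foldl_nr0 s : {in s, forall f, gspan F f} -> foldl (@nr K E) 0 s = 0.
Proof.
elim: s => [|f s IH] sF //=.
rewrite nr0l; last by apply/gspan_cochains/gspan_hat_gspan/sF; rewrite mem_head.
by apply: IH => g gs; apply: sF; rewrite inE gs orbT.
Qed.

Lemma foldl_nrD f g s : cochains f -> cochains g -> {in s, forall f, gspan F f} ->
  foldl (@nr K E) (f + g) s = foldl (@nr K E) f s + foldl (@nr K E) g s.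
Proof.
elim: s f g => [|h s IH] f g fC gC sF //=.
have hC : cochains h by apply/gspan_cochains/gspan_hat_gspan/sF; rewrite mem_head.
rewrite nrDl // IH //; try exact: cochains_nr.
by move=> k ks; apply: sF; rewrite inE ks orbT.
Qed.

Lemma foldl_weight s k m h : weight m h -> m = (size s + k)%N ->
  {in s, forall f, gspan F f} -> weight k (foldl (@nr K E) h s).
Proof.
move=> hm mE sF; rewrite {m}mE in hm; elim: s h hm sF => [|f s IH] h hw sF //=;
  apply: IH.
  by apply: weight_nr => //; apply: sF; rewrite mem_head.
by move=> g gs; apply: sF; rewrite inE gs orbT.
Qed.

(** The weight drops by 1 with each bracket, and bracketing a cochain of
    weight 0 with a lift gives 0. *)
Lemma foldl_weight_small s k h : weight k h -> (k < size s)%N -> {in s, forall f,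
  gspan F f} ->
  foldl (@nr K E) h s = 0.
Proof.
elim: s k h => [|f s IH] [|k] h //= hw ks sF.
  rewrite weight0_nr //; last by apply: sF; rewrite mem_head.
  by apply: foldl_nr0 => g gs; apply: sF; rewrite inE gs orbT.
apply: (IH k) => //; first by apply: weight_nr => //; apply: sF; rewrite mem_head.
by move=> g gs; apply: sF; rewrite inE gs orbT.
Qed.

Lemma projF_weight k h : weight k.+1 h -> projF h = 0.
Proof. by move=> [_ hA]; apply: supportedf_projF0 hA. Qed.

Lemma projF_weight0 h : weight 0 h -> projF h = h.
Proof. by move=> [hC hA]; apply: supportedf_projF. Qed.

Lemma projF_sum1 f g h : weight 2 f -> weight 1 g -> weight 0 h ->
  projF f + projF g + projF h = h.
Proof.
move=> f2 g1 h0; rewrite (projF_weight f2) (projF_weight g1) (projF_weight0 h0).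
by rewrite addr0 add0r.
Qed.

Lemma projF_sum2 f g h : weight 1 f -> weight 0 g -> h = 0 ->
  projF f + projF g + projF h = g.
Proof.
move=> f2 g1 ->; rewrite (projF_weight f2) (projF_weight0 g1) projF0.
by rewrite addr0 add0r.
Qed.

Lemma projF_sum3 f g h : weight 0 f -> g = 0 -> h = 0 ->
  projF f + projF g + projF h = f.
Proof. by move=> f0 -> ->; rewrite (projF_weight0 f0) projF0 !addr0. Qed.

Variable br : E -> E -> lpoly E 1.
Hypothesis qt : quasi_twilled br.
Local Notation l := (voronov (@nr K E) (@projF K a b) (Omega br)).

Lemma psi_weight : weight 3 (psi_hat br).
Proof. by split; [apply/cochain_deg_cochains/psi_deg|apply: psi_supported]. Qed.
Lemma nu1_weight : weight 2 (nu1_hat br).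
Proof. by split; [apply/cochain_deg_cochains/nu1_deg|apply: nu1_supported]. Qed.
Lemma nu2_weight : weight 1 (nu2_hat br).
Proof. by split; [apply/cochain_deg_cochains/nu2_deg|apply: nu2_supported]. Qed.

Lemma voronov_split s : {in s, forall f, gspan F f} ->
  l s = projF (foldl (@nr K E) (psi_hat br) s) +
    projF (foldl (@nr K E) (nu1_hat br) s)
    + projF (foldl (@nr K E) (nu2_hat br) s).
Proof.
move=> sF; rewrite /voronov (Omega_sum qt).
have [[pC _] [n1C _] [n2C _]] := And3 psi_weight nu1_weight nu2_weight.
rewrite !foldl_nrD // ?projFD //.
by rewrite -[psi_hat br]scale1r; apply: cochains_lin.
Qed.

Lemma voronov1 f : gspan F f -> l [:: f] = nr (nu2_hat br) f.
Proof.
move=> Ff; have sF : {in [:: f], forall g, gspan F g} by move=> g; rewrite inE =>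
  /eqP ->.
have W3 : weight 2 (foldl (@nr K E) (psi_hat br) [:: f]).
  exact: (foldl_weight psi_weight (erefl : 3 = size [:: f] + 2)%N sF).
have W2 : weight 1 (foldl (@nr K E) (nu1_hat br) [:: f]).
  exact: (foldl_weight nu1_weight (erefl : 2 = size [:: f] + 1)%N sF).
have W1 : weight 0 (foldl (@nr K E) (nu2_hat br) [:: f]).
  exact: (foldl_weight nu2_weight (erefl : 1 = size [:: f] + 0)%N sF).
exact: etrans (voronov_split sF) (projF_sum1 W3 W2 W1).
Qed.

Lemma voronov2 f g : gspan F f -> gspan F g -> l [:: f; g] = nr (nr (nu1_hat br) f) g.
Proof.
move=> Ff Fg; have sF : {in [:: f; g], forall h, gspan F h}.
  by move=> h; rewrite !inE => /orP [] /eqP ->.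
have W3 : weight 1 (foldl (@nr K E) (psi_hat br) [:: f; g]).
  exact: (foldl_weight psi_weight (erefl : 3 = size [:: f; g] + 1)%N sF).
have W2 : weight 0 (foldl (@nr K E) (nu1_hat br) [:: f; g]).
  exact: (foldl_weight nu1_weight (erefl : 2 = size [:: f; g] + 0)%N sF).
have W1 : foldl (@nr K E) (nu2_hat br) [:: f; g] = 0.
  exact: (foldl_weight_small nu2_weight).
exact: etrans (voronov_split sF) (projF_sum2 W3 W2 W1).
Qed.

Lemma voronov3 f g h : gspan F f -> gspan F g -> gspan F h ->
  l [:: f; g; h] = nr (nr (nr (psi_hat br) f) g) h.
Proof.
move=> Ff Fg Fh; have sF : {in [:: f; g; h], forall k, gspan F k}.
  by move=> k; rewrite !inE => /or3P [] /eqP ->.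
have W3 : weight 0 (foldl (@nr K E) (psi_hat br) [:: f; g; h]).
  exact: (foldl_weight psi_weight (erefl : 3 = size [:: f; g; h] + 0)%N sF).
have W2 : foldl (@nr K E) (nu1_hat br) [:: f; g; h] = 0.
  exact: (foldl_weight_small nu1_weight).
have W1 : foldl (@nr K E) (nu2_hat br) [:: f; g; h] = 0.
  exact: (foldl_weight_small nu2_weight).
exact: etrans (voronov_split sF) (projF_sum3 W3 W2 W1).
Qed.

Lemma voronov4 s : (4 <= size s)%N -> {in s, forall f, gspan F f} -> l s = 0.
Proof.
move=> s4 sF; rewrite (voronov_split sF) (foldl_weight_small nu2_weight _ sF);
  last by lia.
rewrite (foldl_weight_small nu1_weight _ sF); last by lia.
by rewrite (foldl_weight_small psi_weight _ sF) // projF0 !addr0.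
Qed.

End Brackets.

(** * Bracketing with a module homomorphism *)

Section SmallSplittings.
Variables (X : Type) (R : pzRingType) (T : lmodType R) (F : seq X -> seq X -> T).

Lemma splitsum_1_2 x y : splitsum (fun=> 1%N) 1 F [:: x; y] =
  F [:: x] [:: y] - F [:: y] [:: x].
Proof. by rewrite /= add0r addr0 muln0 scale1r -[tpar _ _]/1%N muln1 expr1
  scaleN1r. Qed.

Lemma splitsum_2_2 x y : splitsum (fun=> 1%N) 2 F [:: x; y] = F [:: x; y] [::].
Proof. by rewrite /= !addr0. Qed.

End SmallSplittings.

Section MaurerCartan.
Variables (K : fieldType) (a b : lmodType {poly K}).
Local Notation E := (dsum a b).
Local Notation F := (@hat_deg K a b).
Local Notation ina := (@ina K a b).
Local Notation inb := (@inb K a b).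
Local Notation pra := (@pra K a b).
Local Notation prb := (@prb K a b).
Variable B : {linear b -> a}.
Local Notation beta := (hat (hom_cochain B)).

Lemma hom_cochain_deg : cochain_deg 0 (hom_cochain B).
Proof.
split=> [[|k]//|]; split=> [x i c y z|x i|x s]; rewrite /hom_cochain.
- by rewrite (ord1 i) !updE /= linearP lconstD lconstZ.
- rewrite (ord1 i) !updE /= linearZ /= lconstZ; congr (_ *: _).
  have -> : lvar K (ord0 : 'I_1) = - dd K 0.
    by rewrite -sum_lvar big_ord_recl big_ord0 addr0.
  by rewrite opprK.
have -> : s = 1%g by apply/permP => i; rewrite perm1 (ord1 i) (ord1 (s _)).
by rewrite odd_perm1 scale1r /= perm1; apply/esym/lbind_X; case.
Qed.

Lemma beta_gspan : gspan F beta.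
Proof.
apply: (gspan_gr (hat_graded a b) (n := 0%N)).
by exists (hom_cochain B) => //; apply: hom_cochain_deg.
Qed.

Definition onB : {linear E -> E} := ina \o B \o prb.

Lemma onBK x : onB (onB x) = 0.
Proof. by rewrite /onB /= linear0 linear0. Qed.

Lemma beta0E x : beta 0%N x = lconst 0 (onB (x ord0)).
Proof. by rewrite hatE /= lmap_const. Qed.

Lemma beta_deg : cochain_deg 0 beta.
Proof. exact/hat_cochain_deg/hom_cochain_deg. Qed.

(** The bracket with the lift of B on cochains with two arguments, by
    [nr_beta]. *)
Definition adB (h : E -> E -> lpoly E 1) (x y : E) : lpoly E 1 :=
  h (onB x) y + h x (onB y) - lmap onB (h x y).

Lemma ev_beta p (N : lmodType {poly K}) (chi : point p E -> lpoly N p) z :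
  sesqui chi ->
  ev (beta 0%N) chi [:: z] = chi (z.1, onB z.2).
Proof.
move=> gchi; rewrite /ev /= beta0E big_seq1 lbind_const //.
by have [] := gchi z.1.
Qed.

Lemma pts2 (x : 'I_2 -> E) : pts x = [:: (lvar K ord0, x ord0); (lvar K ord_max,
  x ord_max)].
Proof.
rewrite /pts /image_mem enum_ordSl (enum_ordSl 0).
have -> : enum 'I_0 = [::] by apply: size0nil; rewrite size_enum_ord.
by rewrite /=; have -> : lift ord0 ord0 = ord_max :> 'I_2 by apply: val_inj.
Qed.

Lemma ev_pts2 (h : E -> E -> lpoly E 1) x y :
  ev (arity2 h) (@chi0 K 1 E) [:: (lvar K ord0, x); (lvar K ord_max, y)] = h x y.
Proof.
pose w := fun i : 'I_2 => if i == ord0 then x else y.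
have -> : [:: (lvar K ord0, x); (lvar K ord_max, y)] = pts w by rewrite pts2.
exact: ev_pts.
Qed.

Lemma star_beta_r h x : is_cochain (arity2 h) ->
  star (arity2 h) (beta 0%N) x = h (onB (x ord0)) (x ord_max) +
    h (x ord0) (onB (x ord_max)) :> lpoly E 1.
Proof.
move=> hC; have c0 := @chi0_sesqui K 1 E.
rewrite (starE _ _ _ (erefl : 1 = 1 + 0)%N) pts2.
have g0 := ev_sesqui hC c0 [::].
rewrite splitsum_1_2.
rewrite (ev_beta _ (g0 [:: (lvar K ord_max,
  x ord_max)])) (ev_beta _ (g0 [:: (lvar K ord0, x ord0)])).
congr (_ + _); first exact: ev_pts2.
have -> := ev_skew hC c0 [::] (lvar K ord_max, onB (x ord_max)) (lvar K ord0,
  x ord0) [::].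
by rewrite muln1 expr1 scaleN1r opprK [[::] ++ _]/= ev_pts2.
Qed.

Lemma star_beta_l h x :
  star (beta 0%N) (arity2 h) x = lmap onB (h (x ord0) (x ord_max)) :> lpoly E 1.
Proof.
have c0 := @chi0_sesqui K 1 E.
rewrite (starE _ _ _ (erefl : 1 = 0 + 1)%N) (ev_lmap onB (arity2 h) x) pts2.
rewrite splitsum_2_2; apply: eq_ev => z; exact: (ev_beta z c0).
Qed.

Lemma nr_beta h : is_cochain (arity2 h) -> nr (cochain2 h) beta = cochain2 (adB h).
Proof.
move=> hC; have hd : cochain_deg 1 (cochain2 h : cfam E E) by split=> // -[|[|k]].
have bd := beta_deg.
apply: cfamP => p x; have [pE|pE] := eqVneq p 1; last first.
  by rewrite (nr_out _ hd bd pE); case: p pE x => [|[|p]].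
move: x; rewrite pE => x; rewrite (nr_homog _ hd bd (erefl : 1 = 1 + 0)%N).
rewrite muln0 expr0 scale1r.
by congr (_ - _); [exact: star_beta_r|exact: star_beta_l].
Qed.

Lemma adB_cochain h : is_cochain (arity2 h) -> is_cochain (arity2 (adB h)).
Proof.
move=> hC; have hd : cochain_deg 1 (cochain2 h : cfam E E) by split=> // -[|[|k]].
by have := (nr_deg hd beta_deg).2; rewrite nr_beta.
Qed.

End MaurerCartan.

(** * The Maurer-Cartan equation *)

Lemma ad2_terms (V : zmodType) (p q r : V) : 0 + p - q + (p + 0 - r) - (q +
  r - 0) = (p - q - r) *+ 2.
Proof.
rewrite add0r addr0 subr0 mulr2n opprD !addrA.
by rewrite [RHS](ACl (1*2*4*3*5*6))%AC.
Qed.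

Lemma ad3_terms (V : zmodType) (p : V) : (- p) *+ 2 + (- p) *+ 2 - p *+ 2 = - p *+ 6.
Proof. by rewrite -mulNrn -!mulrnDr. Qed.

Lemma curvature_terms (V : zmodType) (p s t w p' s' t' w' : V) :
  s + t - w' + (p - s' - t') - p' = p + s + (t + w) - w - (p' + s' + (t' + w')).
Proof.
rewrite !addrA addrK !opprD !addrA.
by rewrite [LHS](ACl (4*1*2*7*5*6*3))%AC.
Qed.

Section MCEquation.
Variables (K : fieldType) (a b : lmodType {poly K}).
Local Notation E := (dsum a b).
Local Notation F := (@hat_deg K a b).
Local Notation ina := (@ina K a b).
Local Notation inb := (@inb K a b).
Local Notation pra := (@pra K a b).
Local Notation prb := (@prb K a b).
Variable br : E -> E -> lpoly E 1.
Hypothesis qt : quasi_twilled br.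
Hypothesis K0 : forall n, n.+1%:R != 0 :> K.
Variable B : {linear b -> a}.
Local Notation beta := (hat (hom_cochain B)).
Local Notation onB := (onB B).
Local Notation l := (voronov (@nr K E) (@projF K a b) (Omega br)).

Let brDl := brDl qt.
Let brDr := brDr qt.
Let br0l := br0l qt.
Let br0r := br0r qt.

Lemma lmap_onBK n (P : lpoly E n) : lmap onB (lmap onB P) = 0.
Proof. by apply: lpolyP => m; rewrite !lcoef_lmap lcoef0 onBK. Qed.

Definition ad2 x y := br (onB x) (onB y) - lmap onB (br (onB x) y) - lmap onB
  (br x (onB y)).
Definition ad3 x y := lmap onB (br (onB x) (onB y)).

(** Since B composed with itself vanishes on the sum of a and b, all terms
    with two B in succession drop out and the others occur twice. *)
Lemma adB2E x y : adB B (adB B br) x y = ad2 x y *+ 2.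
Proof.
by rewrite /ad2 -ad2_terms /adB !onBK br0l br0r !lmapD !lmapN lmap_onBK.
Qed.

Lemma adB3E x y : adB B (adB B (adB B br)) x y = - ad3 x y *+ 6.
Proof.
rewrite /ad3 -ad3_terms {1}/adB !adB2E /ad2 !onBK !br0l !br0r !lmap0 !sub0r !subr0.
by rewrite !mulr2n !lmapD !lmapN !lmap_onBK oppr0 !addr0 !opprD !sub0r.
Qed.

Lemma inv_scale (n p : nat) (M : lmodType {poly K}) (z : lpoly M p) :
  (n.+1%:R^-1 : K)%:P%:MP *: (z *+ n.+1) = z.
Proof.
rewrite -scaler_nat scalerA -(rmorph_nat (@scalar_emb K p))
  -[_%:P%:MP]/(@scalar_emb K p _) -rmorphM.
by rewrite mulVf // rmorph1 scale1r.
Qed.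

Definition curvature x y := adB B br x y + ad2 x y - ad3 x y.

(** The sum is the effect of conjugating the bracket with the automorphism
    that maps x to x + B x, up to the bracket itself. *)
Lemma curvatureE x y : curvature x y =
  br (onB x + x) (onB y + y) - br x y - lmap onB (br (onB x + x) (onB y + y)).
Proof.
rewrite brDl !brDr !lmapD; exact: curvature_terms.
Qed.

Lemma projF_eq0 (h : E -> E -> lpoly E 1) :
  projF (cochain2 h) = 0 <-> forall u v, lmap pra (h (inb u) (inb v)) = 0.
Proof.
split=> [h0 u v|h0].
  have := congr1 (fun f : cfam E E => lmap pra (f 1 (fun i =>
    if i == ord0 then inb u else inb v))) h0.
  by rewrite projFE hatE lmap_praK lmap0.
apply: cfamP => -[|[|n]] x; rewrite projFE hatE /resF; last by rewrite !lmap0.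
  by rewrite !lmap0.
by rewrite h0 lmap0.
Qed.

Lemma scale_cochain2 c (h : E -> E -> lpoly E 1) :
  c *: (cochain2 h : cfam E E) = cochain2 (fun x y => c%:P%:MP *: h x y).
Proof. by apply: cfamP => -[|[|n]] x //; exact: scaler0. Qed.

Lemma mc_sum : l [:: beta] + 2%:R^-1 *: l [:: beta; beta] + 6%:R^-1 *: l [:: beta;
  beta; beta] =
  projF (cochain2 curvature).
Proof.
have brC := brC qt; have b1 := adB_cochain B brC; have b2 := adB_cochain B b1.
rewrite /voronov /= -[Omega br]/(cochain2 br :
  cfam E E) (nr_beta _ brC) (nr_beta _ b1) (nr_beta _ b2).
have PL (c d : K) (f g h : cfam E E) : projF f + c *: projF g + d *: projF h =
    projF (d *: h + (c *: g + f)).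
  by rewrite !projF_lin addrC [X in _ = _ + X]addrC.
rewrite PL; congr (projF _); rewrite !scale_cochain2 -!cochain2D.
apply: eq_cochain2 => x y; rewrite adB3E adB2E !inv_scale.
by rewrite /curvature addrC [ad2 x y + _]addrC.
Qed.

Lemma graphE u : (B u, u) = onB (inb u) + inb u :> E.
Proof. by congr (_, _); rewrite /= ?addr0 ?add0r. Qed.

(** At u and v in b the last lemma involves brackets of elements of the graph,
    and the bracket of u and v has no a-part. *)
Lemma deformation_mc : left_deformation_map br B <-> projF (cochain2 curvature) = 0.
Proof.
have W0 u v : lmap pra (curvature (inb u) (inb v)) =
    lmap pra (br (B u, u) (B v, v)) - lmap B (lmap prb (br (B u, u) (B v, v))).
  rewrite curvatureE -!graphE !lmapD !lmapN (pra_br_b qt) subr0; congr (_ - _).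
  by apply: lpolyP => m; rewrite !lcoef_lmap.
rewrite projF_eq0; split=> [S u v|S].
  rewrite W0; apply/eqP; rewrite subr_eq0; apply/eqP/lpolyP => m; rewrite !lcoef_lmap.
  have [||w ->] := csub_br S (x := (B u, u)) (y := (B v, v)) _ _ m;
    [by exists u|by exists v|].
  by [].
split=> [|p x y [u ->] [v ->]|x y [u ->] [v ->] m].
- by exists 0; rewrite linear0.
- by exists (p *: u + v); rewrite linearP.
have /eqP := S u v; rewrite W0 subr_eq0 => /eqP /(congr1 (lcoef m));
  rewrite !lcoef_lmap => e.
exists (prb (lcoef m (br (B u, u) (B v, v)))); rewrite -e.
by case: (lcoef m _).
Qed.

(** The series stops at the third term whatever bound is used to truncate it,
    since the brackets with more arguments vanish. *)
Lemma maurer_cartanE : maurer_cartan F l beta <->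
  l [:: beta] + 2%:R^-1 *: l [:: beta; beta] + 6%:R^-1 *: l [:: beta; beta; beta] = 0.
Proof.
have lk k : (3 < k)%N -> l (nseq k beta) = 0.
  move=> k3; apply: (voronov4 qt); first by rewrite size_nseq.
  by move=> f; rewrite mem_nseq => /andP [_ /eqP ->]; apply: beta_gspan.
(* two truncations are compared with a common larger one *)
pose t k := (k`!%:R)^-1 *: l (nseq k beta).
have tail n m : (forall k, (n < k)%N -> l (nseq k beta) = 0) -> (n <= m)%N ->
    \sum_(1 <= k < m.+1) t k = \sum_(1 <= k < n.+1) t k.
  move=> tn nm; rewrite (big_cat_nat _ (n := n.+1)) //= [X in _ + X](_ : _ =
    0) ?addr0 //.
  rewrite big_nat_cond big1 // => k /andP [/andP [nk _] _].
  by rewrite /t tn // scaler0.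
have t3 : \sum_(1 <= k < 4) t k =
    l [:: beta] + 2%:R^-1 *: l [:: beta; beta] + 6%:R^-1 *: l [:: beta; beta; beta].
  by rewrite big_nat_recr // big_nat_recr // big_nat1 /t invr1 scale1r.
split=> [[_ [n tn sn]]|s0].
  by rewrite -t3 -(tail 3%N (n + 3)%N lk (leq_addl _ _)) (tail n (n +
    3)%N tn (leq_addr _ _)).
split; first by exists (hom_cochain B) => //; apply: hom_cochain_deg.
by exists 3%N => //; rewrite -/t t3.
Qed.

End MCEquation.

(** * V-data, L-infinity structure and deformation maps *)

Theorem theorem4p17 (R : realType) (a b : lmodType {poly R[i]})
    (br : dsum a b -> dsum a b -> lpoly (dsum a b) 1) :
  quasi_twilled br ->
  let L := @cochain_deg _ (dsum a b) (dsum a b) in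
  let F := @hat_deg _ a b in
  let NR := @nr _ (dsum a b) in
  let C := gspan (@cochain_deg _ b a) in
  let l := voronov NR (@projF _ a b) (Omega br) in
  [/\ Omega br = psi_hat br + nu1_hat br + nu2_hat br,
      vdata L NR (gspan F) (@projF _ a b) (Omega br),
      linfty F l,
      [/\ forall f, C f -> l [:: hat f] = NR (nu2_hat br) (hat f),
          forall f1 f2, C f1 -> C f2 ->
            l [:: hat f1; hat f2] = NR (NR (nu1_hat br) (hat f1)) (hat f2),
          forall f1 f2 f3, C f1 -> C f2 -> C f3 ->
            l [:: hat f1; hat f2; hat f3] =
            NR (NR (NR (psi_hat br) (hat f1)) (hat f2)) (hat f3)
        & forall s : seq (cfam b a), (4 <= size s)%N ->
            {in s, forall f, C f} -> l (map (@hat _ a b) s) = 0]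
    & forall B : {linear b -> a},
        let beta := hat (hom_cochain B) in
        (left_deformation_map br B <-> maurer_cartan F l beta) /\
        (maurer_cartan F l beta <->
           l [:: beta] + 2%:R^-1 *: l [:: beta; beta]
             + 6%:R^-1 *: l [:: beta; beta; beta] = 0)].
Proof.
move=> qt L F NR C l.
have K0 n : n.+1%:R != 0 :> R[i] by rewrite Num.Theory.pnatr_eq0.
have CF f : C f -> gspan F (hat f) by move=> fC; apply/gspan_hat; exists f.
have vd := Omega_vdata qt.
split; first exact: Omega_sum.
- exact: vd.
- apply: (voronov_linfty vd); [exact: hat_graded|exact: hat_deg_deg|exact:
  projF_deg|exact: K0].
- split.
  + by move=> f fC; apply: voronov1 => //; apply: CF.
  + by move=> f1 f2 C1 C2; apply: voronov2 => //; apply: CF.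
  + by move=> f1 f2 f3 C1 C2 C3; apply: voronov3 => //; apply: CF.
  + move=> s s4 sC; apply: voronov4 => //; first by rewrite size_map.
    by move=> _ /mapP [f fs ->]; apply/CF/sC.
move=> B beta; rewrite (maurer_cartanE qt) (mc_sum qt K0) (deformation_mc qt).
by split.
Qed.
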